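(* Let $\psi_0\in\overline X$ be given as initial datum, and let $\tilde\psi_t=\lim_{\varepsilon\to0}\bar\varphi^{\varepsilon}_t$ in $L^2(\nu)$ for $t\in[0,T^*]$, where $\bar\varphi^\varepsilon_t$ is the solution of the regularized evolution equation with initial datum $\psi_0$. Then $\tilde\psi_t=S_0(t)\psi_0$ $\nu$-almost everywhere, where $S_0(t)=e^{-t\overline L_3}$.
   Context: Parameters: $\bar n>0$, $1/9<\alpha<1/6.5$, $\mu\in[1/3,7/16]$, $c_0=0.52$, $a\ge 9$, $a_1=a/c_0$, $\gamma_0\in(0,1/8]$, $\kappa\ge 7$, $\mu'>\mu$; $\varepsilon_0>0$ is the regularization parameter, and ''$\varepsilon\to0$'' means $\varepsilon_0\to0$. Operators: $\nu(dw)=e^{-w}(\ln(1+e^w))^{5/2}\,dw$ on $\mathbb R$, and $$\overline K_3(u,v)=4\bar n\,[\ln(1+e^u)\ln(1+e^v)]^{-3/2}\,\frac{e^{-|u-v|}}{1+e^{-\min(u,v)}+e^{-\max(u,v)}}\;\frac{2+e^{\max(u,v)}}{1-e^{-|u-v|}},$$ $$\overline K_3^{\varepsilon}(u,v)=\overline K_3(u,v)\,\frac{1-e^{-\min(\varepsilon(u,v),|u-v|)}}{1-e^{-\varepsilon(u,v)}},\qquad \varepsilon(u,v)=\varepsilon(\max(u,v)),\qquad \varepsilon(w)=\varepsilon_0\exp\Big(-\frac{\mu'}{\gamma_0}\max(a_1,w)\Big).$$ For $k\in\{\overline K_3,\overline K_3^\varepsilon\}$ let $Q_k(\phi,\psi)=\frac12\int\nu(du)\nu(dv)\,k(u,v)(\phi(u)-\phi(v))^*(\psi(u)-\psi(v))+(\phi,\psi)_{L^2(\nu)}$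 with $D(Q_k)=\{\psi\in L^2(\nu):Q_k(\psi,\psi)<\infty\}$. The associated (Friedrichs) self-adjoint operator $L_k\ge0$ has domain $\{\psi\in D(Q_k):\exists C<\infty,\ |Q_k(\phi,\psi)|\le C\|\phi\|_{L^2(\nu)}\ \forall\phi\in D(Q_k)\}$ and satisfies $(\phi,L_k\psi)=Q_k(\phi,\psi)-(\phi,\psi)$ for $\phi\in D(Q_k)$. Put $\overline L_3=L_{\overline K_3}$, $\overline L_3^\varepsilon=L_{\overline K_3^\varepsilon}$, $S_0(t)=e^{-t\overline L_3}$, $S_\varepsilon(t)=e^{-t\overline L_3^\varepsilon}$. Function spaces: $f(v)=\max\big((\ln(1+e^v))^{-\alpha},(\ln 2)^{-\alpha}\big)$, $\tilde\Gamma(v)=f(v)e^{\mu\max(a,c_0v)}$, and for $v\in\mathbb R$, $r>0$, $$\Gamma_0(v,r)=(f(v)+f(v-r))e^{\mu\max(a,c_0v,v-r)}(1-e^{-\kappa r})^{\gamma_0},\qquad \overline\Gamma_\varepsilon(v,r)=(f(v)+f(v-r))e^{\mu\max(a,c_0v,v-r)}(1-e^{-\kappa(r+\varepsilon(v))})^{\gamma_0/2}.$$ $X$ is the Banach space of continuous functions $\psi$ on $\mathbb R$ with $\sup_v|\psi(v)|/\tilde\Gamma(v)<\infty$. $\overline X$ is the Banach space of continuous $\psi$ on $\mathbb R$ with $\sup_v|\psi(v)|/\tilde\Gamma(v)+\sup_{v,r}|\psi(v)-\psi(v-r)|/\Gamma_0(v,r)<\infty$. Regularized solution: $\bar\varphi^\varepsilon_t$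 is the unique solution, with $\sup_{t\ge 0}\sup_v|\bar\varphi^\varepsilon_t(v)|/\tilde\Gamma(v)<\infty$, of the Duhamel-integrated regularized evolution equation $\bar\varphi^\varepsilon_t=e^{-tV^\varepsilon}\psi_0+\int_0^t ds\,e^{-(t-s)V^\varepsilon}K^\varepsilon[\bar\varphi^\varepsilon_s]$, where $V^\varepsilon(v)=\int\nu(dw)\overline K_3^\varepsilon(v,w)$ and $K^\varepsilon[\varphi](v)=\int\nu(dw)\overline K_3^\varepsilon(v,w)\varphi(w)$. It satisfies $\bar\varphi^\varepsilon_t=S_\varepsilon(t)\psi_0$ $\nu$-almost everywhere. The time $T^*$: $T^*>0$ is a fixed time, independent of $\varepsilon_0$, with the property (established separately) that there is a constant $A_1<\infty$, independent of $\varepsilon_0$, such that for initial data $\psi_0\in\overline X$ one has $|\bar\varphi^\varepsilon_t(v)-\bar\varphi^\varepsilon_t(v-r)|\le A_1\Big(\sup_{v',r'}\frac{|\psi_0(v')-\psi_0(v'-r')|}{\Gamma_0(v',r')}\Big)\overline\Gamma_\varepsilon(v,r)$ for all $t\in[0,T^*]$ and all sufficiently small $\varepsilon_0$. The limit: it is already known that for any sequence of regularization parameters $\varepsilon_n\to0$ (in place of $\varepsilon_0$) the corresponding solutions form a Cauchy sequence in $C([0,T^*],L^2(\nu))$; $\tilde\psi$ denotes the limit (a priori along a fixed such sequence). *)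

(* Defs.v *)
From HB Require Import structures.
From mathcomp Require Import all_boot all_order all_algebra.
From mathcomp Require Import all_classical all_reals all_analysis.
From mathcomp Require Import measurable_realfun complex.

Set Implicit Arguments.
Unset Strict Implicit.
Unset Printing Implicit Defensive.

Import Order.TTheory GRing.Theory Num.Theory.
Import numFieldNormedType.Exports.

Local Open Scope classical_set_scope.
Local Open Scope ring_scope.

Record params (R : realType) := Params {
  par_nbar : R;
  par_alpha : R;
  par_mu : R;
  par_a : R;
  par_gamma0 : R;
  par_kappa : R;
  par_mu' : R;
  par_nbar_gt0 : 0 < par_nbar;
  par_alpha_bounds : 9^-1 < par_alpha < (13 / 2)^-1;
  par_mu_bounds : 3^-1 <= par_mu <= 7 / 16;
  par_a_ge9 : 9 <= par_a;
  par_gamma0_bounds : 0 < par_gamma0 <= 8^-1;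
  par_kappa_ge7 : 7 <= par_kappa;
  par_mu'_gt_mu : par_mu < par_mu' }.

Section measure_nu.
Context {R : realType}.

Definition ln1pexp (v : R) : R := ln (1 + expR v).

Definition nu_density (w : R) : R := expR (- w) * ln1pexp w `^ (5 / 2).

Definition nu (A : set R) : \bar R :=
  (\int[lebesgue_measure]_(w in A) (nu_density w)%:E)%E.

Lemma nu_density_ge0 w : 0 <= nu_density w.
Proof. by rewrite mulr_ge0 ?expR_ge0 ?powR_ge0. Qed.

Lemma ln1pexp_gt0 v : 0 < ln1pexp v.
Proof. by rewrite ln_gt0// ltrDl expR_gt0. Qed.

Lemma ln1pexp_le u v : u <= v -> ln1pexp u <= ln1pexp v.
Proof.
by move=> uv; rewrite ler_ln ?posrE ?addr_gt0 ?expR_gt0// lerD2l ler_expR.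
Qed.

Lemma continuous_ln1pexp : continuous ln1pexp.
Proof.
move=> v; apply: continuous_comp.
  by apply: cvgD; [exact: cvg_cst|exact: continuous_expR].
by apply: continuous_ln; rewrite addr_gt0 ?expR_gt0.
Qed.

Lemma measurable_nu_density : measurable_fun setT nu_density.
Proof.
apply: measurable_funM.
  by apply: measurableT_comp => //; exact: measurable_expR.
apply: (@measurableT_comp _ _ _ _ _ _ (@powR R ^~ (5 / 2))) => //.
exact: continuous_measurable_fun continuous_ln1pexp.
Qed.

Let nu0 : nu set0 = 0%E.
Proof. by rewrite /nu integral_set0. Qed.

Let nu_ge0 A : (0 <= nu A)%E.
Proof. by apply: integral_ge0 => x _; rewrite lee_fin nu_density_ge0. Qed.

Let nu_sigma_additive : semi_sigma_additive nu.
Proof.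
have mf : measurable_fun setT (EFin \o nu_density).
  by apply/measurable_EFinP; exact: measurable_nu_density.
have f0 x : (0 <= (EFin \o nu_density) x)%E by rewrite lee_fin nu_density_ge0.
exact: (@semi_sigma_additive_nng_induced _ _ _ lebesgue_measure _ mf f0).
Qed.

HB.instance Definition _ := isMeasure.Build _ _ _ nu nu0 nu_ge0 nu_sigma_additive.

Let nu_sigma_finite : sigma_finite setT nu.
Proof.
exists (fun n : nat => `[- n%:R, n%:R]%classic).
  apply/esym/seteqP; split => // x _.
  exists (Num.truncn `|x|).+1 => //=; rewrite in_itv /= -ler_norml ltW//.
  exact: truncnS_gt.
move=> n; split; first exact: measurable_itv.
pose c : R := expR n%:R * ln1pexp n%:R `^ (5 / 2).
pose A : set R := `[- n%:R, n%:R]%classic.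
have mA : measurable A by exact: measurable_itv.
have le_c : (nu A <= \int[lebesgue_measure]_(x in A) c%:E)%E.
  rewrite /nu; apply: (@ge0_le_integral _ _ _ lebesgue_measure A mA).
  - by move=> x _; rewrite lee_fin nu_density_ge0.
  - apply: measurable_funTS; apply/measurable_EFinP.
    exact: measurable_nu_density.
  - exact: measurable_cst.
  - move=> x; rewrite /A /= in_itv /= => /andP[nx xn].
    rewrite lee_fin; apply: ler_pM; [exact: expR_ge0|exact: powR_ge0| |].
      by rewrite ler_expR lerNl.
    apply: ge0_ler_powR.
    + by rewrite divr_ge0.
    + by rewrite nnegrE; exact/ltW/ln1pexp_gt0.
    + by rewrite nnegrE; exact/ltW/ln1pexp_gt0.
    + exact: ln1pexp_le.
apply: le_lt_trans le_c _; rewrite integral_cst//.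
have A_fin : (lebesgue_measure A < +oo)%E.
  rewrite lebesgue_measure_itv.
  by case: ifPn => _; rewrite ?ltry// -EFinB ltry.
apply: lte_mul_pinfty => //.
by rewrite lee_fin mulr_ge0 ?expR_ge0 ?powR_ge0.
Qed.

HB.instance Definition _ :=
  Measure_isSigmaFinite.Build _ _ _ nu nu_sigma_finite.

End measure_nu.

Notation Cabs := (@Normc.normc _).

Section complex_L2.
Context {R : realType}.
Implicit Types phi psi : R -> R[i].

Definition cintegral d (T : measurableType d) (m : {measure set T -> \bar R})
    (D : set T) (f : T -> R[i]) : R[i] :=
  ((\int[m]_(x in D) complex.Re (f x)) +i*
   (\int[m]_(x in D) complex.Im (f x)))%C.

Definition cmeasurable d (T : measurableType d) (D : set T) (f : T -> R[i]) :=
  measurable_fun D (fun x => complex.Re (f x)) /\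
  measurable_fun D (fun x => complex.Im (f x)).

Definition ccontinuous psi :=
  continuous (fun x => complex.Re (psi x)) /\
  continuous (fun x => complex.Im (psi x)).

Definition L2norm psi : \bar R := 'N[nu]_2%:E[EFin \o Cabs \o psi].

Definition L2 psi := cmeasurable setT psi /\ (L2norm psi < +oo)%E.

(* antilinear in the first argument *)
Definition inner phi psi : R[i] :=
  cintegral nu setT (fun v => ((phi v)^* * psi v)%C).

End complex_L2.

Section form_operator.
Context {R : realType}.
Implicit Types (k : R -> R -> R) (phi psi eta : R -> R[i]).

(* Q_k(phi, psi), meaningful for phi and psi in [Qform_dom k] *)
Definition Qform k phi psi : R[i] :=
  2^-1 * cintegral (nu \x nu)%E setT (fun z : R * R =>
    ((k z.1 z.2)%:C * (phi z.1 - phi z.2)^* * (psi z.1 - psi z.2))%C)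
  + inner phi psi.

(* Q_k(psi, psi) as an element of [0, +oo] *)
Definition Qform_diag k psi : \bar R :=
  ((2^-1)%:E * \int[nu \x nu]_z
     (k z.1 z.2 * Cabs (psi z.1 - psi z.2) ^+ 2)%:E
   + \int[nu]_v (Cabs (psi v) ^+ 2)%:E)%E.

Definition Qform_dom k psi := L2 psi /\ (Qform_diag k psi < +oo)%E.

Definition op_dom k psi := Qform_dom k psi /\
  exists C : R, forall phi, Qform_dom k phi ->
    ((Cabs (Qform k phi psi))%:E <= C%:E * L2norm phi)%E.

(* graph of L_k, on representatives of classes modulo nu-null functions *)
Definition op_graph k psi eta :=
  [/\ op_dom k psi, L2 eta &
      forall phi, Qform_dom k phi ->
        inner phi eta = Qform k phi psi - inner phi psi].

(* [is_exp_semigroup k S] : S t is the operator e^{-t L_k} on L^2(nu) for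
   t >= 0, i.e. S is the strongly continuous contraction semigroup whose
   infinitesimal generator is exactly - L_k (domain included).  It acts on
   representatives; compatibility with nu-a.e. equality is a consequence of
   linearity and contractivity. *)
Record is_exp_semigroup k (S : R -> (R -> R[i]) -> R -> R[i]) : Prop := {
  semigroup_L2 : forall t psi, 0 <= t -> L2 psi -> L2 (S t psi);
  semigroup_linear : forall t (c : R[i]) phi psi, 0 <= t -> L2 phi -> L2 psi ->
    ae_eq nu setT (S t (fun v => c * phi v + psi v))
                  (fun v => c * S t phi v + S t psi v);
  semigroup_contraction : forall t psi, 0 <= t -> L2 psi ->
    (L2norm (S t psi) <= L2norm psi)%E;
  semigroup0 : forall psi, L2 psi -> ae_eq nu setT (S 0 psi) psi;
  semigroupD : forall s t psi, 0 <= s -> 0 <= t -> L2 psi ->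
    ae_eq nu setT (S (s + t) psi) (S s (S t psi));
  semigroup_cvg0 : forall psi, L2 psi ->
    L2norm (fun v => S h psi v - psi v) @[h --> 0^'+] --> 0%E;
  semigroup_generator : forall psi eta, L2 psi -> L2 eta ->
    (op_graph k psi eta <->
     L2norm (fun v => (h^-1)%:C%C * (psi v - S h psi v) - eta v)
       @[h --> 0^'+] --> 0%E) }.

End form_operator.

Section equation.
Context {R : realType} (p : params R).
Implicit Types (u v w r t e : R) (psi : R -> R[i]) (phi : R -> R -> R[i]).

Local Notation nbar := (par_nbar p).
Local Notation alpha := (par_alpha p).
Local Notation mu := (par_mu p).
Local Notation a := (par_a p).
Local Notation gamma0 := (par_gamma0 p).
Local Notation kappa := (par_kappa p).
Local Notation mu' := (par_mu' p).

Definition c0 : R := 52 / 100.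
Definition a1 : R := a / c0.

(* Only the values off the diagonal u = v, which is (nu \x nu)-null, matter. *)
Definition K3 u v : R :=
  4 * nbar * (ln1pexp u * ln1pexp v) `^ (- (3 / 2))
  * (expR (- `|u - v|)
     / (1 + expR (- Num.min u v) + expR (- Num.max u v)))
  * ((2 + expR (Num.max u v)) / (1 - expR (- `|u - v|))).

Definition eps e0 w : R := e0 * expR (- (mu' / gamma0) * Num.max a1 w).

Definition K3eps e0 u v : R :=
  let e := eps e0 (Num.max u v) in
  K3 u v * ((1 - expR (- Num.min e `|u - v|)) / (1 - expR (- e))).

Definition f_weight v : R :=
  Num.max (ln1pexp v `^ (- alpha)) (ln 2 `^ (- alpha)).

Definition Gamma_tilde v : R := f_weight v * expR (mu * Num.max a (c0 * v)).

Definition Gamma0 v r : R :=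
  (f_weight v + f_weight (v - r))
  * expR (mu * Num.max (Num.max a (c0 * v)) (v - r))
  * (1 - expR (- (kappa * r))) `^ gamma0.

Definition Gamma_bar e0 v r : R :=
  (f_weight v + f_weight (v - r))
  * expR (mu * Num.max (Num.max a (c0 * v)) (v - r))
  * (1 - expR (- (kappa * (r + eps e0 v)))) `^ (gamma0 / 2).

Definition Xnorm psi : \bar R :=
  ereal_sup [set (Cabs (psi v) / Gamma_tilde v)%:E | v in setT].

Definition holder_seminorm psi : \bar R :=
  ereal_sup [set (Cabs (psi z.1 - psi (z.1 - z.2)) / Gamma0 z.1 z.2)%:E
            | z in [set z : R * R | 0 < z.2]].

Definition in_X psi := ccontinuous psi /\ (Xnorm psi < +oo)%E.

Definition in_Xbar psi :=
  ccontinuous psi /\ (Xnorm psi + holder_seminorm psi < +oo)%E.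

Definition Veps e0 v : R := \int[nu]_w K3eps e0 v w.

Definition Keps e0 psi v : R[i] :=
  cintegral nu setT (fun w => (K3eps e0 v w)%:C%C * psi w).

(* Joint measurability in (t, v) gives a meaning to the Lebesgue integrals in
   the Duhamel formula; [phi t] is irrelevant for t < 0. *)
Record is_reg_solution e0 psi0 phi : Prop := {
  reg_measurable : cmeasurable ([set t : R | 0 <= t] `*` [set: R])
    (fun z : R * R => phi z.1 z.2);
  reg_in_X : forall t, 0 <= t -> in_X (phi t);
  reg_bounded :
    (ereal_sup [set Xnorm (phi t) | t in [set t : R | (0 <= t)%R]]
      < +oo)%E;
  reg_duhamel : forall t v, 0 <= t ->
    phi t v = (expR (- (t * Veps e0 v)))%:C%C * psi0 v
      + cintegral lebesgue_measure `[0, t] (fun s =>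
          (expR (- ((t - s) * Veps e0 v)))%:C%C * Keps e0 (phi s) v) }.

Definition is_Tstar (Tstar : R) : Prop :=
  0 < Tstar /\
  exists A1 : R, forall psi0, in_Xbar psi0 ->
    \forall e0 \near 0^'+, forall phi, is_reg_solution e0 psi0 phi ->
      forall t v r, 0 <= t <= Tstar -> 0 < r ->
        ((Cabs (phi t v - phi t (v - r)))%:E <=
         A1%:E * holder_seminorm psi0 * (Gamma_bar e0 v r)%:E)%E.

End equation.

(* Main.v *)
Require Import Defs.
From HB Require Import structures.
From mathcomp Require Import all_boot all_order all_algebra.
From mathcomp Require Import all_classical all_reals all_analysis.
From mathcomp Require Import measurable_realfun complex.
From mathcomp Require Import ring lra.

Set Implicit Arguments.
Unset Strict Implicit.
Unset Printing Implicit Defensive.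

Import Order.TTheory GRing.Theory Num.Theory.
Import numFieldNormedType.Exports.

Local Open Scope classical_set_scope.
Local Open Scope ring_scope.

(** On L^2(nu), seen as a real Hilbert space, compare the orbit
    eta_s = S_0(s) psi0 with the regularized solutions phi^n_s, writing E_0 and
    E_n for the Dirichlet forms of K3 and K3eps.  Since psi0 is Hoelder at the
    diagonal, it lies in the domain of L_0, hence so does eta_s, and the
    energies E_0(eta_s) stay bounded.  The functions phi^n_s are an L^2-curve
    with derivative - L_n phi^n_s, so their norms and their energies
    E_n(phi^n_s) decrease, and E_n(psi0) <= E_0(psi0).  As E_n <= E_0,
      d/ds |eta_s - phi^n_s|^2
        <= 2 |(phi^n_s, L_0 eta_s) - E_n(phi^n_s, eta_s)|.
    If u is the L^2-limit of phi^n_s, then (phi^n_s, L_0 eta_s) tends to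
    (u, L_0 eta_s), while truncating the kernels away from the diagonal shows
    that E_0(u) < oo and that E_n(phi^n_s, eta_s) tends to
    E_0(u, eta_s) = (u, L_0 eta_s).  So the right-hand side is bounded and tends
    to 0 for each s, and by dominated convergence phi^n_t tends to eta_t. *)

(** * L^2 as a real Hilbert space *)

(** Bounds for one regularization parameter are kept apart from bounds uniform in it. For a fixed
    parameter the cutoff makes the kernel integrable, so L_n acts by the pointwise integral [Lop] on
    functions controlled by [Gamma_tilde] alone, and the Duhamel formula can be differentiated in
    L^2(nu). The constants obtained there depend on the parameter and enter no limit. The uniform
    quantities used are norms and energies only. Hence the part of E_n(phi^n_s, eta_s) near the
    diagonal is handled by Cauchy-Schwarz: phi^n_s contributes a bounded energy, and the smallness
    comes from eta_s, a fixed function of finite energy.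

    On the other side eta_s is only a class in L^2(nu). The Hoelder bound is used at time 0; what
    survives at later times is membership in the domain of the generator, which the semigroup
    preserves because it commutes with its difference quotients.

    Real scalar products suffice, since the imaginary part of a sesquilinear form at phi is its real
    part at i phi. *)

Section dotc.
Context {R : realType}.
Implicit Types (z w : R[i]) (c : R).

(** The Euclidean scalar product of the plane, equal to the real part of the conjugate of [z] times
    [w]. *)
Definition dotc z w : R :=
  complex.Re z * complex.Re w + complex.Im z * complex.Im w.

Lemma dotcC z w : dotc z w = dotc w z.
Proof. by rewrite /dotc; ring. Qed.

Lemma dotcDl z1 z2 w : dotc (z1 + z2) w = dotc z1 w + dotc z2 w.
Proof. by case: z1 z2 w => [a b] [c d] [e f]; rewrite /dotc/=; ring. Qed.

Lemma dotcNl z w : dotc (- z) w = - dotc z w.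
Proof. by case: z w => [a b] [c d]; rewrite /dotc/=; ring. Qed.

Lemma dotcNr z w : dotc z (- w) = - dotc z w.
Proof. by rewrite !(dotcC z) dotcNl. Qed.

Lemma dotcZl c z w : dotc (c%:C%C * z) w = c * dotc z w.
Proof. by case: z w => [a b] [d e]; rewrite /dotc/=; ring. Qed.

Lemma dotcZr c z w : dotc z (c%:C%C * w) = c * dotc z w.
Proof. by rewrite !(dotcC z) dotcZl. Qed.

Lemma dotc_ge0 z : 0 <= dotc z z.
Proof. by rewrite /dotc -!expr2 addr_ge0 ?sqr_ge0. Qed.

Lemma dotczz z : dotc z z = Cabs z ^+ 2.
Proof.
by case: z => a b; rewrite /dotc/= sqr_sqrtr ?addr_ge0 ?sqr_ge0// -!expr2.
Qed.

Lemma Cabs_ge0 z : 0 <= Cabs z.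
Proof. by case: z => a b /=; exact: sqrtr_ge0. Qed.

Lemma CabsE z : Cabs z = Num.sqrt (dotc z z).
Proof. by rewrite dotczz sqrtr_sqr ger0_norm ?Cabs_ge0. Qed.

(** Lagrange's identity: the difference of the squares is the square of the determinant. *)
Lemma dotc_abs z w : `|dotc z w| <= Cabs z * Cabs w.
Proof.
rewrite -ler_sqr ?nnegrE ?mulr_ge0 ?Cabs_ge0//.
rewrite real_normK ?num_real// exprMn -!dotczz.
case: z w => [a b] [c d]; rewrite /dotc/= -subr_ge0.
rewrite [leRHS](_ : _ = (a * d - b * c) ^+ 2); last by ring.
exact: sqr_ge0.
Qed.

Lemma dotc_abs2 z w : `|dotc z w| <= Cabs z ^+ 2 + Cabs w ^+ 2.
Proof.
apply: le_trans (dotc_abs z w) _.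
by have := Cabs_ge0 z; have := Cabs_ge0 w; nra.
Qed.

Lemma CabsD z w : Cabs (z + w) <= Cabs z + Cabs w.
Proof. exact: le_normcD. Qed.

Lemma CabsN z : Cabs (- z) = Cabs z.
Proof. by rewrite !CabsE dotcNl dotcNr opprK. Qed.

Lemma CabsB z w : Cabs (z - w) <= Cabs z + Cabs w.
Proof. by rewrite (le_trans (CabsD _ _))// CabsN. Qed.

Lemma CabsBC z w : Cabs (z - w) = Cabs (w - z).
Proof. by rewrite -CabsN opprB. Qed.

Lemma CabsZ c z : Cabs (c%:C%C * z) = `|c| * Cabs z.
Proof.
rewrite !CabsE dotcZl dotcZr mulrA -expr2 sqrtrM ?sqr_ge0//.
by rewrite sqrtr_sqr.
Qed.

Lemma CabsM z w : Cabs (z * w) = Cabs z * Cabs w.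
Proof. exact: Normc.normcM. Qed.

Lemma normRe z : `|complex.Re z| <= Cabs z.
Proof.
case: z => a b /=; rewrite -sqrtr_sqr ler_wsqrtr// lerDl; exact: sqr_ge0.
Qed.

Lemma normIm z : `|complex.Im z| <= Cabs z.
Proof.
case: z => a b /=; rewrite -sqrtr_sqr ler_wsqrtr// lerDr; exact: sqr_ge0.
Qed.

Lemma cReM (z w : R[i]) : complex.Re (z * w) =
  complex.Re z * complex.Re w - complex.Im z * complex.Im w.
Proof. by case: z w => [? ?] [? ?]. Qed.

Lemma cImM (z w : R[i]) : complex.Im (z * w) =
  complex.Re z * complex.Im w + complex.Im z * complex.Re w.
Proof. by case: z w => [? ?] [? ?]. Qed.

Lemma Cabs_le_ReIm z : Cabs z <= `|complex.Re z| + `|complex.Im z|.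
Proof.
rewrite -ler_sqr ?nnegrE ?addr_ge0 ?Cabs_ge0 ?normr_ge0// -dotczz /dotc.
by rewrite sqrrD !real_normK ?num_real// -!expr2; have := normr_ge0 (complex.Re z);
   have := normr_ge0 (complex.Im z); nra.
Qed.

End dotc.

Section L2m.
Context d (T : measurableType d) (R : realType).
Variable m : {measure set T -> \bar R}.
Implicit Types (f g h : T -> R[i]) (c : R).

(** Stated for an arbitrary measure, because it serves both for nu and, on increments, for nu x nu;
    [L2P] identifies it with [L2] in the first case. *)
Definition L2m f := cmeasurable setT f /\
  (\int[m]_x (Cabs (f x) ^+ 2)%:E < +oo)%E.

Definition ip f g : R := \int[m]_x dotc (f x) (g x).

Lemma cmeasurable_dotc f g : cmeasurable setT f -> cmeasurable setT g ->
  measurable_fun setT (fun x => dotc (f x) (g x)).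
Proof.
by move=> [? ?] [? ?]; apply: measurable_funD; apply: measurable_funM.
Qed.

Lemma cmeasurable_sq f : cmeasurable setT f ->
  measurable_fun setT (fun x => Cabs (f x) ^+ 2).
Proof.
by move=> mf; under eq_fun do rewrite -dotczz; exact: cmeasurable_dotc.
Qed.

Lemma cmeasurable_Cabs f : cmeasurable setT f ->
  measurable_fun setT (fun x => Cabs (f x)).
Proof.
move=> mf; under eq_fun do rewrite CabsE.
apply: measurableT_comp; last exact: cmeasurable_dotc.
by apply: continuous_measurable_fun; exact: sqrt_continuous.
Qed.

Lemma cmeasurableD f g : cmeasurable setT f -> cmeasurable setT g ->
  cmeasurable setT (fun x => f x + g x).
Proof.
move=> [f1 f2] [g1 g2]; split.
  under eq_fun do rewrite raddfD/=; exact: measurable_funD.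
by under eq_fun do rewrite raddfD/=; exact: measurable_funD.
Qed.

Lemma cmeasurableM f g : cmeasurable setT f -> cmeasurable setT g ->
  cmeasurable setT (fun x => f x * g x).
Proof.
move=> [f1 f2] [g1 g2]; split.
  under eq_fun do rewrite cReM.
  by apply: measurable_funB; apply: measurable_funM.
under eq_fun do rewrite cImM.
by apply: measurable_funD; apply: measurable_funM.
Qed.

Lemma cmeasurable_cst (a : R[i]) : @cmeasurable R d T setT (fun=> a).
Proof. by split; exact: measurable_cst. Qed.

Lemma cmeasurable_real (k : T -> R) : measurable_fun setT k ->
  cmeasurable setT (fun x => (k x)%:C%C).
Proof. by move=> mk; split => //=; exact: measurable_cst. Qed.

Lemma cmeasurableB f g : cmeasurable setT f -> cmeasurable setT g ->
  cmeasurable setT (fun x => f x - g x).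
Proof.
move=> mf mg; have -> : (fun x => f x - g x) = (fun x => f x + (-1) * g x).
  by apply/funext => x; rewrite mulN1r.
by apply: cmeasurableD => //; apply: cmeasurableM => //; exact: cmeasurable_cst.
Qed.

Lemma L2m_integrable f : L2m f ->
  m.-integrable setT (EFin \o (fun x => Cabs (f x) ^+ 2)).
Proof.
move=> [mf lf]; apply/integrableP; split.
  by apply/measurable_EFinP; exact: cmeasurable_sq.
by under eq_integral do rewrite /= ger0_norm ?sqr_ge0//.
Qed.

Lemma L2m_dotc f g : L2m f -> L2m g ->
  m.-integrable setT (EFin \o (fun x => dotc (f x) (g x))).
Proof.
move=> Lf Lg; have iD := integrableD measurableT (L2m_integrable Lf) (L2m_integrable Lg).
apply: le_integrable iD => //.
  by apply/measurable_EFinP; apply: cmeasurable_dotc; [case: Lf|case: Lg].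
move=> x _ /=; rewrite lee_fin.
by rewrite (le_trans (dotc_abs2 _ _))// ler_norm.
Qed.

Lemma L2mD f g : L2m f -> L2m g -> L2m (fun x => f x + g x).
Proof.
move=> Lf Lg; split; first by apply: cmeasurableD; [case: Lf|case: Lg].
have Lf1 := L2m_integrable Lf; have Lg1 := L2m_integrable Lg.
have /integrableP[_] := integrableD measurableT (integrableZl measurableT 2 Lf1)
  (integrableZl measurableT 2 Lg1).
apply: le_lt_trans; apply: ge0_le_integral => //.
- by move=> x _; rewrite lee_fin sqr_ge0.
- by apply/measurable_EFinP; apply: cmeasurable_sq; apply: cmeasurableD;
    [case: Lf|case: Lg].
- apply: measurableT_comp => //; apply: emeasurable_funD;
   apply: measurable_funeM; apply/measurable_EFinP; apply: cmeasurable_sq;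
   [by case: Lf|by case: Lg].
- move=> x _ /=; rewrite lee_fin (le_trans _ (ler_norm _))//.
  have h : Cabs (f x + g x) ^+ 2 <= (Cabs (f x) + Cabs (g x)) ^+ 2.
    by rewrite lerXn2r ?nnegrE ?addr_ge0 ?Cabs_ge0// CabsD.
  apply: le_trans h _; have := sqr_ge0 (Cabs (f x) - Cabs (g x)).
  by rewrite !sqrrD sqrrN; lra.
Qed.

Lemma L2mcZ (c : R[i]) f : L2m f -> L2m (fun x => c * f x).
Proof.
move=> Lf; have mcf : cmeasurable setT (fun x => c * f x).
  by apply: cmeasurableM; [exact: cmeasurable_cst|case: Lf].
split => //.
have /integrableP[_] :=
  integrableZl measurableT (Cabs c ^+ 2) (L2m_integrable Lf).
apply: le_lt_trans; apply: ge0_le_integral => //.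
- by move=> x _; rewrite lee_fin sqr_ge0.
- by apply/measurable_EFinP; exact: cmeasurable_sq.
- apply: measurableT_comp => //.
  by apply: measurable_funeM; apply/measurable_EFinP;
     apply: cmeasurable_sq; case: Lf.
- by move=> x _ /=; rewrite lee_fin (le_trans _ (ler_norm _))// CabsM exprMn.
Qed.

Lemma L2mN f : L2m f -> L2m (fun x => - f x).
Proof. by move=> /(L2mcZ (-1)); under eq_fun do rewrite mulN1r. Qed.

Lemma L2mB f g : L2m f -> L2m g -> L2m (fun x => f x - g x).
Proof. by move=> Lf Lg; apply: L2mD => //; exact: L2mN. Qed.

Lemma L2m_dom f (H : T -> R) : cmeasurable setT f -> measurable_fun setT H ->
  (forall x, Cabs (f x) <= H x) -> (\int[m]_x (H x ^+ 2)%:E < +oo)%E -> L2m f.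
Proof.
move=> mf mH fH H2; split => //; apply: le_lt_trans H2.
apply: ge0_le_integral => //.
- by move=> x _; rewrite lee_fin sqr_ge0.
- by apply/measurable_EFinP; exact: cmeasurable_sq.
- by apply/measurable_EFinP; exact: measurable_funX.
- by move=> x _; rewrite lee_fin lerXn2r ?nnegrE ?Cabs_ge0// (le_trans _ (fH x))
    ?Cabs_ge0.
Qed.

Lemma ipC f g : ip f g = ip g f.
Proof. by rewrite /ip; under eq_Rintegral do rewrite dotcC. Qed.

Lemma ipDl f g h : L2m f -> L2m g -> L2m h ->
  ip (fun x => f x + g x) h = ip f h + ip g h.
Proof.
move=> Lf Lg Lh; rewrite /ip -RintegralD//; [|exact: L2m_dotc..].
by under eq_Rintegral do rewrite dotcDl.
Qed.

Lemma ipZl c f h : L2m f -> L2m h ->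
  ip (fun x => c%:C%C * f x) h = c * ip f h.
Proof.
move=> Lf Lh; rewrite /ip -RintegralZl//; last exact: L2m_dotc.
by under eq_Rintegral do rewrite dotcZl.
Qed.

Lemma ipNl f h : L2m f -> L2m h -> ip (fun x => - f x) h = - ip f h.
Proof.
move=> Lf Lh; rewrite -mulN1r -ipZl//; congr ip; apply/funext => x.
by rewrite rmorphN1 mulN1r.
Qed.

Lemma ipDr f g h : L2m f -> L2m g -> L2m h ->
  ip h (fun x => f x + g x) = ip h f + ip h g.
Proof. by move=> *; rewrite !(ipC h) ipDl. Qed.

Lemma ipZr c f h : L2m f -> L2m h ->
  ip h (fun x => c%:C%C * f x) = c * ip h f.
Proof. by move=> *; rewrite !(ipC h) ipZl. Qed.

Lemma ipNr f h : L2m f -> L2m h -> ip h (fun x => - f x) = - ip h f.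
Proof. by move=> *; rewrite !(ipC h) ipNl. Qed.

Lemma ipBl f g h : L2m f -> L2m g -> L2m h ->
  ip (fun x => f x - g x) h = ip f h - ip g h.
Proof. by move=> *; rewrite ipDl ?ipNl//; exact: L2mN. Qed.

Lemma ipBr f g h : L2m f -> L2m g -> L2m h ->
  ip h (fun x => f x - g x) = ip h f - ip h g.
Proof. by move=> *; rewrite !(ipC h) ipBl. Qed.

Lemma ip_ge0 f : 0 <= ip f f.
Proof. by apply: Rintegral_ge0 => x _; exact: dotc_ge0. Qed.

Lemma ip_CS f g : L2m f -> L2m g -> ip f g ^+ 2 <= ip f f * ip g g.
Proof.
move=> Lf Lg.
have P c : 0 <= ip f f - 2 * c * ip f g + c ^+ 2 * ip g g.
  have Lcg : L2m (fun x => c%:C%C * g x) by exact: L2mcZ.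
  have := ip_ge0 (fun x => f x - c%:C%C * g x).
  have Lfcg : L2m (fun x => f x - c%:C%C * g x) by exact: L2mB.
  rewrite ipBl// !ipBr// !ipZr// !ipZl// (ipC g f).
  by move=> h; apply: le_trans h _; rewrite le_eqVlt; apply/orP; left; apply/eqP; ring.
have a0 := ip_ge0 f; have b0 := ip_ge0 g.
have [g0|gn0] := eqVneq (ip g g) 0.
  (* When [ip g g = 0] the polynomial [P] is affine in [c]; if [ip f g] is nonzero, this [c] gives
     it the value [- 2 * ip f f - 2], which is negative. *)
  rewrite g0 mulr0; have := P (ip f f / ip f g / 2 + ip f f / ip f g + 1/ip f g).
  rewrite g0 mulr0 addr0.
  have [->|fg0] := eqVneq (ip f g) 0; first by rewrite expr0n.
  move: fg0 a0 {P}; set x := ip f g; set y := ip f f => fg0 a0.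
  rewrite (_ : 2 * _ * x = 3 * y + 2); last by field.
  by move=> ?; exfalso; lra.
have gp : 0 < ip g g by rewrite lt0r gn0.
have := P (ip f g / ip g g); move: gn0 gp {P}.
set x := ip f g; set y := ip f f; set z := ip g g => zn0 z0.
rewrite (_ : _ - _ + _ = (y * z - x ^+ 2) / z); last by field.
by rewrite pmulr_lge0 ?invr_gt0// subr_ge0.
Qed.

(** [fine] sends an infinite integral to 0, so this number is informative only together with
    [L2m f]; membership is therefore tracked everywhere. *)
Definition nrm f := Num.sqrt (ip f f).

Lemma nrm_ge0 f : 0 <= nrm f.
Proof. exact: sqrtr_ge0. Qed.

Lemma nrm_sqr f : nrm f ^+ 2 = ip f f.
Proof. by rewrite sqr_sqrtr ?ip_ge0. Qed.

Lemma ip_le f g : L2m f -> L2m g -> `|ip f g| <= nrm f * nrm g.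
Proof.
move=> Lf Lg; rewrite -ler_sqr ?nnegrE ?mulr_ge0 ?nrm_ge0//.
by rewrite real_normK ?num_real// exprMn !nrm_sqr ip_CS.
Qed.

Lemma nrmD f g : L2m f -> L2m g -> nrm (fun x => f x + g x) <= nrm f + nrm g.
Proof.
move=> Lf Lg; rewrite -ler_sqr ?nnegrE ?addr_ge0 ?nrm_ge0//.
rewrite nrm_sqr ipDl ?ipDr//; [|exact: L2mD..].
rewrite (ipC g f) sqrrD !nrm_sqr.
by have := ip_le Lf Lg; rewrite ler_norml => /andP[_]; lra.
Qed.

Lemma nrmN f : L2m f -> nrm (fun x => - f x) = nrm f.
Proof.
by move=> Lf; rewrite /nrm ipNl ?ipNr ?opprK//; exact: L2mN.
Qed.

Lemma nrmBC f g : L2m f -> L2m g ->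
  nrm (fun x => f x - g x) = nrm (fun x => g x - f x).
Proof.
move=> Lf Lg; rewrite -[LHS]nrmN; last exact: L2mB.
by congr nrm; apply/funext => x; rewrite opprB.
Qed.

Lemma eip f : L2m f -> (ip f f)%:E = (\int[m]_x (Cabs (f x) ^+ 2)%:E)%E.
Proof.
move=> Lf; rewrite /ip /Rintegral fineK.
  by under eq_integral do rewrite dotczz.
exact: integrable_fin_num (L2m_dotc Lf Lf).
Qed.

Lemma ae_eq_dotc f f' : cmeasurable setT f -> cmeasurable setT f' ->
  ae_eq m setT f f' -> forall g, cmeasurable setT g -> ip f g = ip f' g.
Proof.
move=> mf mf' ff' g mg; rewrite /ip /Rintegral; congr fine.
apply: ae_eq_integral => //.
- by apply/measurable_EFinP; exact: cmeasurable_dotc.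
- by apply/measurable_EFinP; exact: cmeasurable_dotc.
- by apply: filterS ff' => x /(_ I) /= -> .
Qed.

Lemma nrm0_ae_eq f g : L2m f -> L2m g -> nrm (fun x => f x - g x) = 0 ->
  ae_eq m setT f g.
Proof.
move=> Lf Lg n0; have Lfg : L2m (fun x => f x - g x) by exact: L2mB.
have : (\int[m]_x `|(Cabs (f x - g x) ^+ 2)%:E|)%E = 0%E.
  under eq_integral do rewrite gee0_abs ?lee_fin ?sqr_ge0//.
  by rewrite -eip// -nrm_sqr n0 expr0n.
move/ae_eq_integral_abs => /(_ measurableT) h.
have /h : measurable_fun setT (fun x => (Cabs (f x - g x) ^+ 2)%:E).
  by apply/measurable_EFinP; apply: cmeasurable_sq; case: Lfg.
apply: filterS => x /= /(_ I) /= [] /eqP; rewrite sqrf_eq0 => /eqP h0 _.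
by apply/eqP; rewrite -subr_eq0; apply/eqP; exact: Normc.eq0_normc.
Qed.

End L2m.

Section L2nu.
Context {R : realType}.
Implicit Types f g : R -> R[i].

Lemma L2norm_eqE f : cmeasurable setT f ->
  L2norm f = ((\int[nu]_x (Cabs (f x) ^+ 2)%:E) `^ 2^-1)%E.
Proof.
move=> mf; rewrite /L2norm unlock/=; congr poweR.
apply: eq_integral => x _ /=; rewrite ger0_norm ?Cabs_ge0//.
by rewrite -powR_mulrn ?Cabs_ge0.
Qed.

Lemma L2P f : L2 f <-> L2m nu f.
Proof.
split=> -[mf lf]; split => //; last by rewrite L2norm_eqE// poweR_lty.
  move: lf; rewrite L2norm_eqE// => lf; rewrite ltNge leye_eq; apply/negP => /eqP h; move: lf.
  by rewrite h /= invr_eq0 pnatr_eq0 ltxx.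
Qed.

Lemma L2norm_nrm f : L2m nu f -> L2norm f = (nrm nu f)%:E.
Proof.
move=> Lf; rewrite L2norm_eqE; last by case: Lf.
by rewrite -eip// /= powR12_sqrt ?ip_ge0.
Qed.

End L2nu.

(** * Kernel estimates *)

Section integral_nu.
Context {R : realType}.
Local Notation leb := (@lebesgue_measure R).
Import HBNNSimple.

(** For an indicator the two sides agree by the definition of [nu]; the level sets of a simple
    function are then summed, those of negative level being empty. *)
Lemma integral_nu_nnsfun (h : {nnsfun R >-> R}) :
  (\int[nu]_x (h x)%:E = \int[leb]_x (h x * nu_density x)%:E)%E.
Proof.
have mi r : measurable_fun setT (\1_(h @^-1` [set r]) : R -> R).
  by apply: measurable_indic; rewrite -[X in measurable X]setTI;
     exact: (measurable_funP h).
rewrite integralT_nnsfun sintegralE.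
under [RHS]eq_integral => x _.
  rewrite EFinM fimfunE -fsumEFin// ge0_mule_fsuml; last first.
    by move=> r; rewrite EFinM; apply: nnfun_muleindic_ge0.
  over.
rewrite ge0_integral_fsum//=; last 2 first.
- move=> r; apply: emeasurable_funM; last first.
    by apply/measurable_EFinP; exact: measurable_nu_density.
  by apply/measurable_EFinP; apply: measurable_funM => //; exact: mi.
- move=> r x _; rewrite mule_ge0 ?lee_fin ?nu_density_ge0//.
  exact: nnfun_muleindic_ge0.
apply: eq_fsbigr => r _.
have [r0|r0] := leP 0 r; last first.
  have -> : h @^-1` [set r] = set0.
    by apply/seteqP; split => // x /= hx; move: r0; rewrite -hx ltNge fun_ge0.
  rewrite measure0 mule0 integral0_eq// => x _.
  by rewrite indic0 mulr0 mul0e.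
under eq_integral do rewrite EFinM -muleA.
rewrite ge0_integralZl//; last 2 first.
- apply: emeasurable_funM; first by apply/measurable_EFinP; exact: mi.
  by apply/measurable_EFinP; exact: measurable_nu_density.
- by move=> x _; rewrite mule_ge0// lee_fin ?nu_density_ge0.
congr (_ * _)%E; rewrite /nu/= integral_mkcond.
apply: eq_integral => x _; rewrite /= patchE indicE.
by case: ifPn => xA; rewrite ?mul1e ?mul0e.
Qed.

(** Monotone convergence along increasing simple approximations, applied on both sides of
    [integral_nu_nnsfun]. *)
Lemma integral_nu (f : R -> R) : measurable_fun setT f ->
  (forall x, 0 <= f x) ->
  (\int[nu]_x (f x)%:E = \int[leb]_x (f x * nu_density x)%:E)%E.
Proof.
move=> mf f0.
have mEf : measurable_fun setT (EFin \o f) by exact/measurable_EFinP.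
have Ef0 x : setT x -> (0 <= (EFin \o f) x)%E by rewrite lee_fin f0.
pose g := nnsfun_approx measurableT mEf.
have gf x : (fun n => (g n x)%:E) @ \oo --> (f x)%:E.
  exact: (cvg_nnsfun_approx measurableT mEf Ef0 (I : setT x)).
have ndg x : {homo (fun n => (g n x)%:E) : n m / (n <= m)%N >-> (n <= m)%E}.
  by move=> a b ab; rewrite lee_fin; exact/lefP/nd_nnsfun_approx.
have h1 : (\int[nu]_x (g n x)%:E)%E @[n --> \oo] --> (\int[nu]_x (f x)%:E)%E.
  have -> : (\int[nu]_x (f x)%:E = \int[nu]_x (limn (fun n => (g n x)%:E)))%E.
    by apply: eq_integral => x _; apply/esym/cvg_lim => //; exact: gf.
  apply: (cvg_monotone_convergence measurableT).
  - by move=> n; apply/measurable_EFinP.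
  - by move=> n x _; rewrite lee_fin.
  - by move=> x _; exact: ndg.
have h2 : (\int[leb]_x (g n x * nu_density x)%:E)%E @[n --> \oo] -->
    (\int[leb]_x (f x * nu_density x)%:E)%E.
  have -> : (\int[leb]_x (f x * nu_density x)%:E =
      \int[leb]_x (limn (fun n => (g n x * nu_density x)%:E)))%E.
    apply: eq_integral => x _; apply/esym/cvg_lim => //.
    under eq_fun do rewrite EFinM.
    rewrite EFinM; exact: (cvgeZr (y := (nu_density x)%:E) _ (gf x)).
  apply: (cvg_monotone_convergence measurableT).
  - move=> n; apply/measurable_EFinP; apply: (@measurable_funM _ _ _ _ (g n)).
      exact: measurable_funP.
    exact: measurable_nu_density.
  - by move=> n x _; rewrite lee_fin mulr_ge0 ?nu_density_ge0.
  - move=> x _ a b ab; rewrite lee_fin ler_wpM2r ?nu_density_ge0//.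
    by have := ndg x _ _ ab; rewrite lee_fin.
have h3 : (fun n => (\int[nu]_x (g n x)%:E)%E) =
          (fun n => (\int[leb]_x (g n x * nu_density x)%:E)%E).
  by apply/funext => n; exact: integral_nu_nnsfun.
by move: h1; rewrite h3 => h1; exact: cvg_unique h1 h2.
Qed.

End integral_nu.

(** * Improper integrals of functions with a bounded primitive *)

Section halfline.
Context {R : realType}.
Local Notation leb := (@lebesgue_measure R).
Implicit Types (f F : R -> R) (D : set R) (u v : nat -> R).

(** On each compact interval the fundamental theorem of calculus gives an increment of [F], at most
    [2 * C], and the intervals increase to [D]. The intervals stay inside [D], so [f] may be
    singular at its ends. *)
Lemma integral_exhaust_le f F D (C : R) u v : measurable_fun D f ->
  measurable D ->
  (forall n, u n < v n) -> nonincreasing_seq u -> nondecreasing_seq v ->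
  D = \bigcup_n `[u n, v n]%classic ->
  (forall x, D x -> 0 <= f x) -> (forall x, D x -> `|F x| <= C) ->
  (forall x, D x -> {for x, continuous f}) ->
  (forall x, D x -> is_derive x 1 F (f x)) ->
  (\int[leb]_(x in D) (f x)%:E <= (2 * C)%:E)%E.
Proof.
move=> mf mD uv nu nv DE f0 FC cf dF.
have sD n : `[u n, v n]%classic `<=` D by rewrite DE => x xn; exists n.
have uD n : D (u n) by apply: (sD n); rewrite /= in_itv/= lexx ltW.
have vD n : D (v n) by apply: (sD n); rewrite /= in_itv/= lexx ltW.
rewrite [X in integral _ X _]DE.
have cvgI : (\int[leb]_(x in `[u i, v i]) (f x)%:E)%E @[i --> \oo] -->
    (\int[leb]_(x in \bigcup_i `[u i, v i]%classic) (f x)%:E)%E.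
  apply: ge0_nondecreasing_set_cvg_integral => //.
  - move=> a b ab; apply/subsetPset => x /=; rewrite !in_itv/= => /andP[h1 h2].
    by rewrite (le_trans (nu _ _ ab) h1) (le_trans h2 (nv _ _ ab)).
  - move=> i; apply/measurable_EFinP; exact: measurable_funS (sD i) mf.
  - by move=> i x /sD /f0; rewrite lee_fin.
have cc : (\int[leb]_(x in `[u i, v i]) (f x)%:E)%E @[i --> \oo] -->
    (\int[leb]_(x in \bigcup_i `[u i, v i]%classic) (f x)%:E)%E by [].
rewrite -(cvg_lim _ cvgI)//; apply: lime_le.
  by apply/cvg_ex; eexists; exact: cc.
apply: nearW => n.
rewrite (@continuous_FTC2 _ f F)//; last 3 first.
- apply: continuous_in_subspaceT => x; rewrite inE => /sD; exact: cf.
- split.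
  + move=> x /subset_itv_oo_cc xuv; apply: (@ex_derive _ _ _ _ _ _ _ (dF x _)).
    by apply: (sD n); exact: xuv.
  + apply: cvg_at_right_filter; apply: differentiable_continuous.
    by apply/derivable1_diffP; apply: ex_derive; exact: dF.
  + apply: cvg_at_left_filter; apply: differentiable_continuous.
    by apply/derivable1_diffP; apply: ex_derive; exact: dF.
- move=> x /subset_itv_oo_cc xuv; rewrite derive1E; have Dx := sD n _ xuv.
  exact: (@derive_val _ _ _ _ _ _ _ (dF x Dx)).
rewrite -EFinB lee_fin.
have := FC _ (uD n); have := FC _ (vD n).
by rewrite !ler_norml => /andP[_ ?] /andP[? _]; lra.
Qed.

Lemma integral_right_le f F (a C : R) : measurable_fun `]a, +oo[ f ->
  (forall x, a < x -> 0 <= f x) -> (forall x, a < x -> `|F x| <= C) ->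
  (forall x, a < x -> {for x, continuous f}) ->
  (forall x, a < x -> is_derive x 1 F (f x)) ->
  (\int[leb]_(x in `]a, +oo[) (f x)%:E <= (2 * C)%:E)%E.
Proof.
move=> mf f0 FC cf dF.
(* The left ends are at most [a + 1]; starting the right ends at [a + 2] keeps the intervals
   nondegenerate from [n = 0] on. *)
apply: (@integral_exhaust_le f F _ C (fun n => a + n.+1%:R^-1)
  (fun n => a + n.+2%:R)) => //.
- move=> n; rewrite ltrD2l (@le_lt_trans _ _ 1)//.
    by rewrite invf_le1// ler1n.
  by rewrite ltr1n.
- by move=> i j ij; rewrite lerD2l lef_pV2 ?posrE// ler_nat.
- by move=> i j ij; rewrite lerD2l ler_nat !ltnS.
- apply/seteqP; split => x /=.
    rewrite in_itv/= andbT => ax.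
    pose n := maxn (Num.truncn (x - a)) (Num.truncn ((x - a)^-1)).
    have xa : 0 < x - a by rewrite subr_gt0.
    exists n => //=; rewrite in_itv/=; apply/andP; split.
      rewrite -lerBrDl -[leRHS]invrK lef_pV2 ?posrE ?invr_gt0//.
      apply/ltW/(lt_le_trans (truncnS_gt _)).
      by rewrite ler_nat ltnS leq_maxr.
    rewrite -lerBlDl; apply/ltW/(lt_le_trans (truncnS_gt _)).
    by rewrite ler_nat ltnS leqW// leq_maxl.
  move=> [n _] /=; rewrite !in_itv/= andbT => /andP[h _].
  by apply: lt_le_trans h; rewrite ltrDl invr_gt0.
- by move=> x /=; rewrite in_itv/= andbT => /f0.
- by move=> x /=; rewrite in_itv/= andbT => /FC.
- by move=> x /=; rewrite in_itv/= andbT => /cf.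
- by move=> x /=; rewrite in_itv/= andbT => /dF.
Qed.

Lemma integral_left_le f F (a C : R) : measurable_fun `]-oo, a[ f ->
  (forall x, x < a -> 0 <= f x) -> (forall x, x < a -> `|F x| <= C) ->
  (forall x, x < a -> {for x, continuous f}) ->
  (forall x, x < a -> is_derive x 1 F (f x)) ->
  (\int[leb]_(x in `]-oo, a[) (f x)%:E <= (2 * C)%:E)%E.
Proof.
move=> mf f0 FC cf dF.
apply: (@integral_exhaust_le f F _ C (fun n => a - n.+2%:R)
  (fun n => a - n.+1%:R^-1)) => //.
- move=> n; rewrite ltrD2l ltrN2 (@le_lt_trans _ _ 1)//.
    by rewrite invf_le1// ler1n.
  by rewrite ltr1n.
- by move=> i j ij; rewrite lerD2l lerN2 ler_nat !ltnS.
- by move=> i j ij; rewrite lerD2l lerN2 lef_pV2 ?posrE// ler_nat.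
- apply/seteqP; split => x /=.
    rewrite in_itv/= => ax.
    pose n := maxn (Num.truncn (a - x)) (Num.truncn ((a - x)^-1)).
    have xa : 0 < a - x by rewrite subr_gt0.
    exists n => //=; rewrite in_itv/=; apply/andP; split.
      rewrite lerBlDr -lerBlDl; apply/ltW/(lt_le_trans (truncnS_gt _)).
      by rewrite ler_nat ltnS leqW// leq_maxl.
    rewrite lerBrDr -lerBrDl -[leRHS]invrK lef_pV2 ?posrE ?invr_gt0//.
    apply/ltW/(lt_le_trans (truncnS_gt _)).
    by rewrite ler_nat ltnS leq_maxr.
  move=> [n _] /=; rewrite !in_itv/= => /andP[_ h].
  by apply: le_lt_trans h _; rewrite ltrBlDr ltrDl invr_gt0.
Qed.

End halfline.

(** * An integrable model for the damped singularity on the diagonal *)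

Section profile.
Context {R : realType}.
Local Notation leb := (@lebesgue_measure R).
Implicit Types (th r v w x : R).

Definition profile th r : R :=
  expR (- (r / 64)) + expR (- r) * (1 - expR (- r)) `^ (th - 1).

Lemma profile_ge0 th r : 0 <= profile th r.
Proof. by rewrite addr_ge0 ?mulr_ge0 ?expR_ge0 ?powR_ge0. Qed.

Lemma onem_expRN_gt0 r : 0 < r -> 0 < 1 - expR (- r).
Proof. by move=> r0; rewrite subr_gt0 expR_lt1 oppr_lt0. Qed.

Lemma onem_expRN_ge0 r : 0 <= r -> 0 <= 1 - expR (- r).
Proof. by move=> r0; rewrite subr_ge0 -expR0 ler_expR oppr_le0. Qed.

Lemma onem_expRN_le1 r : 1 - expR (- r) <= 1.
Proof. by rewrite lerBlDr lerDl expR_ge0. Qed.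

Lemma powRB1 th x : 0 < x -> x `^ (th - 1) = x `^ th / x.
Proof.
by move=> x0; rewrite powRD ?(gt_eqF x0) ?implybT// powR_inv1// ltW.
Qed.

Lemma powR_le1 th x : 0 <= th -> 0 <= x <= 1 -> x `^ th <= 1.
Proof.
move=> th0 /andP[x0 x1]; have <- : 1 `^ th = 1 :> R by rewrite powR1.
by apply: ge0_ler_powR => //; rewrite nnegrE.
Qed.

(** With [x = 1 - expR (- r)], split the factor 1 as [x + (1 - x)]: the first part removes the
    singularity, and the second already carries the factor [expR (- r)]. *)
Lemma le_profile th r : 0 <= th -> 0 < r ->
  expR (- (r / 64)) * (1 - expR (- r)) `^ (th - 1) <= profile th r.
Proof.
move=> th0 r0; have x0 := onem_expRN_gt0 r0.
have x1 := onem_expRN_le1 r.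
rewrite /profile powRB1//.
have xt1 : (1 - expR (- r)) `^ th <= 1 by rewrite powR_le1// ltW.
have xt0 := powR_ge0 (1 - expR (- r)) th.
have e1 : expR (- (r / 64)) <= 1 by rewrite expR_le1 oppr_le0 divr_ge0// ltW.
have e0 := expR_ge0 (- (r / 64)).
have y0 := expR_ge0 (- r).
move: x0 x1 xt1 xt0 e1 e0 y0.
set x := 1 - expR (- r); set E := expR (- (r / 64)); set p := x `^ th.
have -> : expR (- r) = 1 - x by rewrite /x; ring.
move=> x0 x1 p1 p0 E1 E0 y0.
have -> : E * (p / x) = E * p + E * ((1 - x) * (p / x)).
  by field; rewrite gt_eqF.
apply: lerD; first by rewrite ler_piMr.
by rewrite ler_piMl// mulr_ge0// divr_ge0// ltW.
Qed.

Lemma measurable_expR_lin (c d : R) :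
  measurable_fun setT (fun x : R => expR (c * x + d)).
Proof.
apply: measurableT_comp; first exact: measurable_expR.
by apply: measurable_funD => //; exact: measurable_funM.
Qed.

Lemma measurable_profile th : measurable_fun setT (profile th).
Proof.
have m1 : measurable_fun setT (fun x : R => expR (- x)).
  by apply: measurableT_comp => //; exact: measurable_expR.
apply: measurable_funD.
  rewrite (_ : (fun _ => _) = fun r => expR (- 64^-1 * r + 0)).
    exact: measurable_expR_lin.
  by apply/funext => r; rewrite addr0 mulNr mulrC.
apply: measurable_funM => //.
apply: (@measurableT_comp _ _ _ _ _ _ (@powR R ^~ (th - 1))) => //.
exact: measurable_funB.
Qed.

Definition profile_prim th r : R :=
  - 64 * expR (- (r / 64)) + th^-1 * (1 - expR (- r)) `^ th.

Lemma is_derive_onem_expRN r :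
  is_derive r 1 (fun r : R => 1 - expR (- r)) (expR (- r)).
Proof.
have d0 : is_derive r 1 (fun r : R => expR (- r)) (expR (- r) * -1).
  exact: (@is_derive1_comp _ expR (fun r => - r)).
by apply: is_derive_eq; ring.
Qed.

Lemma is_derive_profile th r : 0 < th -> 0 < r ->
  is_derive r 1 (profile_prim th) (profile th r).
Proof.
move=> th0 r0; have x0 := onem_expRN_gt0 r0.
have h := is_derive1_powR th x0.
have d1 : is_derive r 1 (fun r : R => expR (- (r / 64)))
    (expR (- (r / 64)) * - 64^-1).
  apply: (@is_derive1_comp _ expR (fun r => - (r / 64))).
  apply: is_derive_eq.
  by rewrite /GRing.scale/=; ring.
have d2 : is_derive r 1 (fun r : R => 1 - expR (- r)) (expR (- r)).
  exact: is_derive_onem_expRN.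
have d3 : is_derive r 1 (fun r : R => (1 - expR (- r)) `^ th)
   (th * (1 - expR (- r)) `^ (th - 1) * expR (- r)).
  exact: (@is_derive1_comp _ (@powR R ^~ th) (fun r => 1 - expR (- r)) r).
apply: is_derive_eq.
rewrite /profile /GRing.scale/=; field.
by rewrite gt_eqF.
Qed.

Lemma profile_prim_le th r : 0 < th -> 0 < r ->
  `|profile_prim th r| <= 64 + th^-1.
Proof.
move=> th0 r0; rewrite /profile_prim.
have x0 := onem_expRN_gt0 r0.
have x1 := onem_expRN_le1 r.
have xt1 : (1 - expR (- r)) `^ th <= 1 by rewrite powR_le1// ltW.
have xt0 := powR_ge0 (1 - expR (- r)) th.
have e1 : expR (- (r / 64)) <= 1 by rewrite expR_le1 oppr_le0 divr_ge0// ltW.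
have e0 := expR_ge0 (- (r / 64)).
have ti : 0 < th^-1 by rewrite invr_gt0.
rewrite (le_trans (ler_normD _ _))// lerD//.
  by rewrite normrM normrN (ger0_norm e0) ger0_norm// ler_piMr.
by rewrite ger0_norm ?mulr_ge0// ?ler_piMr// ltW.
Qed.

Lemma continuous_profile th r : 0 < r -> {for r, continuous (profile th)}.
Proof.
move=> r0; have x0 := onem_expRN_gt0 r0.
apply: differentiable_continuous; apply/derivable1_diffP.
have h := is_derive1_powR (th - 1) x0.
have d2 : is_derive r 1 (fun r : R => 1 - expR (- r)) (expR (- r)).
  exact: is_derive_onem_expRN.
have d3 := @is_derive1_comp _ (@powR R ^~ (th - 1)) _ r _ _ h d2.
have d4 : is_derive r 1 (fun r : R => expR (- (r / 64)))
    (expR (- (r / 64)) * - 64^-1).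
  apply: (@is_derive1_comp _ expR (fun r => - (r / 64))).
  by apply: is_derive_eq; rewrite /GRing.scale/=; ring.
have d5 : is_derive r 1 (fun r : R => expR (- r)) (expR (- r) * -1).
  exact: (@is_derive1_comp _ expR (fun r => - r)).
apply: derivableD; first exact: ex_derive.
apply: derivableM; first exact: ex_derive.
exact: (@ex_derive _ _ _ _ _ _ _ d3).
Qed.

(** Each side of [v] contributes twice the bound [64 + th^-1] on the primitive, uniformly in [v]. *)
Lemma integral_profile_le th v : 0 < th ->
  (\int[leb]_w (profile th `|v - w|)%:E <= (4 * (64 + th^-1))%:E)%E.
Proof.
move=> th0.
have mp : measurable_fun setT (fun w => profile th `|v - w|).
  apply: (measurableT_comp (measurable_profile th)).
  by apply: measurableT_comp => //; exact: measurable_funB.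
have mpE : measurable_fun setT (fun w => (profile th `|v - w|)%:E).
  exact/measurable_EFinP.
have -> : [set: R] = `]-oo, v[%classic `|` `[v, +oo[%classic.
  apply/seteqP; split => // x _ /=; rewrite !in_itv/= andbT.
  by have [|] := ltP x v; [left|right].
rewrite ge0_integral_setU//=; last 3 first.
- exact: measurable_funS mpE.
- by move=> x _; rewrite lee_fin profile_ge0.
- apply/disj_setPLR => x /=; rewrite !in_itv/= andbT => xv.
  by apply/negP; rewrite -ltNge.
have L : (\int[leb]_(w in `]-oo, v[) (profile th (v - w))%:E <=
    (2 * (64 + th^-1))%:E)%E.
  apply: (@integral_left_le _ (fun w => profile th (v - w))
      (fun w => - profile_prim th (v - w))).
  - apply: measurable_funTS; apply: (measurableT_comp (measurable_profile th)).
    exact: measurable_funB.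
  - by move=> x _; exact: profile_ge0.
  - by move=> x xv; rewrite normrN profile_prim_le// subr_gt0.
  - move=> x xv; apply: (@continuous_comp _ _ _ (fun w => v - w) (profile th)).
      by apply: continuousB; [exact: cst_continuous|exact: cvg_id].
    by apply: continuous_profile; rewrite subr_gt0.
  - move=> x xv; have vx : 0 < v - x by rewrite subr_gt0.
    have h := is_derive_profile th0 vx.
    have d1 : is_derive x 1 (fun w : R => v - w) (-1).
      by apply: is_derive_eq; ring.
    have d2 := @is_derive1_comp _ (profile_prim th) (fun w => v - w) x _ _ h d1.
    have d3 := @is_deriveN _ _ _ _ _ _ _ d2.
    by apply: (@is_derive_eq _ _ _ _ _ _ _ _ d3); rewrite mulrN1 opprK.
have G : (\int[leb]_(w in `]v, +oo[) (profile th (w - v))%:E <=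
    (2 * (64 + th^-1))%:E)%E.
  apply: (@integral_right_le _ (fun w => profile th (w - v))
    (fun w => profile_prim th (w - v))).
  - apply: measurable_funTS; apply: (measurableT_comp (measurable_profile th)).
    exact: measurable_funB.
  - by move=> x _; exact: profile_ge0.
  - by move=> x xv; rewrite profile_prim_le// subr_gt0.
  - move=> x xv; apply: (@continuous_comp _ _ _ (fun w => w - v) (profile th)).
      by apply: continuousB; [exact: cvg_id|exact: cst_continuous].
    by apply: continuous_profile; rewrite subr_gt0.
  - move=> x xv; have vx : 0 < x - v by rewrite subr_gt0.
    have h := is_derive_profile th0 vx.
    have d1 : is_derive x 1 (fun w : R => w - v) 1.
      by apply: is_derive_eq; ring.
    have d2 := @is_derive1_comp _ (profile_prim th) (fun w => w - v) x _ _ h d1.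
    by apply: (@is_derive_eq _ _ _ _ _ _ _ _ d2); rewrite mulr1.
rewrite (_ : 4 * _ = 2 * (64 + th^-1) + 2 * (64 + th^-1)); last by ring.
rewrite EFinD; apply: leeD.
  apply: le_trans L; rewrite le_eqVlt; apply/orP; left; apply/eqP.
  apply: eq_integral => w /[!inE]/= /[!in_itv]/= wv.
  by rewrite gtr0_norm ?subr_gt0.
rewrite -integral_itv_obnd_cbnd; last exact: measurable_funTS.
apply: le_trans G; rewrite le_eqVlt; apply/orP; left; apply/eqP.
apply: eq_integral => w /[!inE]/= /[!in_itv]/= /andP[wv _].
by rewrite distrC gtr0_norm ?subr_gt0.
Qed.

End profile.

Section elementary_bounds.
Context {R : realType}.
Implicit Types (a b c e v w x : R).

(** Every factor below is compared with a constant times an exponential; constants multiply and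
    exponents add, so each estimate ends in linear arithmetic. *)
Lemma cexpM_le a b c1 c2 e1 e2 : 0 <= a -> 0 <= b ->
  a <= c1 * expR e1 -> b <= c2 * expR e2 ->
  a * b <= (c1 * c2) * expR (e1 + e2).
Proof.
move=> a0 b0 ha hb.
by rewrite expRD mulrACA; apply: ler_pM.
Qed.

Lemma cexp_le c c' e e' : 0 <= c -> c <= c' -> e <= e' ->
  c * expR e <= c' * expR e'.
Proof. by move=> c0 cc ee; apply: ler_pM; rewrite ?expR_ge0 ?ler_expR. Qed.

Lemma ln1pexp_le_expR v : ln1pexp v <= expR v.
Proof. by apply: le_ln1Dx; rewrite (lt_le_trans _ (expR_ge0 v))// ltrN10. Qed.

(** For [v >= 0] the growth is at most [1 + v], which a small exponential rate absorbs; the rate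
    1/64 is the unit in which the margins of [weight] and [envelope] are counted. *)
Lemma ln1pexp_le_expR64 v : ln1pexp v <= 64 * expR (v / 64).
Proof.
have [v0|v0] := leP 0 v; last first.
  apply: le_trans (ln1pexp_le_expR v) _.
  by rewrite -[leLHS]mul1r; apply: cexp_le => //; lra.
have h : ln1pexp v <= 1 + v.
  rewrite -[leRHS]expRK ler_ln ?posrE ?addr_gt0 ?expR_gt0// expRD.
  have e1 : 1 <= expR v by rewrite -expR0 ler_expR.
  have e2 : 2 <= expR (1 : R) by have := expR_ge1Dx (1 : R); lra.
  nra.
have := expR_ge1Dx (v / 64); lra.
Qed.

(** Apply [ln (1 + x) <= x] to the inverse of [1 + expR v], which is [1 - (1 + expR (- v))^-1]. *)
Lemma ln1pexp_ge v : (1 + expR (- v))^-1 <= ln1pexp v.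
Proof.
have p : 0 < 1 + expR (- v) by rewrite addr_gt0 ?expR_gt0.
have q : 0 < 1 + expR v by rewrite addr_gt0 ?expR_gt0.
rewrite /ln1pexp -[1 + expR v]invrK lnV ?posrE ?invr_gt0// lerNr.
rewrite (_ : (1 + expR v)^-1 = 1 + - (1 + expR (- v))^-1); last first.
  by rewrite expRN; field; rewrite !gt_eqF ?expR_gt0// addrC.
apply: le_ln1Dx; rewrite ltrN2 invf_lt1//.
by rewrite ltrDl expR_gt0.
Qed.

Lemma expR_half_le1 v : 0 <= v -> 1 + expR (- v) <= 2.
Proof.
move=> v0; have : expR (- v) <= 1 by rewrite expR_le1 oppr_le0.
lra.
Qed.

Lemma powR_expR e v : expR v `^ e = expR (v * e).
Proof. by rewrite expRM. Qed.

(** By [ln1pexp_ge] the left side is at most the power [e] of [1 + expR (- v)], a sum bounded by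
    twice its larger term. *)
Lemma ln1pexp_powN v e : 0 <= e ->
  ln1pexp v `^ (- e) <= 2 `^ e * (1 + expR (- (e * v))).
Proof.
move=> e0; have p : 0 < 1 + expR (- v) by rewrite addr_gt0 ?expR_gt0.
have h : ln1pexp v `^ (- e) <= (1 + expR (- v)) `^ e.
  have l0 := ln1pexp_gt0 v.
  rewrite powRN -[leLHS]mul1r ler_pdivrMr ?powR_gt0//.
  rewrite -powRM ?(ltW p) ?(ltW l0)//.
  have pl : 1 <= (1 + expR (- v)) * ln1pexp v.
    by rewrite mulrC -ler_pdivrMr// mul1r ln1pexp_ge.
  suff : 1 `^ e <= ((1 + expR (- v)) * ln1pexp v) `^ e by rewrite powR1.
  by apply: ge0_ler_powR => //; rewrite nnegrE ?mulr_ge0 ?ltW.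
have p2 := powR_ge0 2 e; have ee := expR_ge0 (- (e * v)).
apply: le_trans h _; have [v0|v0] := leP 0 v.
  apply: (@le_trans _ _ (2 `^ e)); last nra.
  by apply: ge0_ler_powR => //; rewrite ?nnegrE ?(ltW p)// expR_half_le1.
apply: (@le_trans _ _ (2 `^ e * expR (- (e * v)))); last nra.
rewrite (_ : - (e * v) = - v * e); last by ring.
rewrite -powR_expR -powRM ?expR_ge0//.
apply: ge0_ler_powR => //; rewrite ?nnegrE ?(ltW p)// ?mulr_ge0 ?expR_ge0//.
have : 1 <= expR (- v) by rewrite -expR0 ler_expR oppr_ge0 ltW.
lra.
Qed.

Lemma ln1pexp_powN32 v :
  ln1pexp v `^ (- (3 / 2)) <= 4 * (1 + expR (- (3 / 2 * v))).
Proof.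
apply: le_trans (ln1pexp_powN v (e := 3 / 2) _) _; first lra.
apply: ler_wpM2r; first by rewrite addr_ge0 ?expR_ge0.
have : 2 `^ (3 / 2) <= 2 `^ 2%:R :> R by apply: ler_powR; lra.
by rewrite powR_mulrn//; lra.
Qed.

Lemma one_expR_le x : 0 <= x -> 1 + expR x <= 2 * expR x.
Proof.
by move=> x0; have : 1 <= expR x; [rewrite -expR0 ler_expR|lra].
Qed.

Lemma one_expR_le0 x : x <= 0 -> 1 + expR x <= 2 * expR 0.
Proof.
by move=> x0; rewrite expR0; have : expR x <= 1; [rewrite expR_le1|lra].
Qed.

(** The closing step of each case of the kernel bound. The number 12288, equal to [128 * 96] and to
    [16 * 768], is the largest product of constants met there; [c] selects one of the two
    exponentials of [envelope]. *)
Lemma cexp_le_envelope (C e c d h : R) : 0 <= C -> C <= 12288 ->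
  expR c <= h -> e <= c + d -> C * expR e <= 12288 * h * expR d.
Proof.
move=> C0 C1 ch ecd; rewrite -mulrA; apply: ler_pM; rewrite ?expR_ge0//.
apply: (@le_trans _ _ (expR (c + d))); first by rewrite ler_expR.
by rewrite expRD ler_wpM2r ?expR_ge0.
Qed.

End elementary_bounds.

(** * Weighted pointwise bound on the kernel *)

Section kernel_bound.
Context {R : realType}.
Implicit Types (r v w x : R).

(* [weight] dominates [Gamma_tilde] (the exponent 7/16 is the largest value of
   mu, and c0 < 1) and, by its last factor, a small power of [(eps p e)^-1];
   [envelope] lies in L^2(nu) because nu has density of order exp(3w/2) at -oo
   and w^(5/2) exp(-w) at +oo. *)
Definition weight v w : R :=
  (1 + expR (- (Num.min v w / 6))) * (1 + expR (7 / 16 * Num.max v w))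
  * (1 + expR (Num.max v w / 64)).

(** What remains of [K3] once the powers of [ln1pexp], the constant and the singular denominator are
    taken out. *)
Definition regular_factor v w : R :=
  expR (- `|v - w|) / (1 + expR (- Num.min v w) + expR (- Num.max v w))
  * (2 + expR (Num.max v w)).

Definition envelope v : R := expR (- (2 / 3 * v)) + expR (15 / 32 * v).

Lemma envelope_ge0 v : 0 <= envelope v.
Proof. by rewrite addr_ge0 ?expR_ge0. Qed.

Lemma weight_ge0 v w : 0 <= weight v w.
Proof. by rewrite !mulr_ge0// addr_ge0 ?expR_ge0. Qed.

Let E (x : R) := expR_ge0 x.

Lemma ler_inv_exp (y z : R) : 0 <= z -> (1 + expR (- y) + z)^-1 <= expR y.
Proof.
move=> z0; rewrite -[leRHS]invrK -expRN lef_pV2 ?posrE ?expR_gt0//.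
  by rewrite -addrA addrC -addrA lerDl addr_ge0.
by rewrite -addrA ltr_wpDr// addr_ge0 ?E.
Qed.

Lemma ler_inv_1 (y z : R) : 0 <= z -> (1 + expR (- y) + z)^-1 <= 1.
Proof.
move=> z0; rewrite invf_le1.
  by rewrite -addrA lerDl addr_ge0 ?E.
by rewrite -addrA ltr_wpDr// addr_ge0 ?E.
Qed.

(** Here [expR (- w)] and [expR (- (v - w))] merge into [expR (- v)], and after bounding [q] a
    function of [w] times a function of [v] is left. For [v >= 0] the exponents add up to
    [(7/16 + 1/64) * v + w / 64], which is [15/32 * v - (v - w) / 64]. For [v < 0] they give
    [11/6 * w - 5/2 * v], which is [- 2/3 * v] at [w = v]. These are the two exponents of
    [envelope]. *)
Lemma kernel_bound_le v w : w <= v ->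
  ln1pexp w * expR (- w) * ln1pexp v `^ (- (3 / 2)) * regular_factor v w
    * weight v w <= 12288 * envelope v * expR (- (`|v - w| / 64)).
Proof.
move=> wv; rewrite /regular_factor /weight min_r ?max_l// ger0_norm ?subr_ge0//.
set q := (1 + _ + _)^-1.
have q0 : 0 <= q by rewrite invr_ge0 !addr_ge0 ?E.
have q1 : q <= 1 by apply: ler_inv_1; exact: E.
have qe : q <= 1 * expR w by rewrite mul1r; apply: ler_inv_exp; exact: E.
have l0 := ltW (ln1pexp_gt0 w).
have -> : forall a b c, ln1pexp w * expR (- w) * ln1pexp v `^ (- (3 / 2))
    * (expR (- (v - w)) * q * (2 + expR v)) * (a * b * c) =
    ln1pexp w * q * a * ((ln1pexp v `^ (- (3 / 2)) * (1 + 2 * expR (- v)))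
      * (b * c)).
  move=> a b c; rewrite opprB expRD !expRN; field.
  by rewrite !gt_eqF ?expR_gt0.
have b0 : 0 <= ln1pexp v `^ (- (3 / 2)) * (1 + 2 * expR (- v)) *
    ((1 + expR (7 / 16 * v)) * (1 + expR (v / 64))).
  by rewrite !mulr_ge0 ?powR_ge0// addr_ge0 ?mulr_ge0 ?E.
have a0 : 0 <= ln1pexp w * q * (1 + expR (- (w / 6))).
  by rewrite !mulr_ge0// addr_ge0 ?E.
have aneg : w <= 0 -> ln1pexp w * q * (1 + expR (- (w / 6)))
     <= (1 * 1 * 2) * expR (w + w + - (w / 6)).
  move=> w0; apply: cexpM_le; rewrite ?mulr_ge0 ?addr_ge0 ?E//.
    by apply: cexpM_le => //; rewrite mul1r ln1pexp_le_expR.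
  by apply: one_expR_le; lra.
have P (x : R) : 0 <= 1 + expR x by rewrite addr_ge0 ?E.
have [v0|v0] := leP 0 v.
  have apos : ln1pexp w * q * (1 + expR (- (w / 6))) <= 128 * expR (w / 64).
    have [w0|w0] := leP 0 w; last first.
      by apply: le_trans (aneg (ltW w0)) _; apply: cexp_le; lra.
    have h : ln1pexp w * q * (1 + expR (- (w / 6))) <=
        (64 * 1 * 2) * expR (w / 64 + 0 + 0).
      apply: cexpM_le; rewrite ?mulr_ge0 ?addr_ge0 ?E//.
        by apply: cexpM_le => //; rewrite ?ln1pexp_le_expR64// expR0 mulr1.
      by apply: one_expR_le0; lra.
    by apply: le_trans h _; apply: cexp_le; lra.
  have h1 : ln1pexp v `^ (- (3 / 2)) <= 8 * expR 0.
    apply: le_trans (ln1pexp_powN32 v) _.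
    have := @one_expR_le0 _ (- (3 / 2 * v)); lra.
  have h2 : 1 + 2 * expR (- v) <= 3 * expR 0.
    have := @one_expR_le0 _ (- v); rewrite expR0; lra.
  have h3 : 1 + expR (7 / 16 * v) <= 2 * expR (7 / 16 * v).
    by apply: one_expR_le; lra.
  have h4 : 1 + expR (v / 64) <= 2 * expR (v / 64).
    by apply: one_expR_le; lra.
  have h5 : 0 <= 1 + 2 * expR (- v) by rewrite addr_ge0 ?mulr_ge0 ?E.
  have := cexpM_le a0 b0 apos
    (cexpM_le (mulr_ge0 (powR_ge0 _ _) h5) (mulr_ge0 (P _) (P _))
      (cexpM_le (powR_ge0 _ _) h5 h1 h2) (cexpM_le (P _) (P _) h3 h4)).
  move/le_trans; apply.
  apply: (cexp_le_envelope (c := 15 / 32 * v)).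
  - by clear; lra.
  - by clear; lra.
  - by rewrite /envelope lerDr E.
  - by clear -v0 wv; lra.
have w0 : w <= 0 by lra.
have h1 : ln1pexp v `^ (- (3 / 2)) <= 8 * expR (- (3 / 2 * v)).
  apply: le_trans (ln1pexp_powN32 v) _.
  have := @one_expR_le _ (- (3 / 2 * v)); lra.
have h2 : 1 + 2 * expR (- v) <= 3 * expR (- v).
  have := @one_expR_le _ (- v); lra.
have h3 : 1 + expR (7 / 16 * v) <= 2 * expR 0 by apply: one_expR_le0; lra.
have h4 : 1 + expR (v / 64) <= 2 * expR 0 by apply: one_expR_le0; lra.
have h5 : 0 <= 1 + 2 * expR (- v) by rewrite addr_ge0 ?mulr_ge0 ?E.
have := cexpM_le a0 b0 (aneg w0)
  (cexpM_le (mulr_ge0 (powR_ge0 _ _) h5) (mulr_ge0 (P _) (P _))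
    (cexpM_le (powR_ge0 _ _) h5 h1 h2) (cexpM_le (P _) (P _) h3 h4)).
move/le_trans; apply.
apply: (cexp_le_envelope (c := - (2 / 3 * v))).
- by clear; lra.
- by clear; lra.
- by rewrite /envelope lerDl E.
- by clear -v0 w0 wv; lra.
Qed.

(** Now a factor [expR (- (w - v))] survives. The part depending on [w] grows at rate at most
    [1/64 + 7/16 + 1/64 = 15/32], so this decay moves it back to the point [v] with room to spare.
    For [v < 0] the part in [v] has exponent [- 3/2 * v + v - v / 6 = - 2/3 * v]. *)
Lemma kernel_bound_ge v w : v <= w ->
  ln1pexp w * expR (- w) * ln1pexp v `^ (- (3 / 2)) * regular_factor v w
    * weight v w <= 12288 * envelope v * expR (- (`|v - w| / 64)).
Proof.
move=> vw; rewrite /regular_factor /weight min_l ?max_r// distrC.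
rewrite ger0_norm ?subr_ge0//.
set q := (1 + _ + _)^-1.
have q0 : 0 <= q by rewrite invr_ge0 !addr_ge0 ?E.
have q1 : q <= 1 * expR 0 by rewrite expR0 mulr1; apply: ler_inv_1; exact: E.
have qe : q <= 1 * expR v by rewrite mul1r; apply: ler_inv_exp; exact: E.
have l0 := ltW (ln1pexp_gt0 w).
have -> : forall a b c, ln1pexp w * expR (- w) * ln1pexp v `^ (- (3 / 2))
    * (expR (- (w - v)) * q * (2 + expR w)) * (a * b * c) =
    (ln1pexp v `^ (- (3 / 2)) * q * a) *
     ((ln1pexp w * (1 + 2 * expR (- w)) * (b * c)) * expR (- (w - v))).
  move=> a b c; rewrite opprB expRD !expRN; field.
  by rewrite !gt_eqF ?expR_gt0.
have P (x : R) : 0 <= 1 + expR x by rewrite addr_ge0 ?E.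
have h5 : 0 <= 1 + 2 * expR (- w) by rewrite addr_ge0 ?mulr_ge0 ?E.
have a0 : 0 <= ln1pexp v `^ (- (3 / 2)) * q * (1 + expR (- (v / 6))).
  by rewrite !mulr_ge0// powR_ge0.
have b0 : 0 <= ln1pexp w * (1 + 2 * expR (- w)) *
    ((1 + expR (7 / 16 * w)) * (1 + expR (w / 64))).
  by rewrite !mulr_ge0.
have c0 : 0 <= ln1pexp w * (1 + 2 * expR (- w)) by rewrite mulr_ge0.
have bpos : 0 <= w -> ln1pexp w * (1 + 2 * expR (- w)) *
    ((1 + expR (7 / 16 * w)) * (1 + expR (w / 64))) <=
    768 * expR (15 / 32 * w).
  move=> w0.
  have h2 : 1 + 2 * expR (- w) <= 3 * expR 0.
    have := @one_expR_le0 _ (- w); rewrite expR0; lra.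
  have h3 : 1 + expR (7 / 16 * w) <= 2 * expR (7 / 16 * w).
    by apply: one_expR_le; lra.
  have h4 : 1 + expR (w / 64) <= 2 * expR (w / 64).
    by apply: one_expR_le; lra.
  have := cexpM_le c0 (mulr_ge0 (P _) (P _))
    (cexpM_le l0 h5 (ln1pexp_le_expR64 w) h2) (cexpM_le (P _) (P _) h3 h4).
  by move/le_trans; apply; apply: cexp_le; lra.
have bneg : w <= 0 -> ln1pexp w * (1 + 2 * expR (- w)) *
    ((1 + expR (7 / 16 * w)) * (1 + expR (w / 64))) <= 12 * expR 0.
  move=> w0.
  have h1 : ln1pexp w <= 1 * expR w by rewrite mul1r ln1pexp_le_expR.
  have h2 : 1 + 2 * expR (- w) <= 3 * expR (- w).
    have := @one_expR_le _ (- w); lra.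
  have h3 : 1 + expR (7 / 16 * w) <= 2 * expR 0 by apply: one_expR_le0; lra.
  have h4 : 1 + expR (w / 64) <= 2 * expR 0 by apply: one_expR_le0; lra.
  have := cexpM_le c0 (mulr_ge0 (P _) (P _))
    (cexpM_le l0 h5 h1 h2) (cexpM_le (P _) (P _) h3 h4).
  by move/le_trans; apply; apply: cexp_le; lra.
have D (x : R) : expR x <= 1 * expR x by rewrite mul1r.
have [v0|v0] := leP 0 v.
  have w0 : 0 <= w by lra.
  have h1 : ln1pexp v `^ (- (3 / 2)) <= 8 * expR 0.
    apply: le_trans (ln1pexp_powN32 v) _.
    have := @one_expR_le0 _ (- (3 / 2 * v)); lra.
  have h3 : 1 + expR (- (v / 6)) <= 2 * expR 0 by apply: one_expR_le0; lra.
  have := cexpM_le a0 (mulr_ge0 b0 (E _))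
    (cexpM_le (mulr_ge0 (powR_ge0 _ _) q0) (P _)
      (cexpM_le (powR_ge0 _ _) q0 h1 q1) h3)
    (cexpM_le b0 (E _) (bpos w0) (D (- (w - v)))).
  move/le_trans; apply.
  apply: (cexp_le_envelope (c := 15 / 32 * v)).
  - by clear; lra.
  - by clear; lra.
  - by rewrite /envelope lerDr E.
  - by clear -v0 vw; lra.
have h1 : ln1pexp v `^ (- (3 / 2)) <= 8 * expR (- (3 / 2 * v)).
  apply: le_trans (ln1pexp_powN32 v) _.
  have := @one_expR_le _ (- (3 / 2 * v)); lra.
have h3 : 1 + expR (- (v / 6)) <= 2 * expR (- (v / 6)).
  by apply: one_expR_le; lra.
have fin (e : R) :
    ln1pexp w * (1 + 2 * expR (- w)) *
    ((1 + expR (7 / 16 * w)) * (1 + expR (w / 64))) <= 768 * expR e ->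
    e <= 15 / 32 * (w - v) ->
    ln1pexp v `^ (- (3 / 2)) * q * (1 + expR (- (v / 6))) *
    (ln1pexp w * (1 + 2 * expR (- w)) *
     ((1 + expR (7 / 16 * w)) * (1 + expR (w / 64))) * expR (- (w - v)))
    <= 12288 * envelope v * expR (- ((w - v) / 64)).
  move=> he ew.
  have := cexpM_le a0 (mulr_ge0 b0 (E _))
    (cexpM_le (mulr_ge0 (powR_ge0 _ _) q0) (P _)
      (cexpM_le (powR_ge0 _ _) q0 h1 qe) h3)
    (cexpM_le b0 (E _) he (D (- (w - v)))).
  move/le_trans; apply.
  apply: (cexp_le_envelope (c := - (2 / 3 * v))).
  - by clear; lra.
  - by clear; lra.
  - by rewrite /envelope lerDl E.
  - by clear -ew v0 vw; lra.
have [w0|w0] := leP 0 w; last first.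
  apply: (fin 0); last by clear -vw v0 w0; lra.
  by apply: le_trans (bneg (ltW w0)) _; apply: cexp_le; clear; lra.
by apply: fin (bpos w0) _; lra.
Qed.

Lemma kernel_bound : exists2 C : R, 0 <= C & forall v w,
  ln1pexp w * expR (- w) * ln1pexp v `^ (- (3 / 2)) * regular_factor v w
    * weight v w <= C * envelope v * expR (- (`|v - w| / 64)).
Proof.
exists 12288; first by rewrite ler0n.
by move=> v w; have [/kernel_bound_le|/ltW/kernel_bound_ge] := leP w v.
Qed.

End kernel_bound.

Section measurability.
Context d (T : measurableType d) (R : realType).
Implicit Types f g : T -> R.

Lemma measurable_inv_ge0 f : measurable_fun setT f -> (forall x, 0 <= f x) ->
  measurable_fun setT (fun x => (f x)^-1).
Proof.
move=> mf f0; under eq_fun do rewrite -powR_inv1//.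
exact: (measurableT_comp (measurable_powR _)).
Qed.

Lemma measurable_expR_comp f : measurable_fun setT f ->
  measurable_fun setT (fun x => expR (f x)).
Proof. by move=> mf; apply: measurableT_comp => //; exact: measurable_expR. Qed.

Lemma measurable_ln1pexp_comp f : measurable_fun setT f ->
  measurable_fun setT (fun x => ln1pexp (f x)).
Proof.
move=> mf; apply: measurableT_comp => //.
exact: continuous_measurable_fun continuous_ln1pexp.
Qed.

Lemma measurable_powR_comp f (e : R) : measurable_fun setT f ->
  measurable_fun setT (fun x => f x `^ e).
Proof. exact: (measurableT_comp (measurable_powR e)). Qed.

Lemma measurable_normr_comp f : measurable_fun setT f ->
  measurable_fun setT (fun x => `|f x|).
Proof. by move=> mf; exact: measurableT_comp. Qed.

Lemma measurable_opp_comp f : measurable_fun setT f ->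
  measurable_fun setT (fun x => - f x).
Proof. by move=> mf; exact: measurableT_comp. Qed.

End measurability.

Section envelope.
Context {R : realType}.
Local Notation leb := (@lebesgue_measure R).
Implicit Types (v w : R).

Lemma measurable_envelope : measurable_fun setT (@envelope R).
Proof.
by apply: measurable_funD; apply: measurable_expR_comp;
   rewrite ?mulNr; do ?apply: measurable_opp_comp; exact: measurable_funM.
Qed.

Lemma envelope_ge1 v : 1 <= envelope v.
Proof.
rewrite /envelope; have a0 := expR_ge0 (- (2 / 3 * v)).
have b0 := expR_ge0 (15 / 32 * v).
have [v0|v0] := leP 0 v.
  have : 1 <= expR (15 / 32 * v) by rewrite -[leLHS]expR0 ler_expR; lra.
  lra.
have : 1 <= expR (- (2 / 3 * v)) by rewrite -[leLHS]expR0 ler_expR; lra.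
lra.
Qed.

(** The exponents add up to [15/16 - 1 + 5/128 = - 3/128] for [v >= 0] and to
    [- 4/3 - 1 + 5/2 = 1/6] for [v < 0]: decay at rate at least 1/64 on both sides. The right side
    is written with [0 - v] to match [profile] centred at 0. *)
Lemma envelope_density : exists2 C : R, 0 <= C &
  forall v, envelope v ^+ 2 * nu_density v <= C * expR (- (`|0 - v| / 64)).
Proof.
pose K : R := 64 `^ (5 / 2).
have K0 : 0 <= K by exact: powR_ge0.
exists (4 + 4 * K); first by lra.
move=> v; rewrite sub0r normrN /nu_density /envelope.
set A := expR (- (2 / 3 * v)); set B := expR (15 / 32 * v).
have A0 : 0 <= A by exact: expR_ge0.
have B0 : 0 <= B by exact: expR_ge0.
have l0 := ltW (ln1pexp_gt0 v).
have [v0|v0] := leP 0 v.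
  rewrite ger0_norm//.
  have AB : A <= B by rewrite ler_expR; lra.
  have h1 : (A + B) ^+ 2 <= 4 * expR (15 / 16 * v).
    rewrite (_ : 15 / 16 * v = 15 / 32 * v + 15 / 32 * v); last by lra.
    by rewrite expRD -/B; nra.
  have h2 : ln1pexp v `^ (5 / 2) <= K * expR (5 / 128 * v).
    rewrite (_ : 5 / 128 * v = (v / 64) * (5 / 2)); last by lra.
    rewrite -powR_expR /K -powRM ?expR_ge0//.
    apply: ge0_ler_powR; rewrite ?nnegrE ?mulr_ge0 ?expR_ge0//.
    exact: ln1pexp_le_expR64.
  have h3 : expR (- v) <= 1 * expR (- v) by rewrite mul1r.
  have h := cexpM_le (sqr_ge0 (A + B)) (mulr_ge0 (expR_ge0 _) (powR_ge0 _ _))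
    h1 (cexpM_le (expR_ge0 _) (powR_ge0 _ _) h3 h2).
  apply: le_trans h _; apply: cexp_le; first lra.
    by rewrite mul1r; lra.
  by clear -v0; lra.
rewrite ltr0_norm//.
have AB : B <= A by rewrite ler_expR; lra.
have h1 : (A + B) ^+ 2 <= 4 * expR (- (4 / 3 * v)).
  rewrite (_ : - (4 / 3 * v) = - (2 / 3 * v) + - (2 / 3 * v)); last by lra.
  by rewrite expRD -/A; nra.
have h2 : ln1pexp v `^ (5 / 2) <= 1 * expR (5 / 2 * v).
  rewrite mul1r (_ : 5 / 2 * v = v * (5 / 2)); last by lra.
  rewrite -powR_expR; apply: ge0_ler_powR; rewrite ?nnegrE ?expR_ge0//.
  exact: ln1pexp_le_expR.
have h3 : expR (- v) <= 1 * expR (- v) by rewrite mul1r.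
have h := cexpM_le (sqr_ge0 (A + B)) (mulr_ge0 (expR_ge0 _) (powR_ge0 _ _))
  h1 (cexpM_le (expR_ge0 _) (powR_ge0 _ _) h3 h2).
apply: le_trans h _; apply: cexp_le; first lra.
  by rewrite !mulr1; lra.
by clear -v0; lra.
Qed.

Lemma envelope_sq_lty : (\int[nu]_v ((envelope v : R) ^+ 2)%:E < +oo)%E.
Proof.
rewrite integral_nu; last 2 first.
- exact: measurable_funX measurable_envelope.
- by move=> v; exact: sqr_ge0.
have [C C0 hC] := envelope_density.
have mp : measurable_fun setT (fun w : R => profile 1 `|0 - w|).
  apply: (measurableT_comp (measurable_profile 1)).
  by apply: measurable_normr_comp; exact: measurable_funB.
apply: (@le_lt_trans _ _ (\int[leb]_v (C%:E * (profile 1 `|0 - v|)%:E))%E).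
  apply: ge0_le_integral => //.
  - by move=> v _; rewrite lee_fin mulr_ge0 ?sqr_ge0 ?nu_density_ge0.
  - apply/measurable_EFinP; apply: measurable_funM.
      exact: measurable_funX measurable_envelope.
    exact: measurable_nu_density.
  - by apply: measurable_funeM; apply/measurable_EFinP.
  - move=> v _; rewrite -EFinM lee_fin; apply: le_trans (hC v) _.
    by rewrite ler_wpM2l// lerDl mulr_ge0 ?expR_ge0 ?powR_ge0.
rewrite ge0_integralZl//; last 2 first.
- exact/measurable_EFinP.
- by move=> v _; rewrite lee_fin profile_ge0.
by rewrite lte_mul_pinfty// (le_lt_trans (integral_profile_le 0 ltr01)) ?ltry.
Qed.

Lemma nu_setT_lty : (nu [set: R] < +oo)%E.
Proof.
apply: le_lt_trans envelope_sq_lty.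
rewrite -[leLHS]mul1e -integral_cst//.
apply: ge0_le_integral => //.
  by apply/measurable_EFinP; exact: measurable_funX measurable_envelope.
by move=> v _; rewrite lee_fin expr_ge1 ?envelope_ge1 ?envelope_ge0.
Qed.

End envelope.

(** * The singular kernel, damped and integrated *)

Section kernels.
Context {R : realType} (p : params R).
Local Notation leb := (@lebesgue_measure R).
Local Notation nbar := (par_nbar p).
Local Notation alpha := (par_alpha p).
Local Notation mu := (par_mu p).
Local Notation a := (par_a p).
Local Notation gamma0 := (par_gamma0 p).
Local Notation kappa := (par_kappa p).
Local Notation mu' := (par_mu' p).
Implicit Types (v w th : R).

Lemma K3_sym v w : K3 p v w = K3 p w v.
Proof.
by rewrite /K3 (mulrC (ln1pexp v)) (distrC v) (minC v) (maxC v).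
Qed.

Lemma K3_ge0 v w : 0 <= K3 p v w.
Proof.
have n0 := ltW (par_nbar_gt0 p).
have h1 := onem_expRN_ge0 (normr_ge0 (v - w)).
by rewrite /K3 !mulr_ge0 ?invr_ge0 ?h1 ?powR_ge0 ?expR_ge0// ?addr_ge0 ?expR_ge0.
Qed.

(** The singular denominator vanishes and its inverse is 0 by convention, so pointwise bounds can be
    stated on the diagonal as well. *)
Lemma K3_diag v : K3 p v v = 0.
Proof. by rewrite /K3 subrr normr0 oppr0 expR0 subrr invr0 !mulr0. Qed.

(** The density contributes the power 5/2 of [ln1pexp w] and the kernel the power -3/2, leaving a
    first power. *)
Lemma K3E v w : nu_density w * K3 p v w =
  4 * nbar * (ln1pexp w * expR (- w) * ln1pexp v `^ (- (3 / 2))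
    * regular_factor v w) / (1 - expR (- `|v - w|)).
Proof.
rewrite /K3 /nu_density /regular_factor.
have lw := ln1pexp_gt0 w; have lv := ln1pexp_gt0 v.
rewrite powRM ?ltW//.
have -> : ln1pexp w `^ (5 / 2) = ln1pexp w * ln1pexp w `^ (3 / 2).
  rewrite -{2}[ln1pexp w]powRr1 ?ltW// -powRD ?gt_eqF ?implybT//.
  by congr (_ `^ _); lra.
have l3 : ln1pexp w `^ (3 / 2) * ln1pexp w `^ (- (3 / 2)) = 1.
  by rewrite powRN mulfV// gt_eqF// powR_gt0.
move: l3; set x := _ `^ (3 / 2); set y := _ `^ _ => xy.
rewrite -[RHS]mulr1 -xy; ring.
Qed.

(** The integrand produced by increments that are Hoelder of exponent [th] and grow like the
    weights. Any [th > 0] makes the singularity, of order -1 in the distance, integrable. *)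
Definition Gkernel th v w : R :=
  K3 p v w * (1 - expR (- `|v - w|)) `^ th * weight v w.

Lemma Gkernel_ge0 th v w : 0 <= Gkernel th v w.
Proof.
by apply: mulr_ge0; [apply: mulr_ge0; [exact: K3_ge0|exact: powR_ge0]|
  exact: weight_ge0].
Qed.

Lemma Gkernel_sym th v w : Gkernel th v w = Gkernel th w v.
Proof.
by rewrite /Gkernel K3_sym (distrC v) /weight (minC v) (maxC v).
Qed.

Lemma Gkernel_le : exists2 C : R, 0 <= C & forall th v w, 0 <= th ->
  Gkernel th v w * nu_density w <= C * envelope v * profile th `|v - w|.
Proof.
have n0 := ltW (par_nbar_gt0 p); have [C C0 hC] := @kernel_bound R.
have D0 : 0 <= 4 * nbar * C by rewrite !mulr_ge0.
exists (4 * nbar * C) => //.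
move=> th v w th0; have [<-|vw] := eqVneq v w.
  rewrite /Gkernel K3_diag 3!mul0r.
  exact: mulr_ge0 (mulr_ge0 D0 (envelope_ge0 _)) (profile_ge0 _ _).
have r0 : 0 < `|v - w| by rewrite normr_gt0 subr_eq0.
have x0 := onem_expRN_gt0 r0.
have -> : Gkernel th v w * nu_density w = 4 * nbar * (ln1pexp w * expR (- w) * ln1pexp v `^ (- (3 / 2))
    * regular_factor v w * weight v w) * (1 - expR (- `|v - w|)) `^ (th - 1).
  rewrite powRB1// /Gkernel.
  have E1 (k x W n c t X : R) : n * k = c * t / X ->
      k * x * W * n = c * (t * W) * (x / X).
    move=> nk; rewrite (_ : k * x * W * n = n * k * (W * x)); last by ring.
    by rewrite nk; ring.
  exact: E1 (K3E v w).
have h : ln1pexp w * expR (- w) * ln1pexp v `^ (- (3 / 2))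
    * regular_factor v w * weight v w * (1 - expR (- `|v - w|)) `^ (th - 1) <=
    C * envelope v * profile th `|v - w|.
  apply: (@le_trans _ _ (C * envelope v * expR (- (`|v - w| / 64))
     * (1 - expR (- `|v - w|)) `^ (th - 1))).
    by rewrite ler_wpM2r ?powR_ge0.
  rewrite -mulrA ler_wpM2l ?mulr_ge0 ?envelope_ge0//.
  exact: le_profile.
have E3 (c t x D y z : R) : 0 <= c -> t * x <= D * y * z ->
    c * t * x <= c * D * y * z.
  by move=> c0 txy; rewrite -!mulrA ler_wpM2l// !mulrA.
have n4 : 0 <= 4 * nbar by rewrite mulr_ge0.
exact: E3 n4 h.
Qed.

Lemma measurable_K3 d (T : measurableType d) (f g : T -> R) :
  measurable_fun setT f -> measurable_fun setT g ->
  measurable_fun setT (fun x => K3 p (f x) (g x)).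
Proof.
move=> mf mg.
have mmax : measurable_fun setT (fun x => Num.max (f x) (g x)).
  exact: measurable_maxr.
have mmin : measurable_fun setT (fun x => Num.min (f x) (g x)).
  exact: measurable_minr.
have mr : measurable_fun setT (fun x => expR (- `|f x - g x|)).
  apply: measurable_expR_comp; apply: measurable_opp_comp.
  by apply: measurable_normr_comp; exact: measurable_funB.
repeat apply: measurable_funM => //.
- apply: measurable_powR_comp.
  by apply: measurable_funM; exact: measurable_ln1pexp_comp.
- apply: measurable_inv_ge0.
    apply: measurable_funD; first apply: measurable_funD => //;
    by apply: measurable_expR_comp; exact: measurable_opp_comp.
  by move=> x; rewrite !addr_ge0 ?expR_ge0.
- by apply: measurable_funD => //; exact: measurable_expR_comp.
- apply: measurable_inv_ge0; first exact: measurable_funB.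
  by move=> x; exact: onem_expRN_ge0.
Qed.

Lemma measurable_Gkernel th d (T : measurableType d) (f g : T -> R) :
  measurable_fun setT f -> measurable_fun setT g ->
  measurable_fun setT (fun x => Gkernel th (f x) (g x)).
Proof.
move=> mf mg.
have mmax : measurable_fun setT (fun x => Num.max (f x) (g x)).
  exact: measurable_maxr.
have mmin : measurable_fun setT (fun x => Num.min (f x) (g x)).
  exact: measurable_minr.
apply: measurable_funM; first apply: measurable_funM.
- exact: measurable_K3.
- apply: measurable_powR_comp; apply: measurable_funB => //.
  apply: measurable_expR_comp; apply: measurable_opp_comp.
  by apply: measurable_normr_comp; exact: measurable_funB.
- repeat apply: measurable_funM; apply: measurable_funD => //;
    apply: measurable_expR_comp => //; do ?apply: measurable_opp_comp;
    exact: measurable_funM.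
Qed.

Lemma integral_Gkernel_le th : 0 < th -> exists2 C : R, 0 <= C & forall v,
  (\int[nu]_w (Gkernel th v w)%:E <= (C * envelope v)%:E)%E.
Proof.
move=> th0; have [C C0 hC] := Gkernel_le.
exists (C * (4 * (64 + th^-1))).
  by rewrite !mulr_ge0// addr_ge0// invr_ge0 ltW.
move=> v.
have mG : measurable_fun setT (fun w => Gkernel th v w).
  by apply: measurable_Gkernel.
have mp : measurable_fun setT (fun w : R => profile th `|v - w|).
  apply: (measurableT_comp (measurable_profile th)).
  by apply: measurable_normr_comp; exact: measurable_funB.
rewrite integral_nu//; last by move=> w; exact: Gkernel_ge0.
apply: (@le_trans _ _ (\int[leb]_w ((C * envelope v)%:E
    * (profile th `|v - w|)%:E))%E).
  apply: ge0_le_integral => //.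
  - by move=> w _; rewrite lee_fin mulr_ge0 ?Gkernel_ge0 ?nu_density_ge0.
  - apply/measurable_EFinP; apply: measurable_funM => //.
    exact: measurable_nu_density.
  - by apply: measurable_funeM; apply/measurable_EFinP.
  - by move=> w _; rewrite -EFinM lee_fin; apply: hC; exact: ltW.
have c0 : 0 <= C * envelope v by rewrite mulr_ge0 ?envelope_ge0.
rewrite ge0_integralZl//; last 2 first.
- exact/measurable_EFinP.
- by move=> w _; rewrite lee_fin profile_ge0.
have -> : C * (4 * (64 + th^-1)) * envelope v =
  C * envelope v * (4 * (64 + th^-1)) by ring.
rewrite [leRHS]EFinM; apply: lee_wpmul2l => //.
exact: integral_profile_le.
Qed.

End kernels.

(** * The regularized kernel and the weights of the function spaces *)

Section kernels_eps.
Context {R : realType} (p : params R).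
Local Notation nbar := (par_nbar p).
Local Notation alpha := (par_alpha p).
Local Notation mu := (par_mu p).
Local Notation a := (par_a p).
Local Notation gamma0 := (par_gamma0 p).
Local Notation kappa := (par_kappa p).
Local Notation mu' := (par_mu' p).
Implicit Types (v w th e x y : R).

Lemma eps_gt0 e w : 0 < e -> 0 < eps p e w.
Proof. by move=> e0; rewrite mulr_gt0 ?expR_gt0. Qed.

Lemma K3eps_sym e v w : K3eps p e v w = K3eps p e w v.
Proof. by rewrite /K3eps K3_sym (distrC v) (maxC v). Qed.

Lemma cutoff_ge0 x y : 0 < x -> 0 <= y ->
  0 <= (1 - expR (- Num.min x y)) / (1 - expR (- x)).
Proof.
move=> x0 y0; apply: divr_ge0; apply: onem_expRN_ge0; last exact: ltW.
by rewrite le_min (ltW x0).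
Qed.

Lemma cutoff_le1 x y : 0 < x ->
  (1 - expR (- Num.min x y)) / (1 - expR (- x)) <= 1.
Proof.
move=> x0; rewrite ler_pdivrMr ?onem_expRN_gt0// mul1r.
by rewrite lerD2l lerN2 ler_expR lerN2 ge_min lexx.
Qed.

Lemma K3eps_ge0 e v w : 0 < e -> 0 <= K3eps p e v w.
Proof.
by move=> e0; rewrite mulr_ge0 ?K3_ge0// cutoff_ge0 ?eps_gt0.
Qed.

Lemma K3eps_le e v w : 0 < e -> K3eps p e v w <= K3 p v w.
Proof.
by move=> e0; rewrite /K3eps ler_piMr ?K3_ge0// cutoff_le1// eps_gt0.
Qed.

Lemma K3eps_eq e v w : 0 < e -> eps p e (Num.max v w) <= `|v - w| ->
  K3eps p e v w = K3 p v w.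
Proof.
move=> e0 h; rewrite /K3eps min_l// mulfV ?mulr1//.
by rewrite gt_eqF// onem_expRN_gt0// eps_gt0.
Qed.

Lemma measurable_K3eps e d (T : measurableType d) (f g : T -> R) : 0 < e ->
  measurable_fun setT f -> measurable_fun setT g ->
  measurable_fun setT (fun z => K3eps p e (f z) (g z)).
Proof.
move=> e0 mf mg.
have mmax : measurable_fun setT (fun z => Num.max (f z) (g z)).
  exact: measurable_maxr.
have meps : measurable_fun setT (fun z => eps p e (Num.max (f z) (g z))).
  apply: measurable_funM => //; apply: measurable_expR_comp.
  by apply: measurable_funM => //; exact: measurable_maxr.
apply: measurable_funM; first exact: measurable_K3.
apply: measurable_funM.
  apply: measurable_funB => //; apply: measurable_expR_comp.
  apply: measurable_opp_comp; apply: measurable_minr => //.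
  by apply: measurable_normr_comp; exact: measurable_funB.
apply: measurable_inv_ge0.
  apply: measurable_funB => //; apply: measurable_expR_comp.
  exact: measurable_opp_comp.
by move=> x; apply: onem_expRN_ge0; exact/ltW/eps_gt0.
Qed.

Lemma onem_expRN_lb x : 0 <= x -> x / (1 + x) <= 1 - expR (- x).
Proof.
move=> x0; have x1 : 0 < 1 + x by lra.
have h : expR (- x) <= (1 + x)^-1.
  by rewrite expRN lef_pV2 ?posrE ?expR_gt0// expR_ge1Dx.
suff -> : x / (1 + x) = 1 - (1 + x)^-1 by lra.
by field; rewrite gt_eqF.
Qed.

Lemma onem_expRN_ub x : 1 - expR (- x) <= x.
Proof. by have := expR_ge1Dx (- x); lra. Qed.

(** The cutoff is the minimum of 1 and a quotient, hence at most any power in [0, 1] of that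
    quotient; the inverse of its denominator is at most [1 + x^-1]. *)
Lemma cutoff_le_powR th x y : 0 < x -> 0 < y -> 0 <= th <= 1 ->
  (1 - expR (- Num.min x y)) / (1 - expR (- x)) <=
  (1 + x^-1) `^ th * (1 - expR (- y)) `^ th.
Proof.
move=> x0 y0 /andP[th0 th1].
have X0 := onem_expRN_gt0 x0; have Y0 := onem_expRN_gt0 y0.
have xi : 0 < x^-1 by rewrite invr_gt0.
have hX : 1 <= (1 + x^-1) * (1 - expR (- x)).
  have h := onem_expRN_lb (ltW x0).
  apply: (@le_trans _ _ ((1 + x^-1) * (x / (1 + x)))).
    by rewrite (_ : _ * _ = 1)//; field; rewrite !gt_eqF// addr_gt0.
  by rewrite ler_pM2l// addr_gt0.
rewrite -powRM ?(ltW Y0) ?addr_ge0 ?(ltW xi)//.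
have [xy|/ltW yx] := leP x y.
  rewrite mulfV ?gt_eqF//.
  suff : 1 `^ th <= ((1 + x^-1) * (1 - expR (- y))) `^ th by rewrite powR1.
  have h : 1 <= (1 + x^-1) * (1 - expR (- y)).
    apply: le_trans hX _; rewrite ler_pM2l ?addr_gt0//.
    by rewrite lerD2l lerN2 ler_expR lerN2.
  by apply: ge0_ler_powR => //; rewrite nnegrE ?(le_trans _ h).
pose z := (1 - expR (- y)) / (1 - expR (- x)); rewrite -/z.
have z0 : 0 < z by rewrite divr_gt0.
have z1 : z <= 1.
  by rewrite ler_pdivrMr// mul1r lerD2l lerN2 ler_expR lerN2.
apply: (@le_trans _ _ (z `^ th)).
  by rewrite ger1_powR ?z0.
apply: ge0_ler_powR; rewrite ?nnegrE ?(ltW z0)//.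
  by apply: mulr_ge0; [rewrite addr_ge0 ?(ltW xi)|exact: ltW].
rewrite ler_pdivrMr// mulrAC mulrC -[leLHS]mulr1.
by rewrite ler_wpM2l// ltW.
Qed.

(** The cutoff gains a power [th] of the distance at the price of the same power of the inverse of
    [eps]. That inverse grows exponentially at rate [mu' / gamma0], so a small [th] brings the
    growth under the rate 1/64 kept in reserve in [weight]. *)
Lemma K3eps_le_powR e : 0 < e -> exists th C : R, [/\ 0 < th, 0 <= C &
  forall v w, K3eps p e v w <=
    C * (K3 p v w * (1 - expR (- `|v - w|)) `^ th
         * (1 + expR (Num.max v w / 64)))].
Proof.
move=> e0.
have g0 : 0 < gamma0 by case/andP: (par_gamma0_bounds p).
have mu0 : 0 < mu'.
  apply: lt_trans (par_mu'_gt_mu p).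
  by have /andP[h _] := par_mu_bounds p; apply: lt_le_trans h.
have a0 : 0 < a by apply: lt_le_trans (par_a_ge9 p).
have a10 : 0 < a1 p by rewrite /a1 /c0 divr_gt0.
pose c := mu' / gamma0; have c0 : 0 < c by rewrite divr_gt0.
(* The bound 1 is what [cutoff_le_powR] asks for; the other one gives [th * c <= 1/64]. *)
pose th := Num.min 1 ((64 * c)^-1).
have th0 : 0 < th by rewrite lt_min ltr01 invr_gt0 mulr_gt0.
have th1 : th <= 1 by rewrite ge_min lexx.
have thc : th * c <= 64^-1.
  apply: (@le_trans _ _ ((64 * c)^-1 * c)).
    by rewrite ler_wpM2r ?(ltW c0)// ge_min lexx orbT.
  by rewrite invfM mulfVK ?gt_eqF// divfK ?gt_eqF.
have ei : 0 < e^-1 by rewrite invr_gt0.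
pose D := (1 + e^-1) `^ th * expR (a1 p / 64).
have D0 : 0 <= D by rewrite mulr_ge0 ?powR_ge0 ?expR_ge0.
exists th, D; split => // v w.
have [<-|vw] := eqVneq v w.
  by rewrite /K3eps K3_diag !mul0r mulr0.
have r0 : 0 < `|v - w| by rewrite normr_gt0 subr_eq0.
set M := Num.max v w.
have e10 := @eps_gt0 e M e0.
have hcut := @cutoff_le_powR th _ _ e10 r0.
have hD : (1 + (eps p e M)^-1) `^ th <= D * (1 + expR (M / 64)).
  have h1 : 1 + (eps p e M)^-1 <= (1 + e^-1) * expR (c * Num.max (a1 p) M).
    rewrite /eps invfM -expRN mulNr opprK -/c.
    have : 1 <= expR (c * Num.max (a1 p) M).
      rewrite -[leLHS]expR0 ler_expR mulr_ge0 ?(ltW c0)//.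
      by rewrite le_max (ltW a10).
    by rewrite mulrDl mul1r; lra.
  apply: (@le_trans _ _ (((1 + e^-1) * expR (c * Num.max (a1 p) M)) `^ th)).
    apply: ge0_ler_powR; rewrite ?nnegrE ?(ltW th0)//.
      by rewrite addr_ge0 ?invr_ge0 ?(ltW e10).
    by rewrite mulr_ge0 ?expR_ge0 ?addr_ge0 ?(ltW ei).
  rewrite powRM ?expR_ge0 ?addr_ge0 ?(ltW ei)// powR_expR.
  rewrite /D -[leRHS]mulrA ler_wpM2l ?powR_ge0//.
  apply: (@le_trans _ _ (expR (64^-1 * Num.max (a1 p) M))).
    rewrite ler_expR mulrAC (mulrC c).
    by rewrite ler_wpM2r// le_max (ltW a10).
  rewrite mulrDr mulr1.
  have m0 : 0 <= expR (a1 p / 64) * expR (M / 64).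
    by rewrite mulr_ge0 ?expR_ge0.
  have m1 : 1 <= expR (a1 p / 64).
    by rewrite -[leLHS]expR0 ler_expR divr_ge0 ?(ltW a10).
  have [h|h] := leP (a1 p) M.
    rewrite mulrC; apply: (@le_trans _ _ (expR (a1 p / 64) * expR (M / 64))).
      by rewrite ler_peMl ?expR_ge0.
    by rewrite lerDr expR_ge0.
  by rewrite mulrC lerDl.
have k0 := K3_ge0 p v w.
have x0 := powR_ge0 (1 - expR (- `|v - w|)) th.
apply: (@le_trans _ _ (K3 p v w * ((1 + (eps p e M)^-1) `^ th *
   (1 - expR (- `|v - w|)) `^ th))).
  by rewrite ler_wpM2l// hcut// (ltW th0).
have E (k x y z d : R) : 0 <= k -> 0 <= x -> y <= d * z ->
    k * (y * x) <= d * (k * x * z).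
  move=> k0' x0' yz; rewrite (_ : d * _ = k * (d * z * x)); last by ring.
  by rewrite ler_wpM2l// ler_wpM2r.
exact: E.
Qed.

Definition pair_weight v w : R :=
  (1 + expR (- (Num.min v w / 6))) * (1 + expR (7 / 16 * Num.max v w)).

Lemma pair_weight_ge0 v w : 0 <= pair_weight v w.
Proof. by rewrite mulr_ge0 ?addr_ge0 ?expR_ge0. Qed.

Lemma weightE v w :
  weight v w = pair_weight v w * (1 + expR (Num.max v w / 64)).
Proof. by []. Qed.

Lemma f_weight_ge0 v : 0 <= f_weight p v.
Proof. by rewrite le_max powR_ge0. Qed.

(** Since [alpha < 2/13 < 1/6], the rate 1/6 used in the weights dominates the growth at -oo. *)
Lemma f_weight_le v : f_weight p v <= 4 * (1 + expR (- (v / 6))).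
Proof.
have /andP[a0 a1] := par_alpha_bounds p.
have al0 : 0 <= alpha by apply/ltW; apply: lt_trans a0; rewrite invr_gt0.
have al1 : alpha <= 1 / 6.
  by apply: le_trans (ltW a1) _; rewrite mul1r lef_pV2 ?posrE//; lra.
have p2 : 2 `^ alpha <= 2 :> R.
  by rewrite -[leRHS]powRr1//; apply: ler_powR; lra.
have e6 := expR_ge0 (- (v / 6)).
have H u : ln1pexp u `^ (- alpha) <= 2 * (1 + expR (- (alpha * u))).
  apply: le_trans (ln1pexp_powN u al0) _.
  by rewrite ler_wpM2r ?addr_ge0 ?expR_ge0.
rewrite /f_weight ge_max; apply/andP; split.
  apply: le_trans (H v) _.
  have [v0|v0] := leP 0 v.
    have : expR (- (alpha * v)) <= 1 by rewrite expR_le1 oppr_le0 mulr_ge0.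
    lra.
  have : expR (- (alpha * v)) <= expR (- (v / 6)).
    rewrite ler_expR lerN2 (mulrC alpha) ler_wnM2l ?(ltW v0)//.
    by rewrite -[leRHS]mul1r.
  lra.
(* The constant branch of the maximum is the other branch at the point 0, because
   [ln1pexp 0 = ln 2]. *)
have := H 0; rewrite /ln1pexp expR0 mulr0 oppr0 expR0.
by move/le_trans; apply; lra.
Qed.

(** If [u <= a], the constant absorbs everything; otherwise [u] is positive, hence at most [t], and
    [mu <= 7/16] applies. *)
Lemma expR_mu_le u t : u <= Num.max 0 t ->
  expR (mu * Num.max a u) <= expR (mu * a) * (1 + expR (7 / 16 * t)).
Proof.
move=> ut; have /andP[m0 m1] := par_mu_bounds p.
have mu0 : 0 < mu by apply: lt_le_trans m0; rewrite invr_gt0.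
have a0 : 0 < a by apply: lt_le_trans (par_a_ge9 p).
have E0 := expR_ge0 (mu * a); have E1 := expR_ge0 (7 / 16 * t).
rewrite mulrDr mulr1; have [ua|au] := leP u a.
  by rewrite lerDl mulr_ge0.
have t0 : u <= t.
  by move: ut; rewrite le_max => /orP[|//]; move: au a0; lra.
apply: (@le_trans _ _ (expR (mu * a) * expR (7 / 16 * t))); last first.
  by rewrite lerDr.
rewrite -expRD ler_expR.
have : mu * u <= 7 / 16 * t.
  by apply: ler_pM => //; [exact: ltW|move: au a0; lra].
have := mulr_gt0 mu0 a0; lra.
Qed.

Lemma Gamma_tilde_le : exists2 C : R, 0 <= C & forall v w,
  Gamma_tilde p v <= C * pair_weight v w /\
  Gamma_tilde p w <= C * pair_weight v w.
Proof.
have C0 : 0 <= 4 * expR (mu * a) by rewrite mulr_ge0 ?expR_ge0.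
have H v w u : Num.min v w <= u -> u <= Num.max v w ->
    Gamma_tilde p u <= 4 * expR (mu * a) * pair_weight v w.
  move=> mu_ uM; rewrite /Gamma_tilde /pair_weight.
  have -> : forall c x y d : R, c * x * (y * d) = (c * y) * (x * d).
    by move=> *; ring.
  apply: ler_pM; rewrite ?f_weight_ge0 ?expR_ge0//.
    apply: le_trans (f_weight_le u) _.
    by rewrite ler_wpM2l// lerD2l ler_expR lerN2 ler_wpM2r// invr_ge0.
  apply: expR_mu_le; rewrite le_max /c0.
  have [u0|u0] := leP u 0; first by apply/orP; left; lra.
  by apply/orP; right; lra.
exists (4 * expR (mu * a)) => // v w; split.
  by apply: H; rewrite ?ge_min ?le_max lexx.
by apply: H; rewrite ?ge_min ?le_max lexx orbT.
Qed.

(** Both sides behave like the minimum of 1 and a multiple of [r]; the comparison runs through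
    [r / (1 + r)]. It removes [kappa] from [Gamma0]. *)
Lemma onem_expRN_scale (k r : R) : 1 <= k -> 0 < r ->
  1 - expR (- (k * r)) <= 2 * k * (1 - expR (- r)).
Proof.
move=> k1 r0; have r1 : 0 < 1 + r by lra.
apply: (@le_trans _ _ (2 * k * (r / (1 + r)))); last first.
  by rewrite ler_wpM2l ?onem_expRN_lb ?(ltW r0)//; lra.
rewrite mulrA ler_pdivlMr//.
have [r_le1|r_gt1] := leP r 1.
  have h : 1 - expR (- (k * r)) <= k * r by exact: onem_expRN_ub.
  have kr : 0 <= k * r by rewrite mulr_ge0; lra.
  have : (1 - expR (- (k * r))) * (1 + r) <= (k * r) * 2.
    by apply: ler_pM => //; [apply: onem_expRN_ge0|lra|lra].
  lra.
have h : (1 - expR (- (k * r))) * (1 + r) <= 1 * (2 * r).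
  apply: ler_pM; [|lra|exact: onem_expRN_le1|lra].
  by apply: onem_expRN_ge0; rewrite mulr_ge0; lra.
apply: le_trans h _; rewrite mul1r -mulrA ler_wpM2l//.
by rewrite ler_peMl; lra.
Qed.

Lemma Gamma0_le : exists2 C : R, 0 <= C & forall v w, w < v ->
  Gamma0 p v (v - w) <=
  C * (pair_weight v w * (1 - expR (- `|v - w|)) `^ gamma0).
Proof.
have /andP[g0 g1] := par_gamma0_bounds p.
have k1 : 1 <= kappa by apply: le_trans (par_kappa_ge7 p); rewrite ler1n.
have C0 : 0 <= 8 * expR (mu * a) by rewrite mulr_ge0 ?expR_ge0.
exists (8 * expR (mu * a) * (2 * kappa)).
  by rewrite mulr_ge0// mulr_ge0//; lra.
move=> v w wv; rewrite /Gamma0 /pair_weight subKr (min_r (ltW wv)) (max_l (ltW wv)).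
rewrite gtr0_norm ?subr_gt0//.
have r0 : 0 < v - w by rewrite subr_gt0.
have h1 : f_weight p v + f_weight p w <= 8 * (1 + expR (- (w / 6))).
  have h0 : expR (- (v / 6)) <= expR (- (w / 6)).
    by rewrite ler_expR lerN2 ler_wpM2r ?(ltW wv).
  have S (x y c d : R) : x <= 4 * (1 + c) -> y <= 4 * (1 + d) -> c <= d ->
    x + y <= 8 * (1 + d) by clear; lra.
  exact: S (f_weight_le v) (f_weight_le w) h0.
have h2 : expR (mu * Num.max (Num.max a (c0 * v)) w) <=
    expR (mu * a) * (1 + expR (7 / 16 * v)).
  rewrite -maxA; apply: expR_mu_le.
  rewrite ge_max !le_max /c0 (ltW wv) orbT andbT.
  case/orP: (le_total v 0) => v0; apply/orP; [left|right]; clear -v0; lra.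
have h3 : (1 - expR (- (kappa * (v - w)))) `^ gamma0 <=
    2 * kappa * (1 - expR (- (v - w))) `^ gamma0.
  have x0 := onem_expRN_gt0 r0.
  have k2 : 1 <= 2 * kappa by clear -k1; lra.
  apply: (@le_trans _ _ ((2 * kappa * (1 - expR (- (v - w)))) `^ gamma0)).
    apply: ge0_ler_powR; rewrite ?nnegrE ?(ltW g0)//.
    - by apply: onem_expRN_ge0; rewrite mulr_ge0 ?(ltW r0)//; clear -k1; lra.
    - by rewrite mulr_ge0 ?(ltW x0)//; clear -k1; lra.
    - exact: onem_expRN_scale.
  rewrite powRM ?(ltW x0)//; last by clear -k1; lra.
  rewrite ler_wpM2r ?powR_ge0//.
  by rewrite -[leRHS]powRr1; [apply: ler_powR|]; clear -k2 g1; lra.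
have -> : forall c d k x y z : R, c * d * k * (x * y * z) =
    (c * x) * (d * y) * (k * z) by move=> *; ring.
apply: ler_pM; rewrite ?powR_ge0//.
  by rewrite mulr_ge0 ?addr_ge0 ?f_weight_ge0 ?expR_ge0.
have f2 : 0 <= f_weight p v + f_weight p w by rewrite addr_ge0 ?f_weight_ge0.
exact: ler_pM f2 (expR_ge0 _) h1 h2.
Qed.

End kernels_eps.

(** * Dirichlet forms and their generators *)

Section partial_integral.
Context d1 d2 (T1 : measurableType d1) (T2 : measurableType d2) (R : realType).
Variable m2 : {sigma_finite_measure set T2 -> \bar R}.

Lemma measurable_partial_integral (f : T1 * T2 -> R) : measurable_fun setT f ->
  measurable_fun setT (fun x => \int[m2]_y f (x, y)).
Proof.
move=> mf; apply: (measurableT_comp (fine_measurable measurableT)).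
have mEf : measurable_fun setT (EFin \o f) by exact/measurable_EFinP.
have -> : (fun x => \int[m2]_y (f (x, y))%:E)%E =
    ((fun x => \int[m2]_y ((EFin \o f)^\+ (x, y))) \-
     (fun x => \int[m2]_y ((EFin \o f)^\- (x, y))))%E.
  apply/funext => x; rewrite [LHS]integralE.
  by congr (_ - _)%E; apply: eq_integral => y _; rewrite !unlock.
apply: emeasurable_funB.
  by apply: measurable_fun_fubini_tonelli_F => //; exact: measurable_funepos.
by apply: measurable_fun_fubini_tonelli_F => //; exact: measurable_funeneg.
Qed.

End partial_integral.

Section form.
Context {R : realType}.
Implicit Types (k : R -> R -> R) (phi psi eta : R -> R[i]).
Local Notation nu2 := (nu \x nu)%E.

(** With the square root of the kernel absorbed, the Dirichlet form is half a scalar product in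
    L^2(nu x nu), and Cauchy-Schwarz and the triangle inequality for it are inherited from [ip] and
    [nrm]. *)
Definition dform k psi (z : R * R) : R[i] :=
  (Num.sqrt (k z.1 z.2))%:C%C * (psi z.1 - psi z.2).

Definition form k phi psi : R := 2^-1 * ip nu2 (dform k phi) (dform k psi).

Definition formdom k psi := L2m nu psi /\ L2m nu2 (dform k psi).

Definition is_kernel k := [/\ forall u v, 0 <= k u v, forall u v, k u v = k v u
  & measurable_fun setT (fun z : R * R => k z.1 z.2)].

(** Multiplication by i in the antilinear argument turns imaginary parts of [inner] and [Qform] into
    real parts. *)
Definition iC psi : R -> R[i] := fun v => 'i%C * psi v.

Lemma cmeasurable_fst psi : cmeasurable setT psi ->
  cmeasurable setT (fun z : R * R => psi z.1).
Proof.
move=> [m1 m2]; split; [exact: (measurableT_comp m1 measurable_fst)|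
  exact: (measurableT_comp m2 measurable_fst)].
Qed.

Lemma cmeasurable_snd psi : cmeasurable setT psi ->
  cmeasurable setT (fun z : R * R => psi z.2).
Proof.
move=> [m1 m2]; split; [exact: (measurableT_comp m1 measurable_snd)|
  exact: (measurableT_comp m2 measurable_snd)].
Qed.

Lemma cmeasurable_diff psi : cmeasurable setT psi ->
  cmeasurable setT (fun z : R * R => psi z.1 - psi z.2).
Proof.
by move=> mpsi; apply: cmeasurableB; [exact: cmeasurable_fst|exact: cmeasurable_snd].
Qed.

Lemma cmeasurable_dform k psi : is_kernel k -> cmeasurable setT psi ->
  cmeasurable setT (dform k psi).
Proof.
move=> [k0 ks mk] mpsi; apply: cmeasurableM; last exact: cmeasurable_diff.
have ms : measurable_fun setT (Num.sqrt : R -> R).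
  by apply: continuous_measurable_fun; exact: sqrt_continuous.
by apply: cmeasurable_real; exact: (measurableT_comp ms mk).
Qed.

Lemma dotc_dform k phi psi z : is_kernel k ->
  dotc (dform k phi z) (dform k psi z) =
  k z.1 z.2 * dotc (phi z.1 - phi z.2) (psi z.1 - psi z.2).
Proof.
by move=> [k0 _ _]; rewrite /dform dotcZl dotcZr mulrA -expr2 sqr_sqrtr.
Qed.

Lemma Cabs_dform k psi z : is_kernel k ->
  Cabs (dform k psi z) ^+ 2 = k z.1 z.2 * Cabs (psi z.1 - psi z.2) ^+ 2.
Proof. by move=> kk; rewrite -!dotczz dotc_dform. Qed.

Lemma Qform_domP k psi : is_kernel k -> Qform_dom k psi <-> formdom k psi.
Proof.
move=> kk; have I0 : (0 <= \int[nu2]_z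
     (k z.1 z.2 * Cabs (psi z.1 - psi z.2) ^+ 2)%:E)%E.
  apply: integral_ge0 => z _; rewrite lee_fin mulr_ge0 ?sqr_ge0//.
  by case: kk.
have E : (\int[nu2]_z (Cabs (dform k psi z) ^+ 2)%:E =
  \int[nu2]_z (k z.1 z.2 * Cabs (psi z.1 - psi z.2) ^+ 2)%:E)%E.
  by apply: eq_integral => z _; rewrite Cabs_dform.
rewrite /Qform_dom /formdom /Qform_diag; split.
  move=> [/L2P Lpsi fin]; split => //; split.
    by apply: cmeasurable_dform => //; case: Lpsi.
  rewrite E ltNge leye_eq; apply/negP => /eqP h; move: fin.
  rewrite h gt0_muley ?lte_fin ?invr_gt0// addye ?ltxx//.
  by rewrite gt_eqF// (lt_le_trans (ltNyr 0))// integral_ge0// => v _;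
     rewrite lee_fin sqr_ge0.
move=> [Lpsi [_ fin]]; split; first exact/L2P.
apply: lte_add_pinfty; last by case: Lpsi.
by apply: lte_mul_pinfty; rewrite ?lee_fin// -E.
Qed.

Lemma ReM_conj (z w : R[i]) : complex.Re (z^*%C * w) = dotc z w.
Proof. by case: z w => [a b] [c e]; rewrite /dotc/=; ring. Qed.

Lemma ImM_conj (z w : R[i]) : complex.Im (z^*%C * w) = dotc ('i%C * z) w.
Proof. by case: z w => [a b] [c e]; rewrite /dotc/=; ring. Qed.

Lemma Re_inner phi psi : complex.Re (inner phi psi) = ip nu phi psi.
Proof. by rewrite /inner /cintegral/=; apply: eq_Rintegral => v _; rewrite ReM_conj. Qed.

Lemma Im_inner phi psi : complex.Im (inner phi psi) = ip nu (iC phi) psi.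
Proof. by rewrite /inner /cintegral/=; apply: eq_Rintegral => v _; rewrite ImM_conj. Qed.

Lemma Re_realM (c : R) (z : R[i]) :
  complex.Re (c%:C%C * z) = c * complex.Re z.
Proof. by case: z => a b /=; rewrite mul0r subr0. Qed.

Lemma Im_realM (c : R) (z : R[i]) :
  complex.Im (c%:C%C * z) = c * complex.Im z.
Proof. by case: z => a b /=; rewrite mul0r addr0. Qed.

Lemma half_complex : 2^-1 = (2^-1 : R)%:C%C :> R[i].
Proof. by rewrite fmorphV/= rmorph_nat. Qed.

Lemma Re_Qform k phi psi : is_kernel k ->
  complex.Re (Qform k phi psi) = form k phi psi + ip nu phi psi.
Proof.
move=> kk; rewrite /Qform half_complex.
transitivity (complex.Re ((2^-1 : R)%:C%C * cintegral nu2 setT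
  (fun z : R * R => ((k z.1 z.2)%:C * (phi z.1 - phi z.2)^* *
    (psi z.1 - psi z.2))%C)) + complex.Re (inner phi psi)).
  exact: raddfD.
rewrite Re_inner; congr (_ + _); rewrite Re_realM; congr (_ * _).
apply: eq_Rintegral => z _.
by rewrite dotc_dform// -ReM_conj -mulrA Re_realM.
Qed.

Lemma Im_Qform k phi psi : is_kernel k ->
  complex.Im (Qform k phi psi) = form k (iC phi) psi + ip nu (iC phi) psi.
Proof.
move=> kk; rewrite /Qform half_complex.
transitivity (complex.Im ((2^-1 : R)%:C%C * cintegral nu2 setT
  (fun z : R * R => ((k z.1 z.2)%:C * (phi z.1 - phi z.2)^* *
    (psi z.1 - psi z.2))%C)) + complex.Im (inner phi psi)).
  exact: raddfD.
rewrite Im_inner; congr (_ + _); rewrite Im_realM; congr (_ * _).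
apply: eq_Rintegral => z _.
by rewrite dotc_dform// /iC -mulrBr -ImM_conj -mulrA Im_realM.
Qed.

End form.

(** * Pointwise action of the generator *)

Section generator.
Context {R : realType}.
Implicit Types (k : R -> R -> R) (phi psi eta : R -> R[i]).
Local Notation nu2 := (nu \x nu)%E.

Lemma Re_sub (z w : R[i]) : complex.Re (z - w) = complex.Re z - complex.Re w.
Proof. exact: raddfB. Qed.

Lemma Im_sub (z w : R[i]) : complex.Im (z - w) = complex.Im z - complex.Im w.
Proof. exact: raddfB. Qed.

(** The formal generator read off from the Dirichlet form, the symmetry of [k] cancelling the factor
    1/2. Under [opbound] the integral converges absolutely and is dominated by a function in
    L^2(nu). *)
Definition Lop k psi v : R[i] :=
  cintegral nu setT (fun w => (k v w)%:C%C * (psi v - psi w)).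

Definition opbound k psi (C : R) := forall v,
  (\int[nu]_w (k v w * Cabs (psi v - psi w))%:E <= (C * envelope v)%:E)%E.

Lemma L2m_envelope : L2m nu (fun v : R => (envelope v)%:C%C).
Proof.
split; first exact: cmeasurable_real measurable_envelope.
apply: le_lt_trans envelope_sq_lty; rewrite le_eqVlt; apply/orP; left.
apply/eqP; apply: eq_integral => v _; congr _%:E.
by rewrite -dotczz /dotc/= mulr0 addr0 -expr2.
Qed.

Section fixed_kernel.
Variables (k : R -> R -> R) (psi : R -> R[i]) (C : R).
Hypotheses (kk : is_kernel k) (Lpsi : L2m nu psi) (kC : opbound k psi C).

Let k0 u v : 0 <= k u v. Proof. by case: kk. Qed.
Let ks u v : k u v = k v u. Proof. by case: kk. Qed.
Let mpsi : cmeasurable setT psi. Proof. by case: Lpsi. Qed.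
Let mk : measurable_fun setT (fun z : R * R => k z.1 z.2).
Proof. by case: kk. Qed.

Let C0 : 0 <= C.
Proof.
have h : (0 <= (C * envelope (0 : R))%:E)%E.
  apply: le_trans (kC 0); apply: integral_ge0 => w _.
  by rewrite lee_fin mulr_ge0 ?Cabs_ge0.
by move: h; rewrite lee_fin pmulr_lge0// (lt_le_trans ltr01)// envelope_ge1.
Qed.

Let mabs : measurable_fun setT
  (fun z : R * R => k z.1 z.2 * Cabs (psi z.1 - psi z.2)).
Proof.
by apply: measurable_funM => //; apply: cmeasurable_Cabs; exact: cmeasurable_diff.
Qed.

Let mabs_sect v : measurable_fun setT
  (fun w => k v w * Cabs (psi v - psi w)).
Proof.
exact: (measurableT_comp mabs (pair1_measurable v)).
Qed.

Let mdiff_sect v : cmeasurable setT (fun w => (k v w)%:C%C * (psi v - psi w)).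
Proof.
apply: cmeasurableM.
  apply: cmeasurable_real.
  exact: (measurableT_comp mk (pair1_measurable v)).
by apply: cmeasurableB => //; exact: cmeasurable_cst.
Qed.

Let int_abs v : nu.-integrable setT
  (EFin \o (fun w => k v w * Cabs (psi v - psi w))).
Proof.
apply/integrableP; split; first exact/measurable_EFinP.
under eq_integral do rewrite /= ger0_norm ?mulr_ge0 ?Cabs_ge0//.
by apply: le_lt_trans (kC v) _; rewrite ltry.
Qed.

Let int_Re v : nu.-integrable setT
  (EFin \o (fun w => complex.Re ((k v w)%:C%C * (psi v - psi w)))).
Proof.
apply: le_integrable (int_abs v) => //.
  by apply/measurable_EFinP; case: (mdiff_sect v).
move=> w _; rewrite lee_fin Re_realM !normrM ler_wpM2l//.
by rewrite (ger0_norm (Cabs_ge0 _)) normRe.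
Qed.

Let int_Im v : nu.-integrable setT
  (EFin \o (fun w => complex.Im ((k v w)%:C%C * (psi v - psi w)))).
Proof.
apply: le_integrable (int_abs v) => //.
  by apply/measurable_EFinP; case: (mdiff_sect v).
move=> w _; rewrite lee_fin Im_realM !normrM ler_wpM2l//.
by rewrite (ger0_norm (Cabs_ge0 _)) normIm.
Qed.

Lemma dotc_Lop z v : (dotc z (Lop k psi v))%:E =
  (\int[nu]_w (k v w * dotc z (psi v - psi w))%:E)%E.
Proof.
rewrite /dotc /Lop /cintegral /=.
rewrite -[X in (X + _)%:E]RintegralZl// -[X in (_ + X)%:E]RintegralZl//.
rewrite -RintegralD//=; last 2 first.
- have := integrableZl measurableT (complex.Re z) (int_Re v).
  by move=> hi; apply: (eq_integrable measurableT _ _ _ hi) => w _; rewrite /= EFinM.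
- have := integrableZl measurableT (complex.Im z) (int_Im v).
  by move=> hi; apply: (eq_integrable measurableT _ _ _ hi) => w _; rewrite /= EFinM.
rewrite fineK; last first.
  apply: integrable_fin_num => //.
  have := integrableD measurableT
    (integrableZl measurableT (complex.Re z) (int_Re v))
    (integrableZl measurableT (complex.Im z) (int_Im v)).
  by move=> hi; apply: (eq_integrable measurableT _ _ _ hi) => w _; rewrite /= -!EFinM -EFinD.
apply: eq_integral => w _; congr _%:E.
by rewrite Re_realM Im_realM; ring.
Qed.

Lemma cmeasurable_Lop : cmeasurable setT (Lop k psi).
Proof.
have m : cmeasurable setT
    (fun z : R * R => (k z.1 z.2)%:C%C * (psi z.1 - psi z.2)).
  by apply: cmeasurableM; [exact: cmeasurable_real|exact: cmeasurable_diff].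
by case: m => m1 m2; split => /=; [exact: (measurable_partial_integral nu m1)|
  exact: (measurable_partial_integral nu m2)].
Qed.

Lemma Cabs_Lop_le v : Cabs (Lop k psi v) <= 2 * C * envelope v.
Proof.
apply: le_trans (Cabs_le_ReIm _) _.
have h : \int[nu]_w (k v w * Cabs (psi v - psi w)) <= C * envelope v.
  rewrite -lee_fin /Rintegral fineK; first exact: kC.
  exact: integrable_fin_num (int_abs v).
have h1 : `|complex.Re (Lop k psi v)| <= C * envelope v.
  apply: le_trans h; apply: le_trans (le_normr_Rintegral _ (int_Re v)) _ => //.
  apply: le_Rintegral => //; first exact: integrable_norm (int_Re v).
  move=> w _; rewrite Re_realM normrM (ger0_norm (k0 _ _)) ler_wpM2l//.
  exact: normRe.
have h2 : `|complex.Im (Lop k psi v)| <= C * envelope v.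
  apply: le_trans h; apply: le_trans (le_normr_Rintegral _ (int_Im v)) _ => //.
  apply: le_Rintegral => //; first exact: integrable_norm (int_Im v).
  move=> w _; rewrite Im_realM normrM (ger0_norm (k0 _ _)) ler_wpM2l//.
  exact: normIm.
by apply: le_trans (lerD h1 h2) _; rewrite -[2 * C * _]mulrA mulr_natl mulr2n.
Qed.

Lemma L2m_Lop : L2m nu (Lop k psi).
Proof.
apply: (L2m_dom (H := fun v => 2 * C * envelope v)).
- exact: cmeasurable_Lop.
- by apply: measurable_funM => //; exact: measurable_envelope.
- exact: Cabs_Lop_le.
- have [_] := L2mcZ (2 * C)%:C%C L2m_envelope.
  apply: le_lt_trans; rewrite le_eqVlt; apply/orP; left; apply/eqP.
  apply: eq_integral => v _; congr _%:E.
  by rewrite -dotczz /dotc/= !(mul0r, mulr0, subr0, addr0) -expr2.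
Qed.

(** Integrating the second variable first costs [C * envelope v], and the product of the modulus of
    [eta] with [envelope] is at most the sum of their squares. *)
Let int_prod eta : L2m nu eta -> nu2.-integrable setT (EFin \o
  (fun z => Cabs (eta z.1) * (k z.1 z.2 * Cabs (psi z.1 - psi z.2)))).
Proof.
move=> Leta; have meta : cmeasurable setT eta by case: Leta.
apply/integrable12ltyP.
  apply/measurable_EFinP; apply: measurable_funM => //.
  by apply: cmeasurable_Cabs; exact: cmeasurable_fst.
apply: (@le_lt_trans _ _ (\int[nu]_v (C%:E *
   ((Cabs (eta v) ^+ 2)%:E + (Cabs (envelope v)%:C%C ^+ 2)%:E)))%E).
  apply: ge0_le_integral => //.
  - by move=> v _; apply: integral_ge0.
  - have := @measurable_fun_fubini_tonelli_F _ _ _ _ R (@nu R)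
      (fun z : R * R => `|Cabs (eta z.1) * (k z.1 z.2 * Cabs (psi z.1 - psi z.2))|%:E).
    apply => //; apply/measurable_EFinP; apply: measurable_normr_comp.
    apply: measurable_funM => //.
    by apply: cmeasurable_Cabs; exact: cmeasurable_fst.
  - apply: measurable_funeM; apply: emeasurable_funD; apply/measurable_EFinP.
      exact: cmeasurable_sq.
    by apply: cmeasurable_sq; case: L2m_envelope.
  move=> v _; have h0 w : 0 <= k v w * Cabs (psi v - psi w).
    by rewrite mulr_ge0 ?Cabs_ge0.
  under eq_integral do rewrite /= ger0_norm ?mulr_ge0 ?Cabs_ge0// EFinM.
  rewrite ge0_integralZl//; last 3 first.
  - exact/measurable_EFinP.
  - by move=> w _; rewrite lee_fin.
  - by rewrite lee_fin Cabs_ge0.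
  apply: le_trans (lee_wpmul2l _ (kC v)) _; first by rewrite lee_fin Cabs_ge0.
  rewrite -EFinD -!EFinM lee_fin mulrCA ler_wpM2l//.
  have -> : Cabs (envelope v)%:C%C = envelope v.
    by rewrite CabsE /dotc/= mulr0 addr0 -expr2 sqrtr_sqr ger0_norm// envelope_ge0.
  by have := Cabs_ge0 (eta v); have := envelope_ge0 v;
    move: (Cabs _) (envelope _) => x y; nra.
rewrite ge0_integralZl//; last 2 first.
- apply: emeasurable_funD; apply/measurable_EFinP.
    exact: cmeasurable_sq.
  by apply: cmeasurable_sq; case: L2m_envelope.
- by move=> v _; rewrite adde_ge0 ?lee_fin ?sqr_ge0.
apply: lte_mul_pinfty => //.
rewrite ge0_integralD//; last 4 first.
- by move=> v _; rewrite lee_fin sqr_ge0.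
- by apply/measurable_EFinP; exact: cmeasurable_sq.
- by move=> v _; rewrite lee_fin sqr_ge0.
- by apply/measurable_EFinP; apply: cmeasurable_sq; case: L2m_envelope.
by apply: lte_add_pinfty; [case: Leta|case: L2m_envelope].
Qed.

Let int_prod2 eta : L2m nu eta -> nu2.-integrable setT (EFin \o
  (fun z => Cabs (eta z.2) * (k z.1 z.2 * Cabs (psi z.1 - psi z.2)))).
Proof.
move=> Leta; have meta : cmeasurable setT eta by case: Leta.
have mf : measurable_fun setT (EFin \o
    (fun z : R * R => Cabs (eta z.2) * (k z.1 z.2 * Cabs (psi z.1 - psi z.2)))).
  apply/measurable_EFinP; apply: measurable_funM => //.
  by apply: cmeasurable_Cabs; exact: cmeasurable_snd.
apply/integrable21ltyP => //.
have /integrable12ltyP : nu2.-integrable setT (EFin \o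
  (fun z => Cabs (eta z.1) * (k z.1 z.2 * Cabs (psi z.1 - psi z.2)))).
  exact: int_prod.
move=> h; apply: le_lt_trans (h _).
  rewrite le_eqVlt; apply/orP; left; apply/eqP; apply: eq_integral => v _.
  by apply: eq_integral => w _ /=; rewrite ks CabsBC.
by case/integrableP: (int_prod Leta).
Qed.

Let int_dot1 eta : L2m nu eta -> nu2.-integrable setT (EFin \o
  (fun z => k z.1 z.2 * dotc (eta z.1) (psi z.1 - psi z.2))).
Proof.
move=> Leta; have meta : cmeasurable setT eta by case: Leta.
apply: le_integrable (int_prod Leta) => //.
  apply/measurable_EFinP; apply: measurable_funM => //.
  by apply: cmeasurable_dotc; [exact: cmeasurable_fst|exact: cmeasurable_diff].
move=> z _; rewrite lee_fin [leRHS]ger0_norm ?mulr_ge0 ?Cabs_ge0//.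
rewrite normrM (ger0_norm (k0 _ _)) mulrCA ler_wpM2l//.
exact: dotc_abs.
Qed.

Let int_dot2 eta : L2m nu eta -> nu2.-integrable setT (EFin \o
  (fun z => k z.1 z.2 * dotc (eta z.2) (psi z.1 - psi z.2))).
Proof.
move=> Leta; have meta : cmeasurable setT eta by case: Leta.
apply: le_integrable (int_prod2 Leta) => //.
  apply/measurable_EFinP; apply: measurable_funM => //.
  by apply: cmeasurable_dotc; [exact: cmeasurable_snd|exact: cmeasurable_diff].
move=> z _; rewrite lee_fin [leRHS]ger0_norm ?mulr_ge0 ?Cabs_ge0//.
rewrite normrM (ger0_norm (k0 _ _)) mulrCA ler_wpM2l//.
exact: dotc_abs.
Qed.

(** The increment of [eta] is split into its two terms, each absolutely integrable by [int_prod] and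
    [int_prod2]. Exchanging the variables turns the second integral into minus the first, so the
    difference is twice the scalar product. *)
Lemma form_Lop eta : L2m nu eta -> form k eta psi = ip nu eta (Lop k psi).
Proof.
move=> Leta.
have E1 : ip nu eta (Lop k psi) = \int[nu2]_z
    (k z.1 z.2 * dotc (eta z.1) (psi z.1 - psi z.2)).
  rewrite /ip /Rintegral; congr fine.
  rewrite -(integral12_prod_meas1 (int_dot1 Leta)).
  by apply: eq_integral => v _; rewrite dotc_Lop.
have E2 : - ip nu eta (Lop k psi) = \int[nu2]_z
    (k z.1 z.2 * dotc (eta z.2) (psi z.1 - psi z.2)).
  rewrite -ipNr//; last exact: L2m_Lop.
  rewrite /ip /Rintegral; congr fine.
  rewrite -(integral21_prod_meas1 (int_dot2 Leta)).
  apply: eq_integral => v _; rewrite dotcNr -dotcNl dotc_Lop.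
  apply: eq_integral => w _; congr _%:E.
  by rewrite /= ks dotcNl -dotcNr opprB.
rewrite /form.
have -> : ip nu2 (dform k eta) (dform k psi) =
    ip nu eta (Lop k psi) - - ip nu eta (Lop k psi).
  rewrite [in X in _ = X - _]E1 E2 -RintegralB//; [|exact: int_dot1|exact: int_dot2].
  apply: eq_Rintegral => z _; rewrite dotc_dform//.
  by rewrite -mulrBr dotcDl dotcNl.
by rewrite opprK; move: (ip _ _ _) => A; field.
Qed.

(** One of the two factors in the squared increment is bounded by the sum of the moduli; what is
    left is integrable by [int_prod] and [int_prod2] with [eta = psi]. *)
Lemma formdom_Lop : formdom k psi.
Proof.
split => //; split; first exact: cmeasurable_dform.
have /integrableP[_] := integrableD measurableT (int_prod Lpsi) (int_prod2 Lpsi).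
apply: le_lt_trans; apply: ge0_le_integral => //.
- by move=> z _; rewrite lee_fin sqr_ge0.
- by apply/measurable_EFinP; apply: cmeasurable_sq; exact: cmeasurable_dform.
- apply: measurableT_comp => //; apply: emeasurable_funD.
    by case/integrableP: (int_prod Lpsi).
  by case/integrableP: (int_prod2 Lpsi).
- move=> z _; rewrite Cabs_dform//= lee_fin (le_trans _ (ler_norm _))//.
  have E (x y a b : R) : 0 <= x -> 0 <= y -> y <= a + b ->
      x * y ^+ 2 <= a * (x * y) + b * (x * y).
    move=> x0 y0 yab; rewrite -mulrDl [leRHS]mulrCA expr2 ler_wpM2l//.
    by rewrite ler_wpM2r.
  by apply: E; rewrite ?Cabs_ge0// CabsB.
Qed.

(** [form_Lop] at [phi] and at [iC phi] gives the real and the imaginary part of the defining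
    identity; Cauchy-Schwarz then gives the continuity in [phi]. *)
Lemma op_graph_Lop : op_graph k psi (Lop k psi).
Proof.
have LL := L2m_Lop.
have LiC phi : L2m nu phi -> L2m nu (iC phi) by exact: L2mcZ.
have niC phi : nrm nu (iC phi) = nrm nu phi.
  rewrite /nrm /ip; congr (Num.sqrt _); apply: eq_Rintegral => v _.
  by rewrite !dotczz /iC CabsM /= expr0n/= add0r expr1n sqrtr1 mul1r.
split.
- split; first by apply/Qform_domP => //; exact: formdom_Lop.
  exists (2 * (nrm nu (Lop k psi) + nrm nu psi)) => phi /Qform_domP => /(_ kk).
  move=> [Lphi _]; rewrite L2norm_nrm// -EFinM lee_fin.
  apply: le_trans (Cabs_le_ReIm _) _.
  rewrite Re_Qform// Im_Qform// !form_Lop//; last exact: LiC.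
  have h1 := ip_le Lphi LL; have h2 := ip_le Lphi Lpsi.
  have h3 := ip_le (LiC _ Lphi) LL; have h4 := ip_le (LiC _ Lphi) Lpsi.
  have := ler_normD (ip nu phi (Lop k psi)) (ip nu phi psi).
  have := ler_normD (ip nu (iC phi) (Lop k psi)) (ip nu (iC phi) psi).
  move: h1 h2 h3 h4; rewrite niC.
  have E (x y a b c e n l m : R) : a <= n * l -> b <= n * m -> c <= n * l ->
     e <= n * m -> x <= c + e -> y <= a + b -> y + x <= 2 * (l + m) * n.
    by rewrite (_ : 2 * (l + m) * n = (n * l + n * m) * 2); [lra|ring].
  exact: E.
- by apply/L2P.
- move=> phi /Qform_domP => /(_ kk) [Lphi _].
  have Re_eq : complex.Re (inner phi (Lop k psi)) =
      complex.Re (Qform k phi psi - inner phi psi).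
    by rewrite Re_sub Re_Qform// !Re_inner addrK form_Lop.
  have Im_eq : complex.Im (inner phi (Lop k psi)) =
      complex.Im (Qform k phi psi - inner phi psi).
    by rewrite Im_sub Im_Qform// !Im_inner addrK form_Lop//; exact: LiC.
  by apply/eqP; rewrite eq_complex Re_eq Im_eq !eqxx.
Qed.

End fixed_kernel.

Lemma op_graph_form k psi eta : is_kernel k -> op_graph k psi eta ->
  [/\ formdom k psi, L2m nu eta &
    forall phi, formdom k phi -> ip nu phi eta = form k phi psi].
Proof.
move=> kk [[/(Qform_domP _ kk) dpsi _] /L2P Leta h]; split => // phi dphi.
have /(congr1 (@complex.Re R)) := h phi ((Qform_domP phi kk).2 dphi).
rewrite Re_inner => ->.
by rewrite Re_sub Re_Qform// Re_inner addrK.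
Qed.

End generator.

Section concrete.
Context {R : realType} (p : params R).
Local Notation gamma0 := (par_gamma0 p).
Implicit Types (v w th e M : R) (psi : R -> R[i]).

Lemma is_kernel_K3 : is_kernel (K3 p).
Proof.
split; [exact: K3_ge0|exact: K3_sym|].
exact: (measurable_K3 p measurable_fst measurable_snd).
Qed.

Lemma is_kernel_K3eps e : 0 < e -> is_kernel (K3eps p e).
Proof.
move=> e0; split; [by move=> u v; exact: K3eps_ge0|exact: K3eps_sym|].
exact: (measurable_K3eps p e0 measurable_fst measurable_snd).
Qed.

Lemma f_weight_gt0 v : 0 < f_weight p v.
Proof. by rewrite lt_max powR_gt0// ln1pexp_gt0. Qed.

Lemma Gamma_tilde_gt0 v : 0 < Gamma_tilde p v.
Proof. by rewrite mulr_gt0 ?f_weight_gt0 ?expR_gt0. Qed.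

Lemma Gamma0_gt0 v r : 0 < r -> 0 < Gamma0 p v r.
Proof.
move=> r0; have k0 : 0 < par_kappa p by apply: lt_le_trans (par_kappa_ge7 p).
apply: mulr_gt0; first by rewrite mulr_gt0 ?addr_gt0 ?f_weight_gt0 ?expR_gt0.
by rewrite powR_gt0// onem_expRN_gt0// mulr_gt0.
Qed.

Lemma Xnorm_le psi M : (Xnorm p psi <= M%:E)%E ->
  forall v, Cabs (psi v) <= M * Gamma_tilde p v.
Proof.
move=> h v; rewrite -ler_pdivrMr ?Gamma_tilde_gt0// -lee_fin.
by apply: le_trans h; apply: ereal_sup_ubound; exists v.
Qed.

Lemma Xnorm_ge0 psi : (0 <= Xnorm p psi)%E.
Proof.
apply: (@le_trans _ _ (Cabs (psi 0) / Gamma_tilde p 0)%:E).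
  by rewrite lee_fin divr_ge0 ?Cabs_ge0// ltW// Gamma_tilde_gt0.
by apply: ereal_sup_ubound; exists 0.
Qed.

Lemma holder_seminorm_ge0 psi : (0 <= holder_seminorm p psi)%E.
Proof.
apply: (@le_trans _ _ (Cabs (psi 0 - psi (0 - 1)) / Gamma0 p 0 1)%:E).
  by rewrite lee_fin divr_ge0 ?Cabs_ge0// ltW// Gamma0_gt0.
by apply: ereal_sup_ubound; exists (0, 1) => //=.
Qed.

Lemma pair_weight_diag v : pair_weight v v <= 4 * envelope v.
Proof.
rewrite /pair_weight /envelope minxx maxxx.
have P (x : R) : 0 <= 1 + expR x by rewrite addr_ge0 ?expR_ge0.
have e1 := expR_ge0 (- (2 / 3 * v)); have e2 := expR_ge0 (15 / 32 * v).
have [v0|v0] := leP 0 v.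
  have h1 : 1 + expR (- (v / 6)) <= 2 * expR 0 by apply: one_expR_le0; lra.
  have h2 : 1 + expR (7 / 16 * v) <= 2 * expR (7 / 16 * v).
    by apply: one_expR_le; lra.
  apply: le_trans (cexpM_le (P _) (P _) h1 h2) _.
  have h : expR (0 + 7 / 16 * v) <= expR (15 / 32 * v) by rewrite ler_expR; lra.
  lra.
have h1 : 1 + expR (- (v / 6)) <= 2 * expR (- (v / 6)).
  by apply: one_expR_le; lra.
have h2 : 1 + expR (7 / 16 * v) <= 2 * expR 0 by apply: one_expR_le0; lra.
apply: le_trans (cexpM_le (P _) (P _) h1 h2) _.
have h : expR (- (v / 6) + 0) <= expR (- (2 / 3 * v)) by rewrite ler_expR; lra.
lra.
Qed.

Lemma Gamma_tilde_envelope : exists2 C : R, 0 <= C &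
  forall v, Gamma_tilde p v <= C * envelope v.
Proof.
have [C C0 hC] := Gamma_tilde_le p.
exists (C * 4) => [|v]; first by rewrite mulr_ge0.
have [h _] := hC v v; apply: le_trans h _.
by rewrite -mulrA ler_wpM2l// pair_weight_diag.
Qed.

Lemma L2m_Xbound psi M : cmeasurable setT psi ->
  (forall v, Cabs (psi v) <= M * Gamma_tilde p v) -> L2m nu psi.
Proof.
move=> mpsi hM; have [C C0 hC] := Gamma_tilde_envelope.
have M0 : 0 <= M.
  by rewrite -(pmulr_lge0 _ (Gamma_tilde_gt0 0)) (le_trans _ (hM 0)) ?Cabs_ge0.
apply: (L2m_dom (H := fun v => M * C * envelope v)) => //.
- by apply: measurable_funM => //; exact: measurable_envelope.
- by move=> v; apply: le_trans (hM v) _; rewrite -mulrA ler_wpM2l.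
- have [_] := L2mcZ (M * C)%:C%C (@L2m_envelope R).
  apply: le_lt_trans; rewrite le_eqVlt; apply/orP; left; apply/eqP.
  apply: eq_integral => v _; congr _%:E.
  by rewrite -dotczz /dotc/= !(mul0r, mulr0, subr0, addr0) -expr2.
Qed.

Lemma ccontinuous_cmeasurable psi : ccontinuous psi -> cmeasurable setT psi.
Proof. by move=> [c1 c2]; split; exact: continuous_measurable_fun. Qed.

Lemma pair_weight_ge1 v w : 1 <= pair_weight v w.
Proof.
have a0 := expR_ge0 (- (Num.min v w / 6)).
have b0 := expR_ge0 (7 / 16 * Num.max v w).
by rewrite -[leLHS]mulr1; apply: ler_pM => //; rewrite lerDl.
Qed.

Lemma integral_K3eps_le e : 0 < e -> exists2 C : R, 0 <= C & forall v,
  (\int[nu]_w (K3eps p e v w * pair_weight v w)%:E <= (C * envelope v)%:E)%E.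
Proof.
move=> e0; have [th [D [th0 D0 hD]]] := K3eps_le_powR p e0.
have [C C0 hC] := integral_Gkernel_le p th0.
exists (D * C) => [|v]; first exact: mulr_ge0.
have mG : measurable_fun setT (fun w => Gkernel p th v w).
  exact: measurable_Gkernel.
have mW : measurable_fun setT (fun w : R => pair_weight v w).
  apply: measurable_funM; apply: measurable_funD => //;
    apply: measurable_expR_comp; do ?apply: measurable_opp_comp;
    apply: measurable_funM => //; first exact: measurable_minr.
  exact: measurable_maxr.
apply: (@le_trans _ _ (\int[nu]_w (D%:E * (Gkernel p th v w)%:E))%E).
  apply: ge0_le_integral => //.
  - by move=> w _; rewrite lee_fin mulr_ge0 ?K3eps_ge0 ?pair_weight_ge0.
  - apply/measurable_EFinP; apply: measurable_funM => //.
    exact: measurable_K3eps.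
  - by apply: measurable_funeM; apply/measurable_EFinP.
  - move=> w _; rewrite -EFinM lee_fin /Gkernel weightE.
    have E (x d k y z : R) : x <= d * (k * z) -> 0 <= y ->
        x * y <= d * (k * (y * z)).
      move=> h y0; rewrite (_ : d * _ = d * (k * z) * y); last by ring.
      exact: ler_wpM2r.
    exact: E (hD v w) (pair_weight_ge0 v w).
rewrite ge0_integralZl//; last 2 first.
- exact/measurable_EFinP.
- by move=> w _; rewrite lee_fin Gkernel_ge0.
by rewrite -mulrA [leRHS]EFinM; apply: lee_wpmul2l.
Qed.

(** The cutoff makes the kernel integrable up to the diagonal, so increments are bounded by the sum
    of the moduli and growth control is enough. The constant depends on [e]. *)
Lemma opbound_K3eps e : 0 < e -> exists2 C : R, 0 <= C &
  forall psi M, cmeasurable setT psi ->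
    (forall v, Cabs (psi v) <= M * Gamma_tilde p v) ->
    opbound (K3eps p e) psi (M * C).
Proof.
move=> e0; have [C C0 hC] := integral_K3eps_le e0.
have [D D0 hD] := Gamma_tilde_le p.
exists (2 * D * C) => [|psi M mpsi hM v]; first by rewrite !mulr_ge0.
have M0 : 0 <= M.
  by rewrite -(pmulr_lge0 _ (Gamma_tilde_gt0 0)) (le_trans _ (hM 0)) ?Cabs_ge0.
have mW : measurable_fun setT (fun w : R => pair_weight v w).
  apply: measurable_funM; apply: measurable_funD => //;
    apply: measurable_expR_comp; do ?apply: measurable_opp_comp;
    apply: measurable_funM => //; first exact: measurable_minr.
  exact: measurable_maxr.
have mK : measurable_fun setT (fun w => K3eps p e v w).
  exact: measurable_K3eps.
apply: (@le_trans _ _ (\int[nu]_w ((M * (2 * D))%:E *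
    (K3eps p e v w * pair_weight v w)%:E))%E).
  apply: ge0_le_integral => //.
  - by move=> w _; rewrite lee_fin mulr_ge0 ?K3eps_ge0 ?Cabs_ge0.
  - apply/measurable_EFinP; apply: measurable_funM => //.
    apply: cmeasurable_Cabs; apply: cmeasurableB => //.
  - by apply: measurable_funeM; apply/measurable_EFinP; exact: measurable_funM.
  - move=> w _; rewrite -EFinM lee_fin mulrCA ler_wpM2l ?K3eps_ge0//.
    apply: le_trans (CabsB _ _) _; have [h1 h2] := hD v w.
    have k1 := le_trans (hM v) (ler_wpM2l M0 h1).
    have k2 := le_trans (hM w) (ler_wpM2l M0 h2).
    apply: le_trans (lerD k1 k2) _.
    by rewrite (_ : M * (2 * D) * _ =
      M * (D * pair_weight v w) + M * (D * pair_weight v w))//; ring.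
rewrite ge0_integralZl//; last 3 first.
- by apply/measurable_EFinP; exact: measurable_funM.
- by move=> w _; rewrite lee_fin mulr_ge0 ?K3eps_ge0 ?pair_weight_ge0.
- by rewrite lee_fin !mulr_ge0.
rewrite (_ : M * (2 * D * C) * envelope v = M * (2 * D) * (C * envelope v)).
  by rewrite [leRHS]EFinM; apply: lee_wpmul2l => //; rewrite lee_fin !mulr_ge0.
by ring.
Qed.

Lemma holder_le psi (N : R) : (holder_seminorm p psi <= N%:E)%E ->
  forall v w, w < v -> Cabs (psi v - psi w) <= N * Gamma0 p v (v - w).
Proof.
move=> h v w wv; have r0 : 0 < v - w by rewrite subr_gt0.
rewrite -ler_pdivrMr ?Gamma0_gt0// -lee_fin.
apply: le_trans h; apply: ereal_sup_ubound; exists (v, v - w) => //=.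
by rewrite subKr.
Qed.

(** Without a cutoff, integrability near the diagonal comes from the Hoelder seminorm: [Gamma0]
    supplies the power [gamma0] of the distance that turns [K3] into [Gkernel]. *)
Lemma opbound_K3 psi : in_Xbar p psi -> L2m nu psi /\
  exists C, opbound (K3 p) psi C.
Proof.
move=> [/ccontinuous_cmeasurable mpsi fin].
have Xfin : (Xnorm p psi < +oo)%E.
  by apply: le_lt_trans fin; rewrite leeDl// holder_seminorm_ge0.
have Hfin : (holder_seminorm p psi < +oo)%E.
  by apply: le_lt_trans fin; rewrite leeDr// Xnorm_ge0.
split.
  apply: (@L2m_Xbound _ (fine (Xnorm p psi))) => // v.
  by apply: Xnorm_le; rewrite fineK// ge0_fin_numE// Xnorm_ge0.
pose N := fine (holder_seminorm p psi).
have N0 : 0 <= N by rewrite fine_ge0// holder_seminorm_ge0.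
have hN : (holder_seminorm p psi <= N%:E)%E.
  by rewrite fineK// ge0_fin_numE// holder_seminorm_ge0.
have [D D0 hD] := Gamma0_le p.
have /andP[g0 _] := par_gamma0_bounds p.
have [C C0 hC] := integral_Gkernel_le p g0.
have below v w : w < v ->
    K3 p v w * Cabs (psi v - psi w) <= N * D * Gkernel p gamma0 v w.
  move=> wv; have h1 := holder_le hN wv.
  have h2 := ler_wpM2l N0 (hD v w wv).
  apply: le_trans (ler_wpM2l (K3_ge0 p v w) (le_trans h1 h2)) _.
  have E (k n d x y z : R) : 0 <= k -> 0 <= n -> 0 <= d -> 0 <= x -> 0 <= y ->
      0 <= z -> k * (n * (d * (x * y))) <= n * d * (k * y * (x * (1 + z))).
    move=> *; rewrite (_ : n * d * _ =
      k * (n * (d * (x * y))) + n * d * k * y * x * z); last by ring.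
    by rewrite lerDl !mulr_ge0.
  rewrite /Gkernel weightE.
  by apply: E; rewrite ?K3_ge0 ?pair_weight_ge0 ?powR_ge0 ?expR_ge0.
(* The seminorm only sees ordered pairs; the kernels and the modulus of an increment are symmetric,
   and [K3] is 0 on the diagonal. *)
have all v w : K3 p v w * Cabs (psi v - psi w) <= N * D * Gkernel p gamma0 v w.
  have [|vw|<-] := ltgtP w v; first exact: below.
    by rewrite K3_sym CabsBC Gkernel_sym; exact: below.
  rewrite K3_diag mul0r.
  exact: mulr_ge0 (mulr_ge0 N0 D0) (Gkernel_ge0 _ _ _ _).
exists (N * D * C) => v.
have mG : measurable_fun setT (fun w => Gkernel p gamma0 v w).
  exact: measurable_Gkernel.
apply: (@le_trans _ _ (\int[nu]_w ((N * D)%:E *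
    (Gkernel p gamma0 v w)%:E))%E).
  apply: ge0_le_integral => //.
  - by move=> w _; rewrite lee_fin mulr_ge0 ?K3_ge0 ?Cabs_ge0.
  - apply/measurable_EFinP; apply: measurable_funM.
      exact: measurable_K3.
    apply: cmeasurable_Cabs; apply: cmeasurableB => //.
  - by apply: measurable_funeM; apply/measurable_EFinP.
  - by move=> w _; rewrite -EFinM lee_fin.
rewrite ge0_integralZl//; last 3 first.
- exact/measurable_EFinP.
- by move=> w _; rewrite lee_fin Gkernel_ge0.
- by rewrite lee_fin mulr_ge0.
by rewrite -mulrA [leRHS]EFinM; apply: lee_wpmul2l => //; rewrite lee_fin mulr_ge0.
Qed.

End concrete.

(** * Curves in L^2: orbits and regularized solutions *)

Section L2curves.
Context d (T : measurableType d) (R : realType).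
Variable m : {measure set T -> \bar R}.
Implicit Types (f g : T -> R[i]) (a b : R -> T -> R[i]) (s : R).

Lemma nrm_ae f g : L2m m f -> L2m m g -> ae_eq m setT f g -> nrm m f = nrm m g.
Proof.
move=> [mf _] [mg _] fg; rewrite /nrm (ae_eq_dotc mf mg fg)//.
by rewrite ipC (ae_eq_dotc mf mg fg)// ipC.
Qed.

Lemma cvg0_le (I : Type) (F : set_system I) (FF : Filter F) (x y : I -> R) :
  (\forall i \near F, 0 <= x i <= y i) -> y i @[i --> F] --> 0 ->
  x i @[i --> F] --> 0.
Proof. by move=> xy y0; apply: (squeeze_cvgr xy _ y0); exact: cvg_cst. Qed.

Lemma cvg_ip (I : Type) (F : set_system I) (FF : Filter F)
    (a b : I -> T -> R[i]) f g :
  (\forall i \near F, L2m m (a i)) -> (\forall i \near F, L2m m (b i)) ->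
  L2m m f -> L2m m g ->
  nrm m (fun x => a i x - f x) @[i --> F] --> 0 ->
  nrm m (fun x => b i x - g x) @[i --> F] --> 0 ->
  ip m (a i) (b i) @[i --> F] --> ip m f g.
Proof.
move=> La Lb Lf Lg af bg.
apply/subr_cvg0/norm_cvg0P.
pose A i := nrm m (fun x => a i x - f x); pose B i := nrm m (fun x => b i x - g x).
have h : A i * B i + A i * nrm m g + nrm m f * B i @[i --> F] --> 0.
  have -> : 0 = 0 * 0 + 0 * nrm m g + nrm m f * 0 :> R by ring.
  exact: cvgD (cvgD (cvgM af bg) (cvgM af (cvg_cst _))) (cvgM (cvg_cst _) bg).
apply: cvg0_le h; near=> i; rewrite normr_ge0/=.
have Lai : L2m m (a i) by near: i.
have Lbi : L2m m (b i) by near: i.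
have LA : L2m m (fun x => a i x - f x) by exact: L2mB.
have LB : L2m m (fun x => b i x - g x) by exact: L2mB.
have -> : ip m (a i) (b i) - ip m f g =
    ip m (fun x => a i x - f x) (fun x => b i x - g x) +
    ip m (fun x => a i x - f x) g + ip m f (fun x => b i x - g x).
  by rewrite !ipBl// !ipBr//; ring.
apply: le_trans (ler_normD _ _) _; apply: lerD; last exact: ip_le.
by apply: le_trans (ler_normD _ _) _; apply: lerD; exact: ip_le.
Unshelve. all: by end_near. Qed.

Definition L2cont a s := nrm m (fun x => a t x - a s x) @[t --> s] --> 0.

Definition L2deriv a (a' : T -> R[i]) s :=
  nrm m (fun x => (h^-1)%:C%C * (a (h + s) x - a s x) - a' x) @[h --> 0^'] --> 0.

Lemma continuous_ip a b s : (forall t, L2m m (a t)) -> (forall t, L2m m (b t)) ->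
  L2cont a s -> L2cont b s -> {for s, continuous (fun t => ip m (a t) (b t))}.
Proof. by move=> La Lb ca cb; apply: cvg_ip => //; exact: nearW. Qed.

Lemma L2cont_shift a s : L2cont a s ->
  nrm m (fun x => a (h + s) x - a s x) @[h --> 0^'] --> 0.
Proof.
move=> ca; apply: (@cvg_trans _ (nrm m (fun x => a (h + s) x - a s x) @[h --> nbhs 0])).
  by apply: cvg_app; exact: nbhs_dnbhs.
have cs : (h + s) @[h --> (0 : R)] --> s.
  by rewrite -[X in _ --> X]add0r; apply: cvgD; [exact: cvg_id|exact: cvg_cst].
exact: (cvg_comp _ _ cs ca).
Qed.

(** In the product rule the increment of [a] is paired with [b] at the shifted time and the
    increment of [b] with [a] at [s]; hence the continuity assumption on [b]. *)
Lemma derive_ip a b (a' b' : T -> R[i]) s : (forall t, L2m m (a t)) -> (forall t, L2m m (b t)) ->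
  L2m m a' -> L2m m b' -> L2cont b s -> L2deriv a a' s -> L2deriv b b' s ->
  is_derive s 1 (fun t => ip m (a t) (b t)) (ip m a' (b s) + ip m (a s) b').
Proof.
move=> La Lb La' Lb' cb da db.
have cvgh : h^-1 *: (ip m (a (h + s)) (b (h + s)) - ip m (a s) (b s))
    @[h --> 0^'] --> ip m a' (b s) + ip m (a s) b'.
  have c1 : ip m (fun x => (h^-1)%:C%C * (a (h + s) x - a s x)) (b (h + s))
      @[h --> 0^'] --> ip m a' (b s).
    apply: cvg_ip => //.
    - by apply: nearW => h; apply: L2mcZ; exact: L2mB.
    - exact: nearW.
    - exact: L2cont_shift.
  have c2 : ip m (a s) (fun x => (h^-1)%:C%C * (b (h + s) x - b s x))
      @[h --> 0^'] --> ip m (a s) b'.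
    apply: cvg_ip => //.
    - exact: nearW.
    - by apply: nearW => h; apply: L2mcZ; exact: L2mB.
    - under eq_fun do rewrite /nrm; apply: cvg0_le (cvg_cst 0).
      apply: nearW => h; rewrite sqrtr_ge0/=.
      have -> : (fun x => a s x - a s x) = (fun=> 0) by apply/funext => x; rewrite subrr.
      rewrite /ip; under eq_Rintegral do rewrite /dotc/= mulr0 addr0.
      by rewrite Rintegral_cst// mul0r sqrtr0.
  apply: cvg_trans (cvgD c1 c2); apply: near_eq_cvg; apply: nearW => h.
  have L1 : L2m m (fun x => a (h + s) x - a s x) by exact: L2mB.
  have L2 : L2m m (fun x => b (h + s) x - b s x) by exact: L2mB.
  transitivity (ip m (fun x => (h^-1)%:C%C * (a (h + s) x - a s x)) (b (h + s)) +
    ip m (a s) (fun x => (h^-1)%:C%C * (b (h + s) x - b s x))) => //.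
  by rewrite ipZl// ipZr// ipBl// ipBr// /GRing.scale/=; ring.
apply: DeriveDef.
  apply/cvg_ex; exists (ip m a' (b s) + ip m (a s) b').
  by under eq_fun do rewrite scaler1.
rewrite /derive; apply: cvg_lim => //.
by under eq_fun do rewrite scaler1.
Qed.

Lemma cvg_L2_dominated (u : nat -> T -> R[i]) f (H : T -> R) :
  (forall n, cmeasurable setT (u n)) -> cmeasurable setT f ->
  measurable_fun setT H -> (\int[m]_x (H x ^+ 2)%:E < +oo)%E ->
  (forall n x, Cabs (u n x - f x) <= H x) ->
  (forall x, Cabs (u n x - f x) @[n --> \oo] --> 0) ->
  nrm m (fun x => u n x - f x) @[n --> \oo] --> 0.
Proof.
move=> mu mf mH H2 uH uf.
have mD n : cmeasurable setT (fun x => u n x - f x) by exact: cmeasurableB.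
have LD n : L2m m (fun x => u n x - f x) by exact: L2m_dom (uH n) H2.
have iH : m.-integrable setT (EFin \o (fun x => H x ^+ 2)).
  apply/integrableP; split; first by apply/measurable_EFinP; exact: measurable_funX.
  by under eq_integral do rewrite /= ger0_norm ?sqr_ge0//.
have cvgE : (\int[m]_x (Cabs (u n x - f x) ^+ 2)%:E)%E @[n --> \oo] -->
    (\int[m]_x 0)%E.
  apply: (dominated_cvg measurableT _ _ _ iH) => //.
  - by move=> n; apply/measurable_EFinP; exact: cmeasurable_sq.
  - move=> x _; apply/fine_cvgP; split; first exact: nearW.
    have c2 := cvgM (uf x) (uf x); rewrite mulr0 in c2.
    exact: c2.
  - move=> n x _; rewrite /= lee_fin ger0_norm ?sqr_ge0// lerXn2r ?nnegrE ?Cabs_ge0//.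
    by rewrite (le_trans _ (uH n x)) ?Cabs_ge0.
rewrite integral0 in cvgE.
have cvgI : ip m (fun x => u n x - f x) (fun x => u n x - f x) @[n --> \oo] --> 0.
  have cE : (ip m (fun x => u n x - f x) (fun x => u n x - f x))%:E
      @[n --> \oo] --> 0%:E.
    by under eq_fun do rewrite eip//.
  exact: (fine_cvg cE).
rewrite -[X in _ --> X](@sqrtr0 R).
apply: (@continuous_cvg _ _ _ _ _ _ Num.sqrt) => //; exact: sqrt_continuous.
Qed.

End L2curves.

(** * Orbits of the semigroup *)

Section orbit.
Context {R : realType}.
Variables (k : R -> R -> R) (S : R -> (R -> R[i]) -> R -> R[i]).
Hypothesis hS : is_exp_semigroup k S.
Implicit Types (f g : R -> R[i]) (s t h : R).

Lemma semigroup_L2m t f : 0 <= t -> L2m nu f -> L2m nu (S t f).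
Proof. by move=> t0 /L2P Lf; apply/L2P; exact: (semigroup_L2 hS). Qed.

Lemma semigroup_nrm t f : 0 <= t -> L2m nu f -> nrm nu (S t f) <= nrm nu f.
Proof.
move=> t0 Lf; have LS := semigroup_L2m t0 Lf.
by rewrite -lee_fin -!L2norm_nrm//; apply: (semigroup_contraction hS) => //; exact/L2P.
Qed.

Lemma L2m0 : L2m nu (fun=> 0 : R[i]).
Proof.
split; first exact: cmeasurable_cst.
under eq_integral do rewrite -dotczz /dotc/= mulr0 addr0.
by rewrite integral0 ltry.
Qed.

Lemma nrm_zero : nrm nu (fun=> 0 : R[i]) = 0 :> R.
Proof.
rewrite /nrm /ip; under eq_Rintegral do rewrite /dotc/= mulr0 addr0.
by rewrite Rintegral_cst// mul0r sqrtr0.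
Qed.

Lemma semigroup_zero t : 0 <= t -> ae_eq nu setT (S t (fun=> 0)) (fun=> 0).
Proof.
move=> t0; apply: nrm0_ae_eq; [|exact: L2m0|].
  by apply: semigroup_L2m => //; exact: L2m0.
under eq_fun do rewrite subr0.
apply/eqP; rewrite eq_le nrm_ge0 andbT -nrm_zero.
by apply: semigroup_nrm => //; exact: L2m0.
Qed.

Lemma semigroup_comb t (c e : R[i]) f g : 0 <= t -> L2m nu f -> L2m nu g ->
  ae_eq nu setT (S t (fun v => c * f v + e * g v))
    (fun v => c * S t f v + e * S t g v).
Proof.
move=> t0 Lf Lg; have Lg' := L2mcZ e Lg.
have h1 := semigroup_linear hS c t0 ((L2P f).2 Lf) ((L2P _).2 Lg').
have h2 := semigroup_linear hS e t0 ((L2P g).2 Lg) ((L2P _).2 L2m0).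
have h3 := semigroup_zero t0.
have e2 : (fun v => e * g v + 0) = (fun v => e * g v).
  by apply/funext => v; rewrite addr0.
rewrite e2 in h2.
apply: filterS3 h1 h2 h3 => v /= h1 h2 h3 _.
by rewrite h1// h2// h3// addr0.
Qed.

Lemma semigroup_sub t f g : 0 <= t -> L2m nu f -> L2m nu g ->
  ae_eq nu setT (S t (fun v => f v - g v)) (fun v => S t f v - S t g v).
Proof.
move=> t0 Lf Lg; have := semigroup_comb 1 (-1) t0 Lf Lg.
have -> : (fun v => 1 * f v + -1 * g v) = (fun v => f v - g v).
  by apply/funext => v; rewrite mul1r mulN1r.
have -> : (fun v => 1 * S t f v + -1 * S t g v) = (fun v => S t f v - S t g v).
  by apply/funext => v; rewrite mul1r mulN1r.
by [].
Qed.

Lemma semigroup_add s t f : 0 <= s -> 0 <= t -> L2m nu f ->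
  ae_eq nu setT (S (s + t) f) (S s (S t f)).
Proof. by move=> s0 t0 /L2P Lf; exact: (semigroupD hS). Qed.

(** The left function is almost everywhere [S s] applied to the right one. Thus strong continuity at
    0 gives continuity of orbits at every time. *)
Lemma orbit_sub_le s t f : 0 <= s -> 0 <= t -> L2m nu f ->
  nrm nu (fun v => S (s + t) f v - S s f v) <= nrm nu (fun v => S t f v - f v).
Proof.
move=> s0 t0 Lf; have LSt := semigroup_L2m t0 Lf.
have LSs := semigroup_L2m s0 Lf.
have LSst := semigroup_L2m (addr_ge0 s0 t0) Lf.
have LD := L2mB LSt Lf.
apply: le_trans (semigroup_nrm s0 LD); rewrite le_eqVlt; apply/orP; left; apply/eqP.
apply: nrm_ae; [exact: L2mB|exact: semigroup_L2m|].
have h1 := semigroup_sub s0 LSt Lf; have h2 := semigroup_add s0 t0 Lf.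
by apply: filterS2 h1 h2 => v /= h1 h2 _; rewrite h1// h2.
Qed.

Lemma L2norm_cvg0 (F : set_system R) (FF : ProperFilter F) (a : R -> R -> R[i]) :
  (\forall h \near F, L2m nu (a h)) ->
  L2norm (a h) @[h --> F] --> 0%E -> nrm nu (a h) @[h --> F] --> 0.
Proof.
move=> La h0.
have : (nrm nu (a h))%:E @[h --> F] --> 0%:E.
  apply: cvg_trans h0; apply: near_eq_cvg.
  by apply: filterS La => h Lh; rewrite L2norm_nrm.
by move/fine_cvg.
Qed.

Lemma nrm_cvg0 (F : set_system R) (FF : ProperFilter F) (a : R -> R -> R[i]) :
  (\forall h \near F, L2m nu (a h)) ->
  nrm nu (a h) @[h --> F] --> 0 -> L2norm (a h) @[h --> F] --> 0%E.
Proof.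
move=> La h0.
have : (nrm nu (a h))%:E @[h --> F] --> 0%:E.
  by apply: cvg_EFin => //; exact: nearW.
apply: cvg_trans; apply: near_eq_cvg.
by apply: filterS La => h Lh; rewrite L2norm_nrm.
Qed.

Lemma near_right_ge0 : \forall h \near (0 : R)^'+, 0 <= h.
Proof. by near=> h. Unshelve. all: by end_near. Qed.

Lemma near_right_delta (P : R -> Prop) : (\forall h \near (0 : R)^'+, P h) ->
  exists2 e : R, 0 < e & forall h, 0 < h < e -> P h.
Proof.
move=> [e /= e0 he]; exists e => // h /andP[h0 hh].
by apply: he => //=; rewrite sub0r normrN gtr0_norm.
Qed.

Lemma orbit_small f : L2m nu f -> forall e, 0 < e ->
  exists2 d : R, 0 < d &
    forall t, 0 <= t < d -> nrm nu (fun v => S t f v - f v) < e.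
Proof.
move=> Lf e e0.
have c0 : nrm nu (fun v => S h f v - f v) @[h --> 0^'+] --> 0.
  apply: L2norm_cvg0; last by apply: (semigroup_cvg0 hS); exact/L2P.
  apply: filterS near_right_ge0 => h h0; apply: L2mB => //.
  exact: semigroup_L2m.
have : \forall h \near 0^'+, nrm nu (fun v => S h f v - f v) < e.
  by apply: (cvgr_lt 0).
move=> /near_right_delta[d d0 hd]; exists d => // t /andP[t0 td].
move: t0; rewrite le_eqVlt => /orP[/eqP <-|t0]; last by apply: hd; rewrite t0 td.
rewrite (_ : nrm nu _ = 0)//.
apply: etrans nrm_zero; apply: nrm_ae; [|exact: L2m0|].
  by apply: L2mB => //; exact: semigroup_L2m.
have := semigroup0 hS ((L2P f).2 Lf).
by apply: filterS => v /= h _; rewrite h// subrr.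
Qed.

(* Extended to s < 0 so that two-sided derivatives make sense. *)
Definition orbit f s := S (Num.max s 0) f.

Lemma L2m_orbit f s : L2m nu f -> L2m nu (orbit f s).
Proof. by move=> Lf; apply: semigroup_L2m => //; rewrite le_max lexx orbT. Qed.

Lemma orbit_dist f s t : L2m nu f ->
  nrm nu (fun v => orbit f t v - orbit f s v) <=
  nrm nu (fun v => S `|Num.max t 0 - Num.max s 0| f v - f v).
Proof.
move=> Lf; rewrite /orbit.
have : 0 <= Num.max t 0 by rewrite le_max lexx orbT.
have : 0 <= Num.max s 0 by rewrite le_max lexx orbT.
move: (Num.max s 0) (Num.max t 0) => {}s {}t s0 t0.
have [st|/ltW ts] := leP s t.
  have := orbit_sub_le (t := t - s) s0 _ Lf.
  rewrite subrKC ger0_norm ?subr_ge0//; exact.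
rewrite distrC nrmBC; [|exact: semigroup_L2m..].
have := orbit_sub_le (t := s - t) t0 _ Lf.
by rewrite subrKC ger0_norm ?subr_ge0//; exact.
Qed.

Lemma max0_dist s t : `|Num.max t 0 - Num.max s 0| <= `|t - s|.
Proof.
have [s0|s0] := leP s 0; have [t0|t0] := leP t 0; rewrite ?subr0 ?sub0r ?subrr ?normr0//.
- by rewrite gtr0_norm// ger0_norm; lra.
- by rewrite normrN gtr0_norm// ler0_norm; lra.
Qed.

Lemma orbit_cont f s : L2m nu f -> L2cont nu (orbit f) s.
Proof.
move=> Lf; apply/cvgrPdist_lt => e e0.
have [d d0 hd] := orbit_small Lf e0.
near=> t; rewrite sub0r normrN ger0_norm ?nrm_ge0//.
apply: le_lt_trans (orbit_dist s t Lf) _; apply: hd; rewrite normr_ge0/=.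
apply: le_lt_trans (max0_dist s t) _.
by near: t; apply/nbhs_ballP; exists d => //= t; rewrite /ball/= distrC.
Unshelve. all: by end_near. Qed.

Section generator_orbit.
Variables (f g : R -> R[i]).
Hypotheses (kk : is_kernel k) (fg : op_graph k f g).

Let Lf : L2m nu f.
Proof. by have [[]] := op_graph_form kk fg. Qed.

Let Lg : L2m nu g.
Proof. by have [] := op_graph_form kk fg. Qed.

Let quot h v := (h^-1)%:C%C * (f v - S h f v) - g v.

Let Lquot h : 0 <= h -> L2m nu (quot h).
Proof.
move=> h0; apply: L2mB => //; apply: L2mcZ; apply: L2mB => //.
exact: semigroup_L2m.
Qed.

Let quot_cvg : nrm nu (quot h) @[h --> 0^'+] --> 0.
Proof.
apply: L2norm_cvg0; last by apply/(semigroup_generator hS) => //; exact/L2P.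
by apply: filterS near_right_ge0 => h h0; exact: Lquot.
Qed.

(** The semigroup commutes with its difference quotients. This identity yields both the invariance
    of the domain and the derivative of orbits. *)
Let quot_orbit s h : 0 <= s -> 0 <= h ->
  ae_eq nu setT (S s (quot h))
    (fun v => (h^-1)%:C%C * (S s f v - S (s + h) f v) - S s g v).
Proof.
move=> s0 h0; have LSh := semigroup_L2m h0 Lf.
have Lfh : L2m nu (fun v => f v - S h f v) by exact: L2mB.
have h1 := semigroup_comb (h^-1)%:C%C (-1) s0 Lfh Lg.
have -> : quot h = (fun v => (h^-1)%:C%C * (f v - S h f v) + -1 * g v).
  by apply/funext => v; rewrite /quot mulN1r.
have h2 := semigroup_sub s0 Lf LSh.
have h3 := semigroup_add s0 h0 Lf.
apply: filterS3 h1 h2 h3 => v /= h1 h2 h3 _.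
by rewrite h1// h2// h3// mulN1r.
Qed.

(** The quotient at [S s f] is [S s] applied to the quotient at [f], so it converges by
    contractivity; [semigroup_generator] converts this back into membership in the graph. *)
Lemma orbit_generator s : 0 <= s -> op_graph k (S s f) (S s g).
Proof.
move=> s0; have LSf := semigroup_L2m s0 Lf; have LSg := semigroup_L2m s0 Lg.
apply/(semigroup_generator hS); [exact/L2P|exact/L2P|].
have near_L2 : \forall h \near (0 : R)^'+,
    L2m nu (fun v => (h^-1)%:C%C * (S s f v - S h (S s f) v) - S s g v).
  apply: filterS near_right_ge0 => h h0; apply: L2mB => //; apply: L2mcZ.
  by apply: L2mB => //; exact: semigroup_L2m.
apply: nrm_cvg0 => //.
apply: cvg0_le quot_cvg; apply: filterS2 near_right_ge0 near_L2 => h h0 Lh.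
rewrite nrm_ge0/=; apply: le_trans (semigroup_nrm s0 (Lquot h0)).
rewrite le_eqVlt; apply/orP; left; apply/eqP.
apply: nrm_ae => //; first by apply: semigroup_L2m => //; exact: Lquot.
have h1 := quot_orbit s0 h0; have h2 := semigroup_add h0 s0 Lf.
apply: filterS2 h1 h2 => v /= h1 h2 _.
by rewrite h1// -h2// [h + s]addrC.
Qed.

(** The generator gives the derivative from the right. For a step [- l] the error is
    [- S (- l + s) (quot l)] plus the increment of the orbit of [g] between [- l + s] and [s]: the
    first is small by contractivity, the second by continuity. *)
Lemma orbit_deriv s : 0 < s ->
  L2deriv nu (orbit f) (fun v => - orbit g s v) s.
Proof.
move=> s0; have s0' := ltW s0; apply/cvgrPdist_lt => e e0.
have e2 : 0 < e / 2 by rewrite divr_gt0.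
have [d d0 hd] := orbit_small Lg e2.
have : \forall h \near 0^'+, nrm nu (quot h) < e / 2 by apply: (cvgr_lt 0).
move=> /near_right_delta[d' d'0 hd'].
have near0 : \forall h \near (0 : R)^', [/\ h != 0, `|h| < s, `|h| < d & `|h| < d'].
  have nd (e1 : R) : 0 < e1 -> \forall h \near (0 : R)^', `|h| < e1.
    move=> p; apply: nbhs_dnbhs; apply/nbhs_ballP; exists e1 => //= x.
    by rewrite /ball/= sub0r normrN.
  have nz : \forall h \near (0 : R)^', h != 0 by exact: nbhs_dnbhs_neq.
  have n3 : \forall h \near (0 : R)^', `|h| < s /\ (`|h| < d /\ `|h| < d').
    by apply: filterI; [exact: nd|apply: filterI; exact: nd].
  by apply: filterS2 nz n3 => h hz [h1 [h2 h3]]; split.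
apply: filterS near0 => h [h0 hs hhd hhd'].
rewrite sub0r normrN ger0_norm ?nrm_ge0//.
have [hpos|hneg] := ltP 0 h.
  rewrite /orbit !max_l//; last by rewrite addr_ge0// ltW.
  have hh : `|h| = h by rewrite gtr0_norm.
  rewrite hh in hhd hhd'.
  have Lq := Lquot (ltW hpos).
  apply: (@le_lt_trans _ _ (nrm nu (quot h))); last first.
    by apply: lt_trans (hd' h _) _; [rewrite hpos|lra].
  apply: le_trans (semigroup_nrm s0' Lq).
  rewrite -[leRHS]nrmN; last exact: semigroup_L2m.
  rewrite le_eqVlt; apply/orP; left; apply/eqP; apply: nrm_ae.
  - apply: L2mB; last by apply: L2mN; exact: semigroup_L2m.
    by apply: L2mcZ; apply: L2mB; apply: semigroup_L2m => //;
       rewrite addr_ge0// ltW.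
  - by apply: L2mN; exact: semigroup_L2m.
  - have h1 := quot_orbit s0' (ltW hpos).
    apply: filterS h1 => v /= h1 _; rewrite h1//.
    by rewrite [s + h]addrC; ring.
have hn : h < 0 by rewrite lt_neqAle h0.
pose l := - h; have l0 : 0 < l by rewrite /l oppr_gt0.
have hl : h = - l by rewrite /l opprK.
have hh : `|h| = l by rewrite ltr0_norm.
rewrite hh in hs hhd hhd'; rewrite hl /orbit.
have sl : 0 <= - l + s by lra.
rewrite !max_l//.
have Lq := Lquot (ltW l0).
have LSg := semigroup_L2m s0' Lg.
have LSlg := semigroup_L2m sl Lg.
have LSq := semigroup_L2m sl Lq.
have b1 : nrm nu (fun v => S s g v - S (- l + s) g v) < e / 2.
  have := orbit_sub_le sl (ltW l0) Lg; rewrite addrAC addNr add0r.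
  by move/le_lt_trans; apply; apply: hd; rewrite ltW.
have b2 : nrm nu (fun v => - S (- l + s) (quot l) v) < e / 2.
  rewrite nrmN//; apply: le_lt_trans (semigroup_nrm sl Lq) _.
  by apply: hd'; rewrite l0.
have b3 : nrm nu (fun v => - S (- l + s) (quot l) v +
    (S s g v - S (- l + s) g v)) < e.
  apply: le_lt_trans (nrmD (L2mN LSq) (L2mB LSg LSlg)) _.
  by rewrite (splitr e) ltrD.
apply: le_lt_trans b3; rewrite le_eqVlt; apply/orP; left; apply/eqP.
apply: nrm_ae.
- apply: L2mB; last exact: L2mN.
  by apply: L2mcZ; apply: L2mB; exact: semigroup_L2m.
- by apply: L2mD; [exact: L2mN|exact: L2mB].
have h1 := quot_orbit sl (ltW l0).
apply: filterS h1 => v /= h1 _; rewrite h1//.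
rewrite (_ : - l + s + l = s); last by ring.
by rewrite invrN rmorphN; ring.
Qed.

End generator_orbit.

End orbit.

(** * The scalar Duhamel equation *)

Section duhamel.
Context {R : realType}.
Local Notation leb := (@lebesgue_measure R).
Variables (x kap : R -> R) (V B : R).
Hypotheses (mkap : measurable_fun setT kap) (Bkap : forall s, `|kap s| <= B).
Hypothesis xE : forall t, 0 <= t -> x t = expR (- (t * V)) * x 0
  + \int[leb]_(s in `[0, t]) (expR (- ((t - s) * V)) * kap s).

(** The integrating factor: in terms of [g] the equation reads
    [x t = expR (- (t * V)) * (x 0 + G t)], where time enters the integral only through its upper
    end. *)
Let g s := expR (s * V) * kap s.

Let mg : measurable_fun setT g.
Proof.
apply: measurable_funM => //; apply: measurable_expR_comp.
exact: measurable_funM.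
Qed.

Let ig u : leb.-integrable `[0, u] (EFin \o g).
Proof.
have fin : (leb (`[0%R, u]%classic : set R) < +oo)%E.
  rewrite lebesgue_measure_itv.
  by case: ifPn => _; rewrite ?ltry// -EFinB ltry.
apply: measurable_bounded_integrable => //.
- exact: measurable_funTS.
- exists (expR (u * `|V|) * B); split; first exact: num_real.
  move=> M hM s /=; rewrite in_itv/= => /andP[s0 su]; apply: ltW.
  apply: le_lt_trans hM; rewrite normrM; apply: ler_pM => //.
  rewrite ger0_norm ?expR_ge0// ler_expR.
  apply: (@le_trans _ _ (s * `|V|)); first by rewrite ler_wpM2l// ler_norm.
  by rewrite ler_wpM2r.
Qed.

Let G t := \int[leb]_(s in `[0, t]) g s.

Let xG t : 0 <= t -> x t = expR (- (t * V)) * (x 0 + G t).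
Proof.
move=> t0; rewrite xE// mulrDr; congr (_ + _).
rewrite /G -RintegralZl//; apply: eq_Rintegral => s _.
rewrite /g mulrA -expRD; congr (expR _ * _); ring.
Qed.

Let cG : continuous (fun t : R => G (Num.max t 0)).
Proof.
move=> t; pose u := `|t| + 1.
have cW : {within `[0, u], continuous G}.
  have u0 : 0 <= u by rewrite addr_ge0.
  exact: (parameterized_integral_continuous u0 (ig u)).
have u0 : 0 < u by rewrite ltr_wpDl.
have tu : t < u by rewrite (le_lt_trans (ler_norm t))// ltrDl.
have [c1 c2 c3] := (continuous_within_itvP G u0).1 cW.
have [t0|[t0|t0]] : t < 0 \/ (0 < t \/ t = 0) by case: (ltgtP t 0); auto.
- apply: cvg_near_cst; near=> z; rewrite (max_r (ltW t0)) max_r// ltW//.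
  by near: z; exact: lt_nbhsl.
- have ct : {for t, continuous G} by apply: c1; rewrite in_itv/= t0 tu.
  rewrite /continuous_at (max_l (ltW t0)).
  apply: cvg_trans ct; apply: near_eq_cvg; near=> z; rewrite max_l// ltW//.
  by near: z; exact: lt_nbhsr.
- rewrite t0 /continuous_at maxxx; apply/cvgrPdist_lt => e e0.
  move/cvgrPdist_lt : c2 => /(_ _ e0)[d /= d0 hd].
  apply/nbhs_ballP; exists d => //= z; rewrite /ball/= sub0r normrN => zd.
  have [z0|z0] := leP z 0; first by rewrite subrr normr0.
  by apply: hd => //=; rewrite sub0r normrN.
Unshelve. all: by end_near. Qed.

Definition extend_left (y : R -> R) t := y (Num.max t 0).

Lemma duhamel_continuous : continuous (extend_left x).
Proof.
have cm : continuous (fun t : R => Num.max t 0).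
  by move=> t; apply: continuous_max; [exact: cvg_id|exact: cvg_cst].
have -> : extend_left x =
    (fun t : R => expR (- (Num.max t 0 * V)) * (x 0 + G (Num.max t 0))).
  by apply/funext => t; rewrite /extend_left xG// le_max lexx orbT.
move=> t; apply: cvgM.
  apply: (@continuous_comp _ _ _ (fun t : R => - (Num.max t 0 * V)) expR).
    by apply: cvgN; apply: cvgM; [exact: cm|exact: cvg_cst].
  exact: continuous_expR.
by apply: cvgD; [exact: cvg_cst|exact: cG].
Qed.

Lemma duhamel_derive t : 0 < t -> {for t, continuous kap} ->
  is_derive t 1 (extend_left x) (kap t - V * x t).
Proof.
move=> t0 ck.
have cg : {for t, continuous g}.
  apply: cvgM => //.
  apply: (@continuous_comp _ _ _ (fun t : R => t * V) expR).
    by apply: cvgM; [exact: cvg_id|exact: cvg_cst].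
  exact: continuous_expR.
have tu : t < t + 1 by rewrite ltrDl.
have [dG G'] := continuous_FTC1_closed tu (ig (t + 1)) t0 cg.
have DG : is_derive t 1 G (g t).
  by apply: DeriveDef; [exact: dG|rewrite -derive1E; exact: G'].
have dE : is_derive t 1 (fun t : R => expR (- (t * V)))
    (expR (- (t * V)) * - V).
  apply: (@is_derive1_comp _ expR (fun t => - (t * V))).
  by apply: is_derive_eq; rewrite /GRing.scale/=; ring.
have D : is_derive t 1 (fun t : R => expR (- (t * V)) * (x 0 + G t))
    (kap t - V * x t).
  apply: is_derive_eq.
  rewrite (xG (ltW t0)) /g /GRing.scale/=.
  rewrite (_ : expR (t * V) = (expR (- (t * V)))^-1); last by rewrite expRN invrK.
  by field; rewrite gt_eqF// expR_gt0.
have nE : \forall z \near t, extend_left x z = expR (- (z * V)) * (x 0 + G z).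
  near=> z; have z0 : 0 < z by near: z; exact: lt_nbhsr.
  by rewrite /extend_left (max_l (ltW z0)); exact: xG (ltW z0).
by apply: near_eq_is_derive D; apply: filterS nE => z ->.
Unshelve. all: by end_near. Qed.

End duhamel.

Section regular_solution.
Context {R : realType} (p : params R).
Local Notation leb := (@lebesgue_measure R).
Variables (e : R) (psi0 : R -> R[i]) (phi : R -> R -> R[i]).
Hypotheses (e0 : 0 < e) (hphi : is_reg_solution p e psi0 phi).
Implicit Types (s t v w : R).

Local Notation K := (K3eps p e).
Local Notation V := (Veps p e).

(** The solution is unspecified at negative times; it is frozen there at its initial value, as
    [orbit] is. *)
Definition time_extend (f : R -> R -> R[i]) s := f (Num.max s 0).
Local Notation Phi := (time_extend phi).

Lemma reg_bound : exists2 M : R, 0 <= M &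
  forall s v, Cabs (Phi s v) <= M * Gamma_tilde p v.
Proof.
have bnd := reg_bounded hphi.
set S := ereal_sup _ in bnd.
have le_S s : 0 <= s -> (Xnorm p (phi s) <= S)%E.
  by move=> s0; apply: ereal_sup_ubound; exists s.
have S0 : (0 <= S)%E by apply: le_trans (le_S 0 (lexx 0)); exact: Xnorm_ge0.
exists (fine S) => [|s v]; first exact: fine_ge0.
apply: Xnorm_le; rewrite fineK ?ge0_fin_numE//.
by apply: le_S; rewrite le_max lexx orbT.
Qed.

Lemma cmeasurable_reg s : cmeasurable setT (Phi s).
Proof.
apply: ccontinuous_cmeasurable.
by have [] := reg_in_X hphi (_ : 0 <= Num.max s 0); rewrite ?le_max ?lexx ?orbT.
Qed.

Lemma cmeasurable_reg_joint :
  cmeasurable setT (fun z : R * R => Phi z.1 z.2).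
Proof.
have [m1 m2] := reg_measurable hphi.
have mD : measurable ([set t : R | 0 <= t] `*` [set: R]).
  apply: measurableX => //; rewrite -set_itvcy; exact: measurable_itv.
have mg : measurable_fun setT (fun z : R * R => (Num.max z.1 0, z.2)).
  apply/measurable_fun_pairP; split => /=.
    by apply: measurable_maxr => //; exact: measurable_fst.
  exact: measurable_snd.
have sub : (fun z : R * R => (Num.max z.1 0, z.2)) @` setT `<=`
    [set t : R | 0 <= t] `*` [set: R].
  by move=> _ [z _ <-]; split => //=; rewrite le_max lexx orbT.
split.
  exact: (measurable_comp mD sub m1 mg).
exact: (measurable_comp mD sub m2 mg).
Qed.

Lemma reg_L2m s : L2m nu (Phi s).
Proof.
have [M M0 hM] := reg_bound.
exact: L2m_Xbound (cmeasurable_reg s) (hM s).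
Qed.

Lemma reg_opbound : exists2 C : R, 0 <= C & forall s, opbound K (Phi s) C.
Proof.
have [M M0 hM] := reg_bound; have [C C0 hC] := opbound_K3eps p e0.
exists (M * C) => [|s]; first exact: mulr_ge0.
exact: hC (cmeasurable_reg s) (hM s).
Qed.

Lemma reg_initial : phi 0 = psi0.
Proof.
apply/funext => v; rewrite (reg_duhamel hphi)// mul0r oppr0 expR0 mul1r.
rewrite set_itv1 /cintegral !Rintegral_set1.
by rewrite addr0.
Qed.

Lemma measurable_pair_weight v : measurable_fun setT (pair_weight v).
Proof.
apply: measurable_funM; apply: measurable_funD => //;
  apply: measurable_expR_comp; do ?apply: measurable_opp_comp;
  apply: measurable_funM => //; first exact: measurable_minr.
exact: measurable_maxr.
Qed.

Lemma measurable_Ksect v : measurable_fun setT (fun w => K v w).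
Proof. exact: measurable_K3eps. Qed.

Lemma integrable_K_weight v :
  nu.-integrable setT (EFin \o (fun w => K v w * pair_weight v w)).
Proof.
have [C C0 hC] := integral_K3eps_le p e0.
apply/integrableP; split.
  apply/measurable_EFinP; apply: measurable_funM.
    exact: measurable_Ksect.
  exact: measurable_pair_weight.
under eq_integral => w _.
  rewrite /= ger0_norm; last first.
    exact: mulr_ge0 (K3eps_ge0 p v w e0) (pair_weight_ge0 v w).
  over.
by apply: le_lt_trans (hC v) _; rewrite ltry.
Qed.

Lemma integrable_K v : nu.-integrable setT (EFin \o (fun w => K v w)).
Proof.
apply: le_integrable (integrable_K_weight v) => //.
  by apply/measurable_EFinP; exact: measurable_Ksect.
move=> w _ /=; rewrite lee_fin [leRHS]normrM ler_peMr ?normr_ge0//.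
by rewrite (ger0_norm (pair_weight_ge0 v w)) pair_weight_ge1.
Qed.

(** * Time regularity of the real and imaginary parts at a fixed point *)

Section component.
(** Instantiated by [complex.Re] and [complex.Im]; the hypotheses list the properties shared by
    both. *)
Variable c : R[i] -> R.
Hypotheses (cZ : forall (r : R) z, c (r%:C%C * z) = r * c z)
  (cB : forall z z' : R[i], c (z - z') = c z - c z')
  (cD : forall z z' : R[i], c (z + z') = c z + c z')
  (c_abs : forall z, `|c z| <= Cabs z)
  (mc : measurable_fun setT (fun z : R * R => c (Phi z.1 z.2)))
  (c_nu : forall f : R -> R[i],
    c (cintegral nu setT f) = \int[nu]_x c (f x))
  (c_leb : forall t (f : R -> R[i]),
    c (cintegral leb `[0, t] f) = \int[leb]_(x in `[0, t]) c (f x)).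

Let mc_sect s : measurable_fun setT (fun w => c (Phi s w)).
Proof. exact: (measurableT_comp mc (pair1_measurable s)). Qed.

Let kap v s := \int[nu]_w (K v w * c (Phi s w)).

Let kap_dom : exists2 B : R, 0 <= B & forall v s w,
  `|K v w * c (Phi s w)| <= B * (K v w * pair_weight v w).
Proof.
have [M M0 hM] := reg_bound; have [D D0 hD] := Gamma_tilde_le p.
exists (M * D) => [|v s w]; first exact: mulr_ge0.
rewrite normrM (ger0_norm (K3eps_ge0 p v w e0)) mulrCA.
rewrite ler_wpM2l ?K3eps_ge0//; apply: le_trans (c_abs _) _.
apply: le_trans (hM s w) _; rewrite -mulrA ler_wpM2l//.
by have [_] := hD v w.
Qed.

Let kap_integrable v s :
  nu.-integrable setT (EFin \o (fun w => K v w * c (Phi s w))).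
Proof.
have [B B0 hB] := kap_dom.
apply: le_integrable (integrableZl measurableT B (integrable_K_weight v)) => //.
  by apply/measurable_EFinP; apply: measurable_funM => //; exact: measurable_Ksect.
move=> w _; rewrite /= lee_fin (le_trans (hB v s w))//.
by rewrite ler_norm.
Qed.

Let measurable_kap v : measurable_fun setT (kap v).
Proof.
apply: (measurable_partial_integral nu
  (f := fun z : R * R => K v z.2 * c (Phi z.1 z.2))).
apply: measurable_funM => //.
exact: (measurableT_comp (measurable_Ksect v) measurable_snd).
Qed.

Let kap_bounded v : exists B : R, forall s, `|kap v s| <= B.
Proof.
have [B B0 hB] := kap_dom.
exists (\int[nu]_w (B * (K v w * pair_weight v w))) => s.
apply: le_trans (le_normr_Rintegral _ (kap_integrable v s)) _ => //.
apply: le_Rintegral => //.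
  exact: integrable_norm (kap_integrable v s).
by have := integrableZl measurableT B (integrable_K_weight v).
Qed.

Let c_Keps v s : c (Keps p e (Phi s) v) = kap v s.
Proof. by rewrite /Keps c_nu; apply: eq_Rintegral => w _; rewrite cZ. Qed.

Let c_Lop v s : c (Lop K (Phi s) v) = V v * c (Phi s v) - kap v s.
Proof.
rewrite /Lop c_nu /Veps -RintegralZr//; last exact: integrable_K.
rewrite -RintegralB//.
  by apply: eq_Rintegral => w _; rewrite cZ cB mulrBr.
have := integrableZr measurableT (c (Phi s v)) (integrable_K v).
by move=> h; apply: (eq_integrable measurableT _ _ _ h) => w _.
Qed.

Let duhamel v t : 0 <= t -> c (phi t v) = expR (- (t * V v)) * c (phi 0 v) +
  \int[leb]_(s in `[0, t]) (expR (- ((t - s) * V v)) * kap v s).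
Proof.
move=> t0; rewrite {1}(reg_duhamel hphi)// cD cZ reg_initial; congr (_ + _).
rewrite c_leb; apply: eq_Rintegral => s; rewrite inE/= in_itv/= => /andP[s0 _].
by rewrite cZ -c_Keps /time_extend max_l.
Qed.

Lemma component_continuous v : continuous (fun s => c (Phi s v)).
Proof.
have [B hB] := kap_bounded v.
exact: (duhamel_continuous (x := fun t => c (phi t v)) (measurable_kap v)
  hB (duhamel v)).
Qed.

(** A bootstrap: a bounded measurable [kap] already makes the solution continuous in time. Dominated
    convergence, with a majorant independent of time, then makes [kap] continuous, which is what
    differentiating the Duhamel integral requires. *)
Let kap_continuous v : continuous (kap v).
Proof.
move=> s; have [B B0 hB] := kap_dom.
have := @continuity_under_integral R _ _ nu (fun s w => K v w * c (Phi s w)) setT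
  measurableT (s - 1) (s + 1) _ _
  (fun w => B * (K v w * pair_weight v w)) _ _.
apply.
- by move=> t _; exact: kap_integrable.
- apply: aeW => w _ t _; apply: cvgM; first exact: cvg_cst.
  exact: component_continuous.
- by have := integrableZl measurableT B (integrable_K_weight v).
- by move=> t _; apply: aeW => w _; exact: hB.
- by rewrite inE/= in_itv/= ltrBlDr ltrDl ltr01.
Qed.

Lemma component_Lop_continuous v : continuous (fun s => c (Lop K (Phi s) v)).
Proof.
under eq_fun do rewrite c_Lop.
move=> s; apply: cvgB; last exact: kap_continuous.
by apply: cvgM; [exact: cvg_cst|exact: component_continuous].
Qed.

Lemma component_derive v t : 0 < t ->
  is_derive t 1 (fun s => c (Phi s v)) (- c (Lop K (Phi t) v)).
Proof.
move=> t0; have [B hB] := kap_bounded v.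
have D := duhamel_derive (x := fun t => c (phi t v)) (measurable_kap v)
  hB (duhamel v) t0 (@kap_continuous v t).
apply: (is_derive_eq D).
by rewrite c_Lop opprB /time_extend max_l// ltW.
Qed.

(** The mean value theorem on nonnegative times, transferred to all times since truncation at 0 is a
    contraction. It supplies the majorant of the difference quotients in [L2deriv_pointwise]. *)
Lemma component_lipschitz v (B : R) :
  (forall s, Cabs (Lop K (Phi s) v) <= B) ->
  forall s t, `|c (Phi t v) - c (Phi s v)| <= B * `|t - s|.
Proof.
move=> hB; have B0 : 0 <= B by apply: le_trans (hB 0); exact: Cabs_ge0.
have H s t : 0 <= s -> s <= t ->
    `|c (Phi t v) - c (Phi s v)| <= B * `|t - s|.
  move=> s0 st.
  have dP x : x \in `]s, t[ ->
      is_derive x 1 (fun s => c (Phi s v)) (- c (Lop K (Phi x) v)).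
    rewrite in_itv/= => /andP[sx _].
    by apply: component_derive; exact: le_lt_trans sx.
  have cP : {within `[s, t], continuous (fun s => c (Phi s v))}.
    by apply: continuous_subspaceT; exact: component_continuous.
  have [x _ ->] := MVT_segment st dP cP.
  rewrite normrM ler_wpM2r// normrN; apply: le_trans (c_abs _) _; exact: hB.
move=> s t; rewrite (_ : Phi t = Phi (Num.max t 0)); last first.
  by rewrite /time_extend; congr phi; rewrite [RHS]max_l// le_max lexx orbT.
rewrite (_ : Phi s = Phi (Num.max s 0)); last first.
  by rewrite /time_extend; congr phi; rewrite [RHS]max_l// le_max lexx orbT.
have s0 : 0 <= Num.max s 0 by rewrite le_max lexx orbT.
have t0 : 0 <= Num.max t 0 by rewrite le_max lexx orbT.
apply: (@le_trans _ _ (B * `|Num.max t 0 - Num.max s 0|)); last first.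
  by rewrite ler_wpM2l// max0_dist.
have [st|ts] := leP (Num.max s 0) (Num.max t 0); first exact: H.
by rewrite distrC (distrC (Num.max t 0)); apply: H => //; exact: ltW.
Qed.

End component.

End regular_solution.

Section envelope_curves.
Context {R : realType}.
Implicit Types (a : R -> R -> R[i]) (s t v h : R).

Lemma Cabs_cvg0 (I : Type) (F : set_system I) (FF : Filter F) (f : I -> R[i]) :
  complex.Re (f i) @[i --> F] --> 0 -> complex.Im (f i) @[i --> F] --> 0 ->
  Cabs (f i) @[i --> F] --> 0.
Proof.
move=> fr fi; have fri := cvgD (cvg_norm fr) (cvg_norm fi).
rewrite normr0 addr0 in fri.
apply: (@cvg0_le _ _ _ FF _ (fun i => `|complex.Re (f i)| + `|complex.Im (f i)|)).
  apply: nearW => i.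
  by rewrite Cabs_ge0/=; exact: Cabs_le_ReIm.
exact: fri.
Qed.

Lemma envelope_scale_sq (C : R) :
  (\int[nu]_v ((C * envelope v) ^+ 2)%:E < +oo)%E.
Proof.
have [_] := L2mcZ C%:C%C (@L2m_envelope R).
apply: le_lt_trans; rewrite le_eqVlt; apply/orP; left; apply/eqP.
apply: eq_integral => v _; congr _%:E.
by rewrite -dotczz /dotc/= !(mul0r, mulr0, subr0, addr0) -expr2.
Qed.

Lemma measurable_envelope_scale (C : R) :
  measurable_fun setT (fun v => C * envelope v).
Proof. by apply: measurable_funM => //; exact: measurable_envelope. Qed.

(** Convergence is tested along sequences avoiding [s], so that dominated convergence applies with a
    multiple of [envelope] as majorant. *)
Lemma L2cont_pointwise a (C : R) : (forall s, cmeasurable setT (a s)) ->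
  (forall s v, Cabs (a s v) <= C * envelope v) ->
  (forall v, continuous (fun s => complex.Re (a s v))) ->
  (forall v, continuous (fun s => complex.Im (a s v))) ->
  forall s, L2cont nu a s.
Proof.
move=> ma aC cr ci s.
pose F t := nrm nu (fun v => a t v - a s v).
have F0 : F s = 0 by rewrite /F; under eq_fun do rewrite subrr; exact: nrm_zero.
have FE : F t @[t --> s^'] --> F s.
  rewrite F0; apply/cvgr_dnbhsP => u [_ us].
  apply: (@cvg_L2_dominated _ _ _ _ (fun n => a (u n)) (a s)
    (fun v => 2 * C * envelope v)) => //.
  - exact: measurable_envelope_scale.
  - exact: envelope_scale_sq.
  - move=> n v; apply: le_trans (CabsB _ _) _.
    apply: le_trans (lerD (aC _ _) (aC _ _)) _.
    by rewrite -[2 * C * _]mulrA mulr_natl mulr2n.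
  - move=> v; apply: Cabs_cvg0.
      under eq_fun do rewrite Re_sub; apply/subr_cvg0.
      exact: (cvg_comp _ _ us (cr v s)).
    under eq_fun do rewrite Im_sub; apply/subr_cvg0.
    exact: (cvg_comp _ _ us (ci v s)).
have : F t @[t --> s] --> F s by apply/continuous_withinNx.
by rewrite F0.
Qed.

Lemma is_derive_cvg_seq (f : R -> R) s (l : R) (u : nat -> R) :
  is_derive s 1 f l -> (forall n, u n != 0) -> u n @[n --> \oo] --> 0 ->
  (u n)^-1 * (f (u n + s) - f s) @[n --> \oo] --> l.
Proof.
move=> [df dfE] u0 uc.
have h : h^-1 *: (f (h *: 1 + s) - f s) @[h --> 0^'] --> l.
  by rewrite -dfE; exact: df.
have := (cvgr_dnbhsP _ 0 l).1 h u (conj u0 uc).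
by under eq_fun do rewrite scaler1.
Qed.

Lemma L2deriv_pointwise a (a' : R -> R[i]) (C : R) s :
  (forall s, cmeasurable setT (a s)) -> cmeasurable setT a' ->
  (forall v, Cabs (a' v) <= C * envelope v) ->
  (forall t v, `|complex.Re (a t v) - complex.Re (a s v)| <=
     C * envelope v * `|t - s|) ->
  (forall t v, `|complex.Im (a t v) - complex.Im (a s v)| <=
     C * envelope v * `|t - s|) ->
  (forall v, is_derive s 1 (fun s => complex.Re (a s v)) (complex.Re (a' v))) ->
  (forall v, is_derive s 1 (fun s => complex.Im (a s v)) (complex.Im (a' v))) ->
  L2deriv nu a a' s.
Proof.
move=> ma ma' a'C lr li dr di; apply/cvgr_dnbhsP => u [u0 uc].
apply: (@cvg_L2_dominated _ _ _ _
  (fun n v => ((u n)^-1)%:C%C * (a (u n + s) v - a s v)) a'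
  (* One [C] for the quotient of each of the real and imaginary parts, and one for [a']. *)
  (fun v => 3 * C * envelope v)) => //.
- move=> n; apply: cmeasurableM; first exact: cmeasurable_cst.
  exact: cmeasurableB.
- exact: measurable_envelope_scale.
- exact: envelope_scale_sq.
- move=> n v; apply: le_trans (CabsB _ _) _.
  have h : Cabs (((u n)^-1)%:C%C * (a (u n + s) v - a s v)) <=
      2 * (C * envelope v).
    rewrite CabsZ normrV ?unitfE// ler_pdivrMl ?normr_gt0//.
    apply: le_trans (Cabs_le_ReIm _) _; rewrite Re_sub Im_sub.
    have h1 := lr (u n + s) v; have h2 := li (u n + s) v.
    rewrite addrK in h1 h2.
    apply: le_trans (lerD h1 h2) _.
    by rewrite (_ : `|u n| * (2 * (C * envelope v)) =
      C * envelope v * `|u n| + C * envelope v * `|u n|)//; ring.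
  apply: le_trans (lerD h (a'C v)) _.
  by rewrite (_ : 3 * C * envelope v = 2 * (C * envelope v) + C * envelope v)//; ring.
- move=> v; apply: Cabs_cvg0.
    under eq_fun do rewrite Re_sub Re_realM Re_sub; apply/subr_cvg0.
    exact: is_derive_cvg_seq (dr v) u0 uc.
  under eq_fun do rewrite Im_sub Im_realM Im_sub; apply/subr_cvg0.
  exact: is_derive_cvg_seq (di v) u0 uc.
Qed.

Lemma le_of_derive_le0 (f df : R -> R) t : continuous f ->
  (forall x : R, 0 < x -> is_derive x 1 f (df x)) ->
  (forall x : R, 0 < x -> df x <= 0) -> 0 <= t -> f t <= f 0.
Proof.
move=> cf hdf df0; rewrite le_eqVlt => /orP[/eqP <-//|t0].
have dP x : x \in `]0, t[ -> is_derive x 1 f (df x).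
  by rewrite in_itv/= => /andP[x0 _]; exact: hdf.
have [x] := MVT t0 dP (continuous_subspaceT cf).
rewrite in_itv/= => /andP[x0 _] E.
by rewrite -subr_le0 E subr0 pmulr_lle0// df0.
Qed.

End envelope_curves.

Section regular_curve.
Context {R : realType} (p : params R).
Variables (e : R) (psi0 : R -> R[i]) (phi : R -> R -> R[i]).
Hypotheses (e0 : 0 < e) (hphi : is_reg_solution p e psi0 phi).
Implicit Types (s t v w : R).

Local Notation K := (K3eps p e).
Local Notation Phi := (time_extend phi).
Local Notation LPhi := (fun s => Lop K (Phi s)).

Let kk : is_kernel K. Proof. exact: is_kernel_K3eps. Qed.
Let LP := reg_L2m hphi.

Let mRe : measurable_fun setT (fun z : R * R => complex.Re (Phi z.1 z.2)).
Proof. by have [] := cmeasurable_reg_joint hphi. Qed.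

Let mIm : measurable_fun setT (fun z : R * R => complex.Im (Phi z.1 z.2)).
Proof. by have [] := cmeasurable_reg_joint hphi. Qed.

Let Re_add (z z' : R[i]) : complex.Re (z + z') = complex.Re z + complex.Re z'.
Proof. exact: raddfD. Qed.

Let Im_add (z z' : R[i]) : complex.Im (z + z') = complex.Im z + complex.Im z'.
Proof. exact: raddfD. Qed.

Lemma reg_Lop_L2m s : L2m nu (LPhi s).
Proof. by have [C _ hC] := reg_opbound e0 hphi; exact: L2m_Lop kk (LP s) (hC s). Qed.

Lemma reg_cont s : L2cont nu Phi s.
Proof.
have [M M0 hM] := reg_bound hphi; have [D D0 hD] := Gamma_tilde_envelope p.
apply: (L2cont_pointwise (C := M * D)).
- exact: cmeasurable_reg hphi.
- by move=> {}s v; apply: le_trans (hM s v) _; rewrite -mulrA ler_wpM2l.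
- move=> v; apply: (component_continuous e0 hphi (c := @complex.Re R)) => //.
  + exact: Re_realM.
  + exact: normRe.
- move=> v; apply: (component_continuous e0 hphi (c := @complex.Im R)) => //.
  + exact: Im_realM.
  + exact: normIm.
Qed.

Lemma reg_Lop_cont s : L2cont nu LPhi s.
Proof.
have [C C0 hC] := reg_opbound e0 hphi.
apply: (L2cont_pointwise (C := 2 * C)).
- by move=> {}s; case: (reg_Lop_L2m s).
- by move=> {}s v; exact: Cabs_Lop_le kk (LP s) (hC s) v.
- move=> v; apply: (component_Lop_continuous e0 hphi (c := @complex.Re R)) => //.
  + exact: Re_realM.
  + exact: Re_sub.
  + exact: normRe.
- move=> v; apply: (component_Lop_continuous e0 hphi (c := @complex.Im R)) => //.
  + exact: Im_realM.
  + exact: Im_sub.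
  + exact: normIm.
Qed.

Lemma reg_deriv s : 0 < s -> L2deriv nu Phi (fun v => - LPhi s v) s.
Proof.
move=> s0; have [C C0 hC] := reg_opbound e0 hphi.
have hL t v := Cabs_Lop_le kk (LP t) (hC t) v.
apply: (L2deriv_pointwise (C := 2 * C)).
- exact: cmeasurable_reg hphi.
- by case: (L2mN (reg_Lop_L2m s)).
- by move=> v; rewrite CabsN.
- move=> t v; apply: (component_lipschitz e0 hphi (c := @complex.Re R)) => //.
  + exact: Re_realM.
  + exact: Re_sub.
  + exact: normRe.
- move=> t v; apply: (component_lipschitz e0 hphi (c := @complex.Im R)) => //.
  + exact: Im_realM.
  + exact: Im_sub.
  + exact: normIm.
- move=> v; rewrite (_ : complex.Re (- _) = - complex.Re (LPhi s v)).
    apply: (component_derive e0 hphi (c := @complex.Re R)) => //.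
    + exact: Re_realM.
    + exact: Re_sub.
    + exact: normRe.
  exact: raddfN.
- move=> v; rewrite (_ : complex.Im (- _) = - complex.Im (LPhi s v)).
    apply: (component_derive e0 hphi (c := @complex.Im R)) => //.
    + exact: Im_realM.
    + exact: Im_sub.
    + exact: normIm.
  exact: raddfN.
Qed.

Lemma reg_form eta s : L2m nu eta -> form K eta (Phi s) = ip nu eta (LPhi s).
Proof. by have [C _ hC] := reg_opbound e0 hphi; exact: form_Lop kk (LP s) (hC s) eta. Qed.

Lemma form_ge0 k (f : R -> R[i]) : 0 <= form k f f.
Proof. by rewrite mulr_ge0 ?ip_ge0// invr_ge0. Qed.

Lemma formC k (f g : R -> R[i]) : form k f g = form k g f.
Proof. by rewrite /form ipC. Qed.

Lemma reg_nrm_le t : 0 <= t -> nrm nu (Phi t) <= nrm nu (Phi 0).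
Proof.
move=> t0; rewrite -ler_sqr ?nnegrE ?nrm_ge0// !nrm_sqr.
apply: (@le_of_derive_le0 _ (fun s => ip nu (Phi s) (Phi s))
  (fun s => ip nu (fun v => - LPhi s v) (Phi s) +
            ip nu (Phi s) (fun v => - LPhi s v))) => //.
- by move=> s; apply: continuous_ip => //; exact: reg_cont.
- move=> s s0; have LL := L2mN (reg_Lop_L2m s).
  by apply: derive_ip => //; [exact: reg_cont|exact: reg_deriv|exact: reg_deriv].
- move=> s s0; rewrite (ipC nu (fun v => - LPhi s v)) ipNr//; last exact: reg_Lop_L2m.
  by rewrite -reg_form// -opprD oppr_le0 addr_ge0// form_ge0.
Qed.

(** The energy is [ip nu (Phi s) (Lop K (Phi s))], but no time derivative of the second factor is at
    hand. By symmetry of the form, its increment is the scalar product of the increment of [Phi]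
    with the sum of the two values of [Lop K (Phi s)], so continuity of the latter suffices. The
    derivative is minus twice the squared norm of [Lop K (Phi s)]. *)
Lemma reg_form_le t : 0 <= t -> form K (Phi t) (Phi t) <= form K (Phi 0) (Phi 0).
Proof.
move=> t0.
have LL := reg_Lop_L2m.
apply: (@le_of_derive_le0 _ (fun s => form K (Phi s) (Phi s))
  (fun s => ip nu (fun v => - LPhi s v) (fun v => LPhi s v + LPhi s v))) => //.
- under eq_fun do rewrite reg_form//.
  by move=> s; apply: continuous_ip => //; [exact: reg_cont|exact: reg_Lop_cont].
- move=> s s0.
  have cvgh : h^-1 *: (form K (Phi (h + s)) (Phi (h + s)) -
      form K (Phi s) (Phi s)) @[h --> 0^'] -->
      ip nu (fun v => - LPhi s v) (fun v => LPhi s v + LPhi s v).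
    have c1 : ip nu (fun v => (h^-1)%:C%C * (Phi (h + s) v - Phi s v))
        (fun v => LPhi (h + s) v + LPhi s v) @[h --> 0^'] -->
        ip nu (fun v => - LPhi s v) (fun v => LPhi s v + LPhi s v).
      apply: cvg_ip.
      - by apply: nearW => h; apply: L2mcZ; exact: L2mB.
      - by apply: nearW => h; exact: L2mD.
      - exact: L2mN.
      - exact: L2mD.
      - exact: reg_deriv.
      - apply: cvg_trans (L2cont_shift (reg_Lop_cont s)); apply: near_eq_cvg.
        apply: nearW => h; congr nrm; apply/funext => v.
        by rewrite opprD addrACA subrr addr0.
    apply: cvg_trans c1; apply: near_eq_cvg; apply: nearW => h.
    (* Symmetry makes the cross terms of the expanded product cancel. *)
    have sym : ip nu (Phi (h + s)) (LPhi s) = ip nu (Phi s) (LPhi (h + s)).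
      by rewrite -!reg_form// formC.
    rewrite (ipZl _ (L2mB (LP _) (LP _)) (L2mD (LL _) (LL _))).
    rewrite (ipBl (LP _) (LP _) (L2mD (LL _) (LL _))).
    rewrite (ipDr (LL _) (LL _) (LP (h + s))) (ipDr (LL _) (LL _) (LP s)).
    rewrite sym (reg_form _ (LP (h + s))) (reg_form _ (LP s)) /GRing.scale/=.
    move: (ip _ _ _) (ip _ _ _) (ip _ _ _) => x y z; ring.
  apply: DeriveDef.
    apply/cvg_ex; eexists; under eq_fun do rewrite scaler1; exact: cvgh.
  rewrite /derive; apply: cvg_lim => //.
  by under eq_fun do rewrite scaler1.
- move=> s s0; rewrite ipC ipNr//; last exact: L2mD.
  by rewrite ipDl// oppr_le0 addr_ge0// ip_ge0.
Qed.

End regular_curve.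

(** * Convergence of the forms *)

Section form_theory.
Context {R : realType}.
Implicit Types (k l : R -> R -> R) (f g : R -> R[i]).
Local Notation nu2 := (nu \x nu)%E.

Lemma formE k f g : is_kernel k -> form k f g = 2^-1 * \int[nu2]_z
  (k z.1 z.2 * dotc (f z.1 - f z.2) (g z.1 - g z.2)).
Proof.
move=> kk; rewrite /form; congr (_ * _); apply: eq_Rintegral => z _.
exact: dotc_dform.
Qed.

Lemma form_integrable k f g : is_kernel k -> formdom k f -> formdom k g ->
  nu2.-integrable setT (EFin \o (fun z =>
    k z.1 z.2 * dotc (f z.1 - f z.2) (g z.1 - g z.2))).
Proof.
move=> kk [_ df] [_ dg].
have h := L2m_dotc df dg.
by apply: (eq_integrable measurableT _ _ _ h) => z _ /=; rewrite dotc_dform.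
Qed.

Lemma formdom_le k l f : is_kernel k -> is_kernel l ->
  (forall u v, k u v <= l u v) -> formdom l f -> formdom k f.
Proof.
move=> kk kl kl_le [Lf [ml fl]]; split => //; have mf : cmeasurable setT f by case: Lf.
split; first exact: cmeasurable_dform.
apply: le_lt_trans fl; apply: ge0_le_integral => //.
- by move=> z _; rewrite lee_fin sqr_ge0.
- by apply/measurable_EFinP; apply: cmeasurable_sq; exact: cmeasurable_dform.
- by apply/measurable_EFinP; exact: cmeasurable_sq.
- by move=> z _; rewrite lee_fin !Cabs_dform// ler_wpM2r ?sqr_ge0.
Qed.

Lemma form_le k l f : is_kernel k -> is_kernel l ->
  (forall u v, k u v <= l u v) -> formdom l f -> form k f f <= form l f f.
Proof.
move=> kk kl kl_le df; have dkf := formdom_le kk kl kl_le df.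
rewrite !formE// ler_wpM2l ?invr_ge0//.
apply: le_Rintegral => //; [exact: form_integrable|exact: form_integrable|].
by move=> z _; rewrite ler_wpM2r ?dotc_ge0.
Qed.

Lemma form_sub_kernel k l f g : is_kernel k -> is_kernel l ->
  is_kernel (fun u v => l u v - k u v) -> (forall u v, k u v <= l u v) ->
  formdom l f -> formdom l g ->
  form (fun u v => l u v - k u v) f g = form l f g - form k f g.
Proof.
move=> kk kl klk kl_le df dg.
have dkf := formdom_le kk kl kl_le df; have dkg := formdom_le kk kl kl_le dg.
rewrite !formE// -mulrBr -RintegralB//; [|exact: form_integrable..].
by congr (_ * _); apply: eq_Rintegral => z _; rewrite mulrBl.
Qed.

Lemma is_kernel_sub k l : is_kernel k -> is_kernel l ->
  (forall u v, k u v <= l u v) -> is_kernel (fun u v => l u v - k u v).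
Proof.
move=> [k0 ks mk] [l0 ls ml] kl; split.
- by move=> u v; rewrite subr_ge0.
- by move=> u v; rewrite ls ks.
- exact: measurable_funB.
Qed.

Lemma form_CS k f g : is_kernel k -> formdom k f -> formdom k g ->
  `|form k f g| <= Num.sqrt (form k f f) * Num.sqrt (form k g g).
Proof.
move=> kk [_ df] [_ dg].
rewrite -sqrtrM; last exact: form_ge0.
rewrite -[leLHS]ger0_norm// -sqrtr_sqr ler_wsqrtr//.
rewrite real_normK ?num_real//.
have E (h x y z : R) : x ^+ 2 <= y * z -> (h * x) ^+ 2 <= h * y * (h * z).
  by move=> xyz; rewrite exprMn [leRHS]mulrACA -expr2 ler_wpM2l ?sqr_ge0.
by apply: E; exact: ip_CS.
Qed.

Lemma dformB k f g : dform k (fun v => f v - g v) =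
  (fun z => dform k f z - dform k g z).
Proof. by apply/funext => z; rewrite /dform -mulrBr; congr (_ * _); ring. Qed.

Lemma formdomB k f g : formdom k f -> formdom k g ->
  formdom k (fun v => f v - g v).
Proof.
move=> [Lf df] [Lg dg]; split; first exact: L2mB.
by rewrite dformB; exact: L2mB.
Qed.

Lemma formBl k f g h : formdom k f -> formdom k g -> formdom k h ->
  form k (fun v => f v - g v) h = form k f h - form k g h.
Proof.
by move=> [_ df] [_ dg] [_ dh]; rewrite /form dformB ipBl// mulrBr.
Qed.

Lemma sqrt_formB k f g : formdom k f -> formdom k g ->
  Num.sqrt (form k f f) <= Num.sqrt (form k g g) +
    Num.sqrt (form k (fun v => f v - g v) (fun v => f v - g v)).
Proof.
move=> [_ df] [_ dg].
have h2 : 0 <= 2^-1 :> R by rewrite invr_ge0.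
rewrite /form !(sqrtrM _ h2) -mulrDr ler_wpM2l ?sqrtr_ge0// dformB.
have E : dform k f = (fun z => dform k g z + (dform k f z - dform k g z)).
  by apply/funext => z; rewrite addrC subrK.
have := nrmD dg (L2mB df dg); rewrite -E; exact.
Qed.

(** As nu is finite, a bounded kernel gives a form continuous on L^2(nu). This is what lets L^2
    convergence pass to truncated energies. *)
Lemma form_bounded k f (B : R) : is_kernel k -> (forall u v, k u v <= B) ->
  L2m nu f ->
  formdom k f /\ form k f f <= 2 * B * fine (nu [set: R]) * nrm nu f ^+ 2.
Proof.
move=> kk kB Lf; have [k0 _ mk] := kk; have mf : cmeasurable setT f by case: Lf.
have B0 : 0 <= B by apply: le_trans (kB 0 0); exact: k0.
have nfin : nu [set: R] \is a fin_num by rewrite ge0_fin_numE// nu_setT_lty.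
have m1 : measurable_fun setT (fun z : R * R => Cabs (f z.1) ^+ 2).
  by apply: cmeasurable_sq; exact: cmeasurable_fst.
have m2 : measurable_fun setT (fun z : R * R => Cabs (f z.2) ^+ 2).
  by apply: cmeasurable_sq; exact: cmeasurable_snd.
have I1 : (\int[nu2]_z (Cabs (f z.1) ^+ 2)%:E =
    (fine (nu [set: R]) * nrm nu f ^+ 2)%:E)%E.
  rewrite (fubini_tonelli1 (fun z : R * R => (Cabs (f z.1) ^+ 2)%:E)); last 2 first.
  - exact/measurable_EFinP.
  - by move=> z; rewrite lee_fin sqr_ge0.
  rewrite /fubini_F; under eq_integral do rewrite /= integral_cst//.
  rewrite ge0_integralZr//; last 2 first.
  - by apply/measurable_EFinP; exact: cmeasurable_sq.
  - by move=> v _; rewrite lee_fin sqr_ge0.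
  by rewrite -eip// nrm_sqr EFinM (fineK nfin) muleC.
have I2 : (\int[nu2]_z (Cabs (f z.2) ^+ 2)%:E =
    (fine (nu [set: R]) * nrm nu f ^+ 2)%:E)%E.
  rewrite (fubini_tonelli2 (fun z : R * R => (Cabs (f z.2) ^+ 2)%:E)); last 2 first.
  - exact/measurable_EFinP.
  - by move=> z; rewrite lee_fin sqr_ge0.
  rewrite /fubini_G; under eq_integral do rewrite /= integral_cst//.
  rewrite ge0_integralZr//; last 2 first.
  - by apply/measurable_EFinP; exact: cmeasurable_sq.
  - by move=> v _; rewrite lee_fin sqr_ge0.
  by rewrite -eip// nrm_sqr EFinM (fineK nfin) muleC.
have le : (\int[nu2]_z (Cabs (dform k f z) ^+ 2)%:E <=
    (2 * (2 * B * fine (nu [set: R]) * nrm nu f ^+ 2))%:E)%E.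
  apply: (@le_trans _ _ (\int[nu2]_z ((2 * B)%:E *
      ((Cabs (f z.1) ^+ 2)%:E + (Cabs (f z.2) ^+ 2)%:E)))%E).
    apply: ge0_le_integral => //.
    - by move=> z _; rewrite lee_fin sqr_ge0.
    - by apply/measurable_EFinP; apply: cmeasurable_sq; exact: cmeasurable_dform.
    - by apply: measurable_funeM; apply: emeasurable_funD; exact/measurable_EFinP.
    - move=> z _; rewrite Cabs_dform// -EFinD -EFinM lee_fin.
      rewrite (mulrC 2) -mulrA; apply: ler_pM => //; first exact: sqr_ge0.
      have h : Cabs (f z.1 - f z.2) ^+ 2 <= (Cabs (f z.1) + Cabs (f z.2)) ^+ 2.
        by rewrite lerXn2r ?nnegrE ?addr_ge0 ?Cabs_ge0// CabsB.
      apply: le_trans h _; have := sqr_ge0 (Cabs (f z.1) - Cabs (f z.2)).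
      by move: (Cabs _) (Cabs _) => x y; rewrite !expr2; lra.
  rewrite ge0_integralZl//; last 3 first.
  - by apply: emeasurable_funD; exact/measurable_EFinP.
  - by move=> z _; rewrite adde_ge0 ?lee_fin ?sqr_ge0.
  - by rewrite lee_fin mulr_ge0.
  rewrite ge0_integralD//; last 4 first.
  - by move=> z _; rewrite lee_fin sqr_ge0.
  - exact/measurable_EFinP.
  - by move=> z _; rewrite lee_fin sqr_ge0.
  - exact/measurable_EFinP.
  rewrite I1 I2 -EFinD -EFinM lee_fin le_eqVlt; apply/orP; left; apply/eqP; ring.
have Ld : L2m nu2 (dform k f).
  split; first exact: cmeasurable_dform.
  by apply: le_lt_trans le _; rewrite ltry.
split => //.
rewrite -eip// lee_fin in le.
by rewrite /form ler_pdivrMl.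
Qed.

End form_theory.

(** * Limits of forms squeezed between truncations and the full kernel *)

Section form_limit.
Context {R : realType}.
Implicit Types (f g u eta : R -> R[i]).
Local Notation nu2 := (nu \x nu)%E.
Variables (K : R -> R -> R) (T : nat -> R -> R -> R) (B : nat -> R).
Hypotheses (kK : is_kernel K) (kT : forall m, is_kernel (T m))
  (T_incr : forall v w, {homo T ^~ v ^~ w : m n / (m <= n)%N >-> m <= n})
  (T_cvg : forall v w, T m v w @[m --> \oo] --> K v w)
  (T_bounded : forall m v w, T m v w <= B m).

Lemma trunc_le m v w : T m v w <= K v w.
Proof.
have h := @nondecreasing_cvgn_le R (T ^~ v ^~ w) (T_incr v w).
have c : cvgn (T ^~ v ^~ w) by apply/cvg_ex; exists (K v w); exact: T_cvg.
by have := h c m; rewrite (cvg_lim _ (@T_cvg v w)).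
Qed.

Lemma trunc_integral_cvg f : cmeasurable setT f ->
  (\int[nu2]_z (Cabs (dform (T m) f z) ^+ 2)%:E @[m --> \oo] -->
   \int[nu2]_z (Cabs (dform K f z) ^+ 2)%:E)%E.
Proof.
move=> mf.
have H z : (((Cabs (dform (T m) f z) ^+ 2)%:E)%E @[m --> \oo] -->
    ((Cabs (dform K f z) ^+ 2)%:E)%E).
  apply: cvg_EFin; first exact: nearW.
  rewrite (_ : fine \o _ = fun m => T m z.1 z.2 * Cabs (f z.1 - f z.2) ^+ 2).
    by rewrite Cabs_dform//; apply: cvgMr_tmp; exact: T_cvg.
  by apply/funext => m /=; rewrite Cabs_dform.
rewrite (_ : (\int[nu2]_z (Cabs (dform K f z) ^+ 2)%:E =
   \int[nu2]_z limn (fun m => (Cabs (dform (T m) f z) ^+ 2)%:E))%E); last first.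
  by apply: eq_integral => z _; apply/esym/cvg_lim => //; exact: H.
apply: cvg_monotone_convergence => //.
- move=> m; apply/measurable_EFinP; apply: cmeasurable_sq.
  exact: cmeasurable_dform.
- by move=> m z _; rewrite lee_fin sqr_ge0.
- move=> z _ m n mn; rewrite lee_fin !Cabs_dform// ler_wpM2r ?sqr_ge0//.
  exact: T_incr.
Qed.

Lemma trunc_formdom f (C : R) : L2m nu f -> (forall m, form (T m) f f <= C) ->
  formdom K f /\ form K f f <= C.
Proof.
move=> Lf fC; have mf : cmeasurable setT f by case: Lf.
have le m : (\int[nu2]_z (Cabs (dform (T m) f z) ^+ 2)%:E <= (2 * C)%:E)%E.
  have [[_ df] _] := form_bounded (kT m) (T_bounded m) Lf.
  by rewrite -eip// lee_fin -ler_pdivrMl//; exact: fC.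
have leK : (\int[nu2]_z (Cabs (dform K f z) ^+ 2)%:E <= (2 * C)%:E)%E.
  have h := trunc_integral_cvg mf.
  rewrite -(cvg_lim _ h)//; apply: lime_le; last by apply: nearW => m; exact: le.
  by apply/cvg_ex; eexists; exact: h.
have dK : L2m nu2 (dform K f).
  split; first exact: cmeasurable_dform.
  by apply: le_lt_trans leK _; rewrite ltry.
split; first by split.
by move: leK; rewrite -eip// lee_fin /form ler_pdivrMl.
Qed.

Lemma trunc_form_cvg f : formdom K f ->
  form (T m) f f @[m --> \oo] --> form K f f.
Proof.
move=> df; have [Lf dK] := df; have mf : cmeasurable setT f by case: Lf.
have h := trunc_integral_cvg mf.
rewrite -eip// in h; move/fine_cvg: h => h.
rewrite /form; apply: cvgMl_tmp.
have E : (fun m => ip nu2 (dform (T m) f) (dform (T m) f)) =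
    fine \o (fun m => \int[nu2]_z (Cabs (dform (T m) f z) ^+ 2)%:E)%E.
  apply/funext => m.
  have [_ dTf] := formdom_le (kT m) kK (trunc_le m) df.
  by rewrite [RHS]/= -eip.
by rewrite E; exact: h.
Qed.

Lemma sqrt_form_trunc_le m f : L2m nu f ->
  Num.sqrt (form (T m) f f) <=
  Num.sqrt (2 * B m * fine (nu [set: R])) * nrm nu f.
Proof.
move=> Lf; have [_ h] := form_bounded (kT m) (@T_bounded m) Lf.
have B0 : 0 <= B m by apply: le_trans (T_bounded m 0 0); case: (kT m).
have c0 : 0 <= 2 * B m * fine (nu [set: R]).
  by rewrite !mulr_ge0// fine_ge0// measure_ge0.
apply: le_trans (ler_wsqrtr h) _.
by rewrite sqrtrM// sqrtr_sqr ger0_norm ?nrm_ge0.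
Qed.

(** The regularized kernels enter through a squeeze: [L n] lies below [K] and, for large [n], above
    each truncation [T m]. *)
Variables (L : nat -> R -> R -> R) (phi : nat -> R -> R[i]).
Variables (u : R -> R[i]) (C : R).
Hypotheses (kL : forall n, is_kernel (L n))
  (L_le : forall n v w, L n v w <= K v w)
  (T_L : forall m, \forall n \near \oo, forall v w, T m v w <= L n v w)
  (dphi : forall n, formdom (L n) (phi n))
  (phiC : forall n, form (L n) (phi n) (phi n) <= C)
  (Lu : L2m nu u)
  (phi_cvg : nrm nu (fun v => phi n v - u v) @[n --> \oo] --> 0).

Let Lphi n : L2m nu (phi n).
Proof. by case: (dphi n). Qed.

Let sqrt_trunc_cvg m :
  Num.sqrt (form (T m) (fun v => phi n v - u v) (fun v => phi n v - u v))
    @[n --> \oo] --> 0.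
Proof.
apply: (@cvg0_le _ _ _ _ _ (fun n =>
  Num.sqrt (2 * B m * fine (nu [set: R])) * nrm nu (fun v => phi n v - u v))).
  apply: nearW => n; rewrite sqrtr_ge0 andTb.
  by apply: sqrt_form_trunc_le; exact: L2mB.
by rewrite -[X in _ --> X](mulr0 (Num.sqrt (2 * B m * fine (nu [set: R])))); exact: cvgMl_tmp.
Qed.

(** Lower semicontinuity of the energy. For fixed [m] the triangle inequality for [T m] bounds the
    root of the truncated energy of [u] by that of [phi n], at most the root of [C], plus a term
    vanishing with the L^2 distance; monotone convergence in [m] concludes. *)
Lemma form_limit_le : formdom K u /\ form K u u <= C.
Proof.
have C0 : 0 <= C by apply: le_trans (phiC 0%N); exact: form_ge0.
apply: trunc_formdom => // m.
rewrite -ler_sqrt//.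
have h : \forall n \near \oo, Num.sqrt (form (T m) u u) - Num.sqrt C <=
    Num.sqrt (form (T m) (fun v => phi n v - u v) (fun v => phi n v - u v)).
  apply: filterS (T_L m) => n Tn.
  have [du _] := form_bounded (kT m) (@T_bounded m) Lu.
  have [dp _] := form_bounded (kT m) (@T_bounded m) (Lphi n).
  rewrite lerBlDl (_ : form (T m) (fun v => phi n v - u v) _ =
    form (T m) (fun v => u v - phi n v) (fun v => u v - phi n v)).
    apply: le_trans (sqrt_formB du dp) _; rewrite lerD2r ler_wsqrtr//.
    by apply: le_trans (phiC n); exact: form_le (kT m) (kL n) Tn (dphi n).
  by rewrite !formE//; congr (_ * _); apply: eq_Rintegral => z _;
     rewrite !dotczz -CabsN; congr (_ * Cabs _ ^+ 2); ring.
by rewrite -subr_le0; exact: (cvgr_to_ge (@sqrt_trunc_cvg m) h).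
Qed.

(** The difference splits into the [T m] form at [phi n - u] and two remainders with the kernels
    [L n - T m] and [K - T m]. Cauchy-Schwarz bounds each remainder by the root of [C] times the
    root of the energy of [eta] missed by [T m]. *)
Lemma form_limit_cvg eta : formdom K eta ->
  form (L n) (phi n) eta @[n --> \oo] --> form K u eta.
Proof.
move=> de; have [du uC] := form_limit_le.
have C0 : 0 <= C by apply: le_trans (phiC 0%N); exact: form_ge0.
pose tail m := form K eta eta - form (T m) eta eta.
have tail_cvg : Num.sqrt (tail m) @[m --> \oo] --> 0.
  rewrite -[X in _ --> X]sqrtr0.
  apply: (continuous_cvg _ (@sqrt_continuous R 0)).
  rewrite -[X in _ --> X](subrr (form K eta eta)).
  by apply: cvgB; [exact: cvg_cst|exact: trunc_form_cvg].
have key m n : (forall v w, T m v w <= L n v w) ->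
  `|form (L n) (phi n) eta - form K u eta| <=
  Num.sqrt (form (T m) (fun v => phi n v - u v) (fun v => phi n v - u v)) *
    Num.sqrt (form K eta eta) + 2 * Num.sqrt C * Num.sqrt (tail m).
  move=> Tn; have kLT := is_kernel_sub (kT m) (kL n) Tn.
  have kKT := is_kernel_sub (kT m) kK (trunc_le m).
  have dLe := formdom_le (kL n) kK (L_le n) de.
  have dTe := formdom_le (kT m) kK (trunc_le m) de.
  have dTu := formdom_le (kT m) kK (trunc_le m) du.
  have dTp := formdom_le (kT m) (kL n) Tn (dphi n).
  have LT_le v w : L n v w - T m v w <= L n v w.
    by rewrite gerBl; case: (kT m).
  have KT_le v w : K v w - T m v w <= K v w.
    by rewrite gerBl; case: (kT m).
  have dLTe := formdom_le kLT (kL n) LT_le dLe.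
  have dLTp := formdom_le kLT (kL n) LT_le (dphi n).
  have dKTe := formdom_le kKT kK KT_le de.
  have dKTu := formdom_le kKT kK KT_le du.
  have -> : form (L n) (phi n) eta - form K u eta =
    form (T m) (fun v => phi n v - u v) eta +
    form (fun v w => L n v w - T m v w) (phi n) eta -
    form (fun v w => K v w - T m v w) u eta.
    rewrite (form_sub_kernel (kT m) (kL n) kLT Tn (dphi n) dLe).
    rewrite (form_sub_kernel (kT m) kK kKT (trunc_le m) du de).
    rewrite (formBl dTp dTu dTe).
    have E (a b c d : R) : a - b = c - d + (a - c) - (b - d) by ring.
    exact: E.
  have b1 := form_CS (kT m) (formdomB dTp dTu) dTe.
  have b2 := form_CS kLT dLTp dLTe.
  have b3 := form_CS kKT dKTu dKTe.
  have t1 := form_le (kT m) kK (trunc_le m) de.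
  have t2 := le_trans (form_le kLT (kL n) LT_le (dphi n)) (phiC n).
  have t5 : form (fun v w => K v w - T m v w) eta eta = tail m.
    by rewrite /tail (form_sub_kernel (kT m) kK kKT (trunc_le m) de de).
  have t3 : form (fun v w => L n v w - T m v w) eta eta <= tail m.
    by rewrite -t5; apply: (form_le kLT kKT _ dKTe) => v w; rewrite lerD2r.
  have t4 := le_trans (form_le kKT kK KT_le du) uC.
  have c1 := le_trans b1 (ler_wpM2l (sqrtr_ge0 _) (ler_wsqrtr t1)).
  have c2 := le_trans b2 (ler_pM (sqrtr_ge0 _) (sqrtr_ge0 _) (ler_wsqrtr t2) (ler_wsqrtr t3)).
  rewrite t5 in b3.
  have c3 := le_trans b3 (ler_wpM2r (sqrtr_ge0 _) (ler_wsqrtr t4)).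
  have E (a b c x y : R) : `|a| <= x -> `|b| <= y -> `|c| <= y ->
      `|a + b - c| <= x + 2 * y.
    move=> ha hb hc; apply: le_trans (ler_normB _ _) _.
    rewrite mulr_natl mulr2n addrA.
    exact: le_trans (lerD (ler_normD _ _) (lexx _)) (lerD (lerD ha hb) hc).
  by rewrite -mulrA; exact: E.
apply/cvgrPdist_lt => e e0; have e2 : 0 < e / 2 by rewrite divr_gt0.
have h1 : 2 * Num.sqrt C * Num.sqrt (tail m) @[m --> \oo] --> 0.
  by rewrite -[X in _ --> X](mulr0 (2 * Num.sqrt C)); exact: cvgMl_tmp.
(* The remainders are bounded uniformly in [n], so [m] can be fixed before [n]. *)
have /cvgrPdist_lt/(_ _ e2)/filter_ex[m hm] := h1.
have h2 : Num.sqrt (form (T m) (fun v => phi n v - u v) (fun v => phi n v - u v)) *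
    Num.sqrt (form K eta eta) @[n --> \oo] --> 0.
  by rewrite -[X in _ --> X](mul0r (Num.sqrt (form K eta eta))); exact: cvgMr_tmp.
have /cvgrPdist_lt/(_ _ e2) h3 := h2.
apply: filterS (filterI (T_L m) h3) => n [Tn hn].
rewrite distrC; apply: le_lt_trans (key m n Tn) _.
rewrite sub0r normrN in hm; rewrite sub0r normrN in hn.
rewrite [ltRHS](splitr e); apply: ltrD.
  by apply: le_lt_trans (ler_norm _) hn.
by apply: le_lt_trans (ler_norm _) hm.
Qed.

End form_limit.

Section truncated_kernel.
Context {R : realType} (p : params R).

(* On the support of [ktrunc m] the kernels [K3eps p e] with [e <= 1/(m+1)]
   coincide with [K3 p]. *)
Definition ktrunc (m : nat) (u v : R) : R :=
  if (K3 p u v <= m%:R) && (eps p m.+1%:R^-1 (Num.max u v) <= `|u - v|)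
  then K3 p u v else 0.

Lemma eps_le e e' w : e <= e' -> eps p e w <= eps p e' w.
Proof. by move=> ee; rewrite /eps ler_wpM2r ?expR_ge0. Qed.

Lemma is_kernel_ktrunc m : is_kernel (ktrunc m).
Proof.
have [K0 Ks mK] := is_kernel_K3 p; split.
- by move=> u v; rewrite /ktrunc; case: ifP.
- by move=> u v; rewrite /ktrunc Ks (distrC u) (maxC u).
- apply: measurable_fun_ifT => //; apply: measurable_and.
    by apply: measurable_fun_ler => //; exact: measurable_cst.
  apply: measurable_fun_ler.
    apply: measurable_funM => //; apply: measurable_expR_comp.
    apply: measurable_funM => //; apply: measurable_maxr => //.
    exact: measurable_maxr.
  by apply: measurable_normr_comp; exact: measurable_funB.
Qed.

Lemma ktrunc_bounded m u v : ktrunc m u v <= m%:R.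
Proof. by rewrite /ktrunc; case: ifP => [/andP[]|]. Qed.

Lemma ktrunc_incr u v : {homo ktrunc ^~ u ^~ v : m n / (m <= n)%N >-> m <= n}.
Proof.
move=> m n mn; rewrite /ktrunc; case: ifP => [/andP[h1 h2]|_]; last first.
  by case: ifP => // _; exact: K3_ge0.
rewrite ifT//; apply/andP; split; first by apply: le_trans h1 _; rewrite ler_nat.
by apply: le_trans h2; apply: eps_le; rewrite lef_pV2 ?posrE// ler_nat.
Qed.

(** Off the diagonal both conditions in [ktrunc] hold for large [m], so the sequence is eventually
    constant; on the diagonal every term is 0. *)
Lemma ktrunc_cvg u v : ktrunc m u v @[m --> \oo] --> K3 p u v.
Proof.
have [->|uv] := eqVneq u v.
  rewrite K3_diag; rewrite (_ : (fun m => _) = fun=> 0); first exact: cvg_cst.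
  by apply/funext => m; rewrite /ktrunc K3_diag; case: ifP.
have d0 : 0 < `|u - v| by rewrite normr_gt0 subr_eq0.
have h : eps p m.+1%:R^-1 (Num.max u v) @[m --> \oo] --> 0.
  rewrite /eps -[X in _ --> X](mul0r (expR (- (par_mu' p / par_gamma0 p) * Num.max (a1 p) (Num.max u v)))).
  by apply: cvgMr_tmp; exact: cvg_harmonic.
have /cvgrPdist_lt/(_ _ d0) h1 := h.
have h2 := nbhs_infty_ger (K3 p u v).
apply: cvg_near_cst; apply: filterS (filterI h1 h2) => m [e1 e2].
rewrite /ktrunc e2/= ifT//.
by rewrite sub0r normrN in e1; exact: le_trans (ler_norm _) (ltW e1).
Qed.

Lemma ktrunc_le_K3eps m e u v : 0 < e -> e <= m.+1%:R^-1 ->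
  ktrunc m u v <= K3eps p e u v.
Proof.
move=> e0 em; rewrite /ktrunc; case: ifP => [/andP[_ h]|_]; last first.
  exact: K3eps_ge0.
by rewrite K3eps_eq// (le_trans _ h)// eps_le.
Qed.

End truncated_kernel.

(** * Comparison of the two evolutions *)

Section integral_inequality.
Context {R : realType}.
Local Notation leb := (@lebesgue_measure R).

Lemma continuous_integrable_itv (g : R -> R) (a b : R) : continuous g ->
  leb.-integrable `[a, b] (EFin \o g).
Proof.
move=> cg; apply: continuous_compact_integrable; first exact: segment_compact.
exact: continuous_subspaceT.
Qed.

(** The mean value theorem is applied to [f] minus the primitive of [g]; [df] itself is never
    integrated. *)
Lemma le_integral_of_derive_le (f df g : R -> R) (t : R) : continuous f ->
  continuous g -> (forall x : R, 0 < x -> is_derive x 1 f (df x)) ->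
  (forall x : R, 0 < x -> df x <= g x) -> 0 <= t ->
  f t <= f 0 + \int[leb]_(s in `[0, t]) g s.
Proof.
move=> cf cg hdf dfg; rewrite le_eqVlt => /orP[/eqP <-|t0].
  by rewrite set_itv1 Rintegral_set1 addr0.
pose G (x : R) : R := \int[leb]_(s in `[0, x]) g s.
have ig u : leb.-integrable `[0, u] (EFin \o g) by exact: continuous_integrable_itv.
have DG (x : R) : 0 < x -> is_derive x 1 G (g x).
  move=> x0; have xu : x < x + 1 by rewrite ltrDl.
  have [dG G'] := continuous_FTC1_closed xu (ig (x + 1)) x0 (cg x).
  by apply: DeriveDef; [exact: dG|rewrite -derive1E; exact: G'].
have dP (x : R) : x \in `]0, t[ -> is_derive x 1 (fun s => f s - G s) (df x - g x).
  by rewrite in_itv/= => /andP[x0 _]; have := hdf _ x0; have := DG _ x0; move=> *; apply: is_deriveB.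
have cF : {within `[0, t], continuous (fun s => f s - G s)}.
  have c1 := parameterized_integral_continuous (ltW t0) (ig t).
  by move=> x; apply: cvgB; [exact: (continuous_subspaceT cf)|exact: c1].
have [x] := MVT t0 dP cF.
rewrite in_itv/= => /andP[x0 _] E.
have G0 : G 0 = 0 by rewrite /G set_itv1 Rintegral_set1.
have h : (f t - G t) - (f 0 - G 0) <= 0.
  by rewrite E subr0 pmulr_lle0// subr_le0 dfg.
by move: h; rewrite G0 /G; move: (f t) (f 0) (\int[_]_(_ in _) _) => x1 x2 x3; clear; lra.
Qed.

Lemma cvg_integral0_bounded (g : nat -> R -> R) (M t : R) :
  (forall n, continuous (g n)) ->
  (forall n (s : R), 0 <= s <= t -> `|g n s| <= M) ->
  (forall s : R, 0 <= s <= t -> g n s @[n --> \oo] --> 0) ->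
  \int[leb]_(s in `[0, t]) g n s @[n --> \oo] --> 0.
Proof.
move=> cg gM g0.
have h := @dominated_cvg _ _ _ leb `[0, t]%classic (measurable_itv _)
  (fun n s => (g n s)%:E) (cst 0%E) (cst M%:E).
rewrite integral0 in h; apply: (fine_cvg (h _ _ _ _ _)).
- move=> n; apply/measurable_EFinP; apply: measurable_funTS.
  exact: continuous_measurable_fun.
- move=> s /=; rewrite in_itv/= => st; apply: cvg_EFin; first exact: nearW.
  exact: g0.
- by [].
- by have := @continuous_integrable_itv (cst M) 0 t (@cst_continuous _ _ M).
- by move=> n s /=; rewrite in_itv/= => st; rewrite lee_fin; exact: gM.
Qed.

End integral_inequality.

Section comparison.
Context {R : realType} (p : params R).
Local Notation leb := (@lebesgue_measure R).
Variables (S : R -> (R -> R[i]) -> R -> R[i]) (psi0 g : R -> R[i]).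
Hypotheses (hS : is_exp_semigroup (K3 p) S) (psi0_g : op_graph (K3 p) psi0 g).
Implicit Types s t : R.

Local Notation eta := (orbit S psi0).
Local Notation gam := (orbit S g).

Lemma orbit_form s : [/\ formdom (K3 p) (eta s), L2m nu (gam s) &
  forall f, formdom (K3 p) f -> ip nu f (gam s) = form (K3 p) f (eta s)].
Proof.
apply: op_graph_form; first exact: is_kernel_K3.
by apply: (orbit_generator hS (is_kernel_K3 p) psi0_g); rewrite le_max lexx orbT.
Qed.

Let dpsi0 : formdom (K3 p) psi0.
Proof. by have [] := op_graph_form (is_kernel_K3 p) psi0_g. Qed.

Let Lpsi0 : L2m nu psi0. Proof. by case: dpsi0. Qed.

Let Lg : L2m nu g.
Proof. by have [] := op_graph_form (is_kernel_K3 p) psi0_g. Qed.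

Lemma orbit_nrm_le f s : L2m nu f -> nrm nu (orbit S f s) <= nrm nu f.
Proof. by move=> Lf; apply: (semigroup_nrm hS) => //; rewrite le_max lexx orbT. Qed.

(** The energy is the scalar product of [eta s] with its image [gam s] under the generator, and both
    are orbits of a contraction semigroup. *)
Lemma orbit_form_le s : form (K3 p) (eta s) (eta s) <= nrm nu psi0 * nrm nu g.
Proof.
have [de Lgam h] := orbit_form s; have [Le _] := de.
rewrite -h//; apply: le_trans (ler_norm _) _; apply: le_trans (ip_le Le Lgam) _.
exact: ler_pM (nrm_ge0 _ _) (nrm_ge0 _ _) (orbit_nrm_le s Lpsi0) (orbit_nrm_le s Lg).
Qed.

Variables (e : R) (phi : R -> R -> R[i]).
Hypotheses (e0 : 0 < e) (hphi : is_reg_solution p e psi0 phi).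
Local Notation Ke := (K3eps p e).
Local Notation Phi := (time_extend phi).

(** The first term stands for E_0(Phi s, eta s): [Phi s] is available in the domain of the
    regularized form, so the pairing with [gam s] is used instead of the form of [K3]. *)
Definition form_gap s := `|ip nu (Phi s) (gam s) - form Ke (Phi s) (eta s)|.

Let kK := is_kernel_K3 p.
Let kKe := is_kernel_K3eps p e0.
Let Ke_le u v : Ke u v <= K3 p u v. Proof. exact: K3eps_le. Qed.
Let LP s : L2m nu (Phi s). Proof. exact: reg_L2m hphi s. Qed.
Let LLP s : L2m nu (Lop Ke (Phi s)). Proof. exact: reg_Lop_L2m e0 hphi s. Qed.
Let Le s : L2m nu (eta s). Proof. by have [[]] := orbit_form s. Qed.
Let Lgam s : L2m nu (gam s). Proof. by have [] := orbit_form s. Qed.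
Let Phi0 : Phi 0 = psi0.
Proof. by rewrite /time_extend maxxx (reg_initial hphi). Qed.

Lemma reg_formdom s : formdom Ke (Phi s).
Proof.
have [C _ hC] := reg_opbound e0 hphi.
exact: (formdom_Lop kKe (LP s) (hC s)).
Qed.

Lemma reg_form_bound s : 0 <= s ->
  form Ke (Phi s) (Phi s) <= form (K3 p) psi0 psi0.
Proof.
move=> s0; apply: le_trans (reg_form_le e0 hphi s0) _; rewrite Phi0.
exact: form_le kKe kK Ke_le dpsi0.
Qed.

Lemma form_gap_continuous : continuous form_gap.
Proof.
move=> s; apply: cvg_norm; apply: cvgB.
  by apply: continuous_ip => //; [exact: @reg_cont _ _ _ _ _ e0 hphi s|exact: @orbit_cont _ _ _ hS g s Lg].
have -> : (fun t => form Ke (Phi t) (eta t)) =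
    (fun t => ip nu (eta t) (Lop Ke (Phi t))).
  by apply/funext => t; rewrite formC (reg_form e0 hphi).
rewrite formC (reg_form e0 hphi) //.
apply: continuous_ip => //; [exact: @orbit_cont _ _ _ hS psi0 s Lpsi0|exact: @reg_Lop_cont _ _ _ _ _ e0 hphi s].
Qed.

Lemma form_gap_le s : 0 <= s -> form_gap s <= nrm nu psi0 * nrm nu g +
  Num.sqrt (form (K3 p) psi0 psi0) * Num.sqrt (nrm nu psi0 * nrm nu g).
Proof.
move=> s0; apply: le_trans (ler_normB _ _) _; apply: lerD.
  apply: le_trans (ip_le (LP s) (Lgam s)) _.
  apply: ler_pM (nrm_ge0 _ _) (nrm_ge0 _ _) _ (orbit_nrm_le s Lg).
  by rewrite -[X in _ <= nrm _ X]Phi0; exact: reg_nrm_le e0 hphi _ s0.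
have [de _ _] := orbit_form s.
apply: le_trans (form_CS kKe (reg_formdom s) (formdom_le kKe kK Ke_le de)) _.
apply: ler_pM (sqrtr_ge0 _) (sqrtr_ge0 _) (ler_wsqrtr (reg_form_bound s0)) _.
exact: ler_wsqrtr (le_trans (form_le kKe kK Ke_le de) (orbit_form_le s)).
Qed.

Lemma orbit_reg_dist t : 0 <= t ->
  nrm nu (fun v => eta t v - Phi t v) ^+ 2 <=
  nrm nu (fun v => eta 0 v - Phi 0 v) ^+ 2 +
  \int[leb]_(s in `[0, t]) (2 * form_gap s).
Proof.
pose d s := ip nu (eta s) (eta s) - (ip nu (eta s) (Phi s) + ip nu (eta s) (Phi s))
  + ip nu (Phi s) (Phi s).
have dE s : nrm nu (fun v => eta s v - Phi s v) ^+ 2 = d s.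
  rewrite nrm_sqr (ipBl (Le s) (LP s) (L2mB (Le s) (LP s))).
  rewrite (ipBr (Le s) (LP s) (Le s)) (ipBr (Le s) (LP s) (LP s)).
  rewrite (ipC nu (Phi s) (eta s)) /d.
  by move: (ip _ _ _) (ip _ _ _) (ip _ _ _) => x y z; ring.
rewrite !dE.
pose N f : R -> R[i] := fun v => - f v.
pose G s := N (gam s); pose H s := N (Lop Ke (Phi s)).
apply: (@le_integral_of_derive_le _ d (fun s => 
   (ip nu (G s) (eta s) + ip nu (eta s) (G s)) -
   ((ip nu (G s) (Phi s) + ip nu (eta s) (H s)) + 
    (ip nu (G s) (Phi s) + ip nu (eta s) (H s))) +
   (ip nu (H s) (Phi s) + ip nu (Phi s) (H s)))).
- have cee : continuous (fun s => ip nu (eta s) (eta s)).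
    by move=> s; apply: continuous_ip => //; exact: @orbit_cont _ _ _ hS psi0 s Lpsi0.
  have cep : continuous (fun s => ip nu (eta s) (Phi s)).
    by move=> s; apply: continuous_ip => //; [exact: @orbit_cont _ _ _ hS psi0 s Lpsi0|exact: @reg_cont _ _ _ _ _ e0 hphi s].
  have cpp : continuous (fun s => ip nu (Phi s) (Phi s)).
    by move=> s; apply: continuous_ip => //; exact: @reg_cont _ _ _ _ _ e0 hphi s.
  move=> s; apply: cvgD; last exact: cpp.
  by apply: cvgB; [exact: cee|apply: cvgD; exact: cep].
- by move=> s; apply: cvgMl_tmp; exact: form_gap_continuous.
- move=> s s0.
  have ce := @orbit_cont _ _ _ hS psi0 s Lpsi0; have cp := @reg_cont _ _ _ _ _ e0 hphi s.
  have De := @orbit_deriv _ _ _ hS _ _ kK psi0_g s s0; have Dp := @reg_deriv _ _ _ _ _ e0 hphi s s0.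
  have LG := L2mN (Lgam s); have LH := L2mN (LLP s).
  have D1 := derive_ip Le Le LG LG ce De De.
  have D2 := derive_ip Le LP LG LH cp De Dp.
  have D3 := derive_ip LP LP LH LH cp Dp Dp.
  exact: is_deriveD (is_deriveB D1 (is_deriveD D2 D2)) D3.
- move=> s s0; have [de _ hform] := orbit_form s.
  have dKe := formdom_le kKe kK Ke_le de; have dP := reg_formdom s.
  have h1 := form_le kKe kK Ke_le de.
  have h2 := form_ge0 Ke (fun v => eta s v - Phi s v).
  rewrite (formBl dKe dP (formdomB dKe dP)) in h2.
  rewrite (formC _ (eta s)) (formC _ (Phi s)) !formBl// in h2.
  rewrite (formC _ (Phi s) (eta s)) in h2.
  have h3 := ler_norm (ip nu (Phi s) (gam s) - form Ke (Phi s) (eta s)).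
  rewrite -/(form_gap s) in h3.
  rewrite /G /H (ipC nu (N (Lop _ _)) _) (ipC nu (N (gam s)) (eta s)) (ipC nu (N (gam s)) (Phi s)).
  rewrite !(ipNr (Lgam s) (Le s)) !(ipNr (Lgam s) (LP s)) !(ipNr (LLP s) (Le s)) !(ipNr (LLP s) (LP s)).
  rewrite (hform _ de) -!(reg_form e0 hphi)//.
  rewrite (formC _ (Phi s) (eta s)) in h3.
  move: h1 h2 h3; move: (form _ _ _) (form _ _ _) (form _ _ _) (form _ _ _) (ip _ _ _) (form_gap s : R).
  move=> a b c f x y h1 h2 h3; rewrite -subr_ge0.
  (* Three nonnegative terms: the excess of E_0 over E_n at [eta s], the energy E_n of
     [eta s - Phi s], and the distance of the gap from its signed value. *)
  have -> : 2 * y - (- c - c - (- x - b + (- x - b)) + (- a - a)) =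
      2 * ((c - f) + (f - b - (b - a)) + (y - (x - b))) by ring.
  apply: mulr_ge0 => //; apply: addr_ge0; last by rewrite subr_ge0.
  by apply: addr_ge0; [rewrite subr_ge0|].
Qed.

End comparison.

(** * Identification of the limit with the semigroup orbit *)

Unset Implicit Arguments.

Theorem theorem2p5 (R : realType) (p : params R) (Tstar : R)
    (hT : is_Tstar p Tstar)
    (S0 : R -> (R -> R[i]) -> R -> R[i]) (hS0 : is_exp_semigroup (K3 p) S0)
    (psi0 : R -> R[i]) (hpsi0 : in_Xbar p psi0)
    (epsn : nat -> R) (epsn_gt0 : forall n, 0 < epsn n)
    (epsn_cvg0 : epsn n @[n --> \oo] --> 0)
    (phi : nat -> R -> R -> R[i])
    (hphi : forall n, is_reg_solution p (epsn n) psi0 (phi n))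
    (psit : R -> R -> R[i])
    (psit_L2 : forall t, 0 <= t <= Tstar -> L2 (psit t))
    (psit_lim : forall t, 0 <= t <= Tstar ->
      L2norm (fun v => phi n t v - psit t v) @[n --> \oo] --> 0%E) :
  forall t, 0 <= t <= Tstar -> ae_eq nu setT (psit t) (S0 t psi0).
Proof.
have kK := is_kernel_K3 p.
have [Lpsi0 [C hC]] := opbound_K3 hpsi0.
have psi0_g := op_graph_Lop kK Lpsi0 hC.
set g := Lop (K3 p) psi0 in psi0_g.
have [dpsi0 Lg _] := op_graph_form kK psi0_g.
pose Phi n := time_extend (phi n).
have LPhi n s : L2m nu (Phi n s) by exact: reg_L2m (hphi n) s.
have PhiE n t : 0 <= t -> Phi n t = phi n t.
  by move=> t0; rewrite /Phi /time_extend (max_l t0).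
have Lpsit t : 0 <= t <= Tstar -> L2m nu (psit t) by move=> tT; apply/L2P; exact: psit_L2.
have Phi_cvg t : 0 <= t <= Tstar ->
    nrm nu (fun v => Phi n t v - psit t v) @[n --> \oo] --> 0.
  move=> tT; have /andP[t0 _] := tT.
  have := psit_lim t tT.
  rewrite (_ : (fun n => L2norm (fun v => phi n t v - psit t v)) =
    (fun n => (nrm nu (fun v => Phi n t v - psit t v))%:E)).
    by move=> /fine_cvg; exact.
  apply/funext => n; rewrite -L2norm_nrm ?PhiE//.
  by rewrite -(PhiE n t t0); apply: L2mB => //; exact: Lpsit.
have gap_cvg s : 0 <= s <= Tstar -> form_gap p S0 psi0 g (epsn n) (phi n) s @[n --> \oo] --> 0.
  move=> sT; have /andP[s0 _] := sT.
  have [de Lgam hform] := orbit_form hS0 psi0_g s.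
  have T_L m : \forall n \near \oo, forall v w, ktrunc p m v w <= K3eps p (epsn n) v w.
    (* The threshold is the parameter built into [ktrunc p m]. *)
    have d0 : 0 < m.+1%:R^-1 :> R by rewrite invr_gt0.
    have /cvgrPdist_lt/(_ _ d0) h := epsn_cvg0.
    apply: filterS h => n; rewrite sub0r normrN (gtr0_norm (epsn_gt0 n)) => h v w.
    exact: ktrunc_le_K3eps (epsn_gt0 n) (ltW h).
  have lim1 := form_limit_le kK (is_kernel_ktrunc p) (@ktrunc_incr _ p) (@ktrunc_cvg _ p)
    (@ktrunc_bounded _ p) (fun n => is_kernel_K3eps p (epsn_gt0 n))
    T_L
    (fun n => reg_formdom (epsn_gt0 n) (hphi n) s)
    (fun n => reg_form_bound psi0_g (epsn_gt0 n) (hphi n) s0) (Lpsit s sT) (Phi_cvg s sT).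
  have lim2 := form_limit_cvg kK (is_kernel_ktrunc p) (@ktrunc_incr _ p) (@ktrunc_cvg _ p)
    (@ktrunc_bounded _ p) (fun n => is_kernel_K3eps p (epsn_gt0 n))
    (fun n v w => K3eps_le p v w (epsn_gt0 n)) T_L
    (fun n => reg_formdom (epsn_gt0 n) (hphi n) s)
    (fun n => reg_form_bound psi0_g (epsn_gt0 n) (hphi n) s0) (Lpsit s sT) (Phi_cvg s sT) de.
  have lim3 : ip nu (Phi n s) (orbit S0 g s) @[n --> \oo] --> ip nu (psit s) (orbit S0 g s).
    apply: cvg_ip => //; [exact: nearW|exact: nearW|exact: Lpsit|exact: Phi_cvg|].
    apply: cvg_near_cst; apply: nearW => n.
    by rewrite -[RHS](@nrm_zero R); congr nrm; apply/funext => v; rewrite subrr.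
  (* The limit has finite energy, so the generator identity can be tested on it; this equates the
     limits of the two terms of the gap. *)
  have [du _] := lim1.
  rewrite -(normr0 R) -(subrr (ip nu (psit s) (orbit S0 g s))).
  apply: cvg_norm; apply: cvgB; first exact: lim3.
  by rewrite (hform _ du).
move=> t tT; have /andP[t0 tTs] := tT.
(* At time 0 the semigroup returns [psi0] only almost everywhere, hence a vanishing norm instead of
   an equality of functions. *)
have d0 n : nrm nu (fun v => orbit S0 psi0 0 v - Phi n 0 v) = 0.
  rewrite -[RHS](@nrm_zero R); apply: nrm_ae; [|exact: L2m0|].
    by apply: L2mB => //; exact: (L2m_orbit hS0).
  rewrite (PhiE n 0 (lexx 0)) (reg_initial (hphi n)) /orbit maxxx.
  have := semigroup0 hS0 ((L2P _).2 Lpsi0).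
  by apply: filterS => v /(_ I) E _; rewrite E subrr.
have dist_cvg : nrm nu (fun v => orbit S0 psi0 t v - Phi n t v) ^+ 2 @[n --> \oo] --> 0.
  apply: (@cvg0_le _ _ _ _ _ (fun n => \int[lebesgue_measure]_(s in `[0, t])
    (2 * form_gap p S0 psi0 g (epsn n) (phi n) s))).
    apply: nearW => n; rewrite sqr_ge0/=.
    have := orbit_reg_dist hS0 psi0_g (epsn_gt0 n) (hphi n) t0.
    by rewrite d0 expr0n/= add0r.
  apply: (@cvg_integral0_bounded _ _ (2 * (nrm nu psi0 * nrm nu g +
    Num.sqrt (form (K3 p) psi0 psi0) * Num.sqrt (nrm nu psi0 * nrm nu g)))).
  - move=> n s; apply: cvgMl_tmp.
    exact: (form_gap_continuous hS0 psi0_g (epsn_gt0 n) (hphi n)).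
  - move=> n s /andP[s0 _]; rewrite normrM ger0_norm// ler_wpM2l//.
    by rewrite normr_id; exact: (form_gap_le hS0 psi0_g (epsn_gt0 n) (hphi n) s0).
  - move=> s /andP[s0 st]; rewrite -(mulr0 2); apply: cvgMl_tmp; apply: gap_cvg.
    by rewrite s0 (le_trans st).
have Lt : L2m nu (S0 t psi0) by exact: (semigroup_L2m hS0).
apply: nrm0_ae_eq => //; first exact: Lpsit.
have orbitE : orbit S0 psi0 t = S0 t psi0 by rewrite /orbit (max_l t0).
have dist_cvg' : nrm nu (fun v => orbit S0 psi0 t v - Phi n t v) @[n --> \oo] --> 0.
  have : Num.sqrt (nrm nu (fun v => orbit S0 psi0 t v - Phi n t v) ^+ 2) @[n --> \oo] --> Num.sqrt (0 : R).
    exact: (continuous_cvg _ (@sqrt_continuous R 0) dist_cvg).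
  rewrite sqrtr0; apply: cvg_trans; apply: near_eq_cvg; apply: nearW => n.
  by rewrite sqrtr_sqr ger0_norm// nrm_ge0.
have sum_cvg : nrm nu (fun v => orbit S0 psi0 t v - Phi n t v) +
    nrm nu (fun v => Phi n t v - psit t v) @[n --> \oo] --> 0.
  by rewrite -[X in _ --> X](addr0 (0 : R)); apply: cvgD => //; exact: Phi_cvg.
(* The norm to be shown zero is independent of [n] and bounded by a sequence tending to 0. *)
apply/eqP; rewrite eq_le nrm_ge0 andbT.
apply: (cvgr_to_ge sum_cvg); apply: nearW => n.
have Lp := Lpsit t tT.
rewrite (nrmBC Lp Lt) orbitE.
have E : (fun v => S0 t psi0 v - psit t v) =
    (fun v => (S0 t psi0 v - Phi n t v) + (Phi n t v - psit t v)).
  by apply/funext => v; rewrite addrA subrK.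
rewrite E; apply: nrmD; exact: L2mB.
Qed.
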